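(* Consider the unknown-scale model with inverse-gamma prior described in the context. Suppose $k_n\sim n^a$ for some $a\in(0,1)$, and that for some $0<\delta<1-a$: (A1) for each $n$ there is $\theta_{0n}=(\theta_{10n},\dots,\theta_{K(n)0n})$ with $\|f_{\theta_{0n}}-f_0\|_2=o(n^{-\delta})$; (A2) $\sum_{i=1}^{K(n)}\theta_{i0n}^2=o(n^{1-\delta})$. Then for every $\epsilon>0$ (and every $\varepsilon>0$), $\pi^*(\mathcal V_\varepsilon^c)=o_{P_0^n}(n^{\epsilon-\delta})$.
   Context: Data: i.i.d. pairs $(y_i,\mathbf x_i)$, $i=1,\dots,n$, with $\mathbf x_i\sim\mathrm{Uniform}[0,1]^p$ ($p$ fixed), $y_i=f_0(\mathbf x_i)+\xi_i$, $\xi_i\sim N(0,\sigma_0^2)$ independent of $\mathbf x_i$, $f_0$ square integrable on $[0,1]^p$, $\sigma_0>0$ unknown. $P_0^n$ is the true data law; $Z_n=o_{P_0^n}(r_n)$ means $Z_n/r_n\to0$ in $P_0^n$-probability; $\|\cdot\|_2$ is the $L_2([0,1]^p)$ norm. $\psi(u)=1/(1+e^{-u})$, $f_{\theta_n}(\mathbf x)=\beta_0+\sum_{j=1}^{k_n}\beta_j\psi(\gamma_{j0}+\sum_{h=1}^p\gamma_{jh}x_h)$, $\theta_n=(\theta_{1n},\dots,\theta_{K(n)n})$ the vector of all parameters, $K(n)$ their number. Parameter $\omega_n=(\theta_n,\sigma^2)$, model density $l_{\omega_n}(y,\mathbf x)=(2\pi\sigma^2)^{-1/2}\exp(-(y-f_{\theta_n}(\mathbf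 x))^2/(2\sigma^2))$, true density $l_0$ the same with $f_0,\sigma_0^2$; $L(\omega_n)=\prod_{i=1}^nl_{\omega_n}(y_i,\mathbf x_i)$. Prior: $p(\omega_n)=\frac{\lambda^\alpha}{\Gamma(\alpha)}(\sigma^{-2})^{\alpha+1}e^{-\lambda/\sigma^2}\prod_{i=1}^{K(n)}(2\pi\zeta^2)^{-1/2}e^{-\theta_{in}^2/(2\zeta^2)}$ with fixed $\alpha,\lambda,\zeta>0$. Posterior $\pi(\omega_n|\mathbf y_n,\mathbf X_n)\propto L(\omega_n)p(\omega_n)$. $d_{KL}(q,p)=\int q\log(q/p)$. Variational family $\mathcal Q_n$: densities $q(\omega_n)=\frac{\tilde b_n^{\tilde a_n}}{\Gamma(\tilde a_n)}(\sigma^{-2})^{\tilde a_n+1}e^{-\tilde b_n/\sigma^2}\prod_{i=1}^{K(n)}N(\theta_{in};\tilde m_{in},\tilde s_{in}^2)$ (inverse-gamma on $\sigma^2$ times independent normals); $\pi^*=\arg\min_{q\in\mathcal Q_n}d_{KL}(q,\pi(\cdot|\mathbf y_n,\mathbf X_n))$. $d_H(l_0,l_{\omega_n})=\int\int(\sqrt{l_{\omega_n}}-\sqrt{l_0})^2dy\,d\mathbf x$, $\mathcal V_\varepsilon=\{\omega_n:d_H(l_0,l_{\omega_n})<\varepsilon\}$. *)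

(* Defs.v *)
(* All objects are over an arbitrary
   R : realType (the reals).  Euclidean spaces R^m are represented by
   m.-tuple R, and the Lebesgue integral over R^m of a nonnegative function is
   the iterated one-dimensional Lebesgue integral (equal to the integral
   against m-dimensional Lebesgue measure by Tonelli for measurable
   integrands).  Signed integrands are split into positive and negative parts. *)
From HB Require Import structures.
From mathcomp Require Import all_boot all_order all_algebra.
From mathcomp Require Import all_classical all_reals all_analysis.
Import Order.TTheory GRing.Theory Num.Theory.

Unset Printing Implicit Defensive.

Local Open Scope ring_scope.
Local Open Scope classical_set_scope.

Fixpoint iint {R : realType} (m : nat) : (m.-tuple R -> \bar R) -> \bar R :=
  match m return (m.-tuple R -> \bar R) -> \bar R with
  | 0 => fun f => f [tuple]
  | m'.+1 => fun f =>
      (\int[@lebesgue_measure R]_x iint m' (fun t : m'.-tuple R => f [tuple of x :: t]))%E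
  end.

Definition iint_signed {R : realType} (m : nat) (f : m.-tuple R -> \bar R) : \bar R :=
  (iint m (fun t => maxe (f t) 0) - iint m (fun t => maxe (- f t) 0))%E.

Definition in_cube {R : realType} (x : seq R) : bool := all (fun u => 0 <= u <= 1) x.

Definition sigmoid {R : realType} (u : R) : R := 1 / (1 + expR (- u)).

Definition Kpar (p k : nat) : nat := (1 + k + k * p.+1)%N.

(* parameter vector theta = (beta_0, beta_1..beta_k,
   gamma_{10},gamma_{11},..,gamma_{1p}, ..., gamma_{k0},..,gamma_{kp}) *)
Definition beta_ {R : realType} (th : seq R) (j : nat) : R := nth 0 th j.
Definition gamma_ {R : realType} (p k : nat) (th : seq R) (j h : nat) : R :=
  nth 0 th (k.+1 + j * p.+1 + h).

(* f_theta(x) = beta_0 + sum_{j=1}^k beta_j psi(gamma_{j0} + sum_h gamma_{jh} x_h)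
   (hidden node j is indexed 0..k-1 below) *)
Definition fnet {R : realType} (p k : nat) (th : seq R) (x : p.-tuple R) : R :=
  beta_ th 0 + \sum_(j < k) beta_ th j.+1 *
     sigmoid (gamma_ p k th j 0 + \sum_(h < p) gamma_ p k th j h.+1 * tnth x h).
Arguments fnet {R} p k th x.

Definition gauss {R : realType} (m v y : R) : R :=
  (Num.sqrt (2 * pi * v))^-1 * expR (- (y - m) ^+ 2 / (2 * v)).

Definition Gammaf {R : realType} (a : R) : R :=
  fine (\int[@lebesgue_measure R]_(t in [set t : R | (0 < t)%R]) (powR t (a - 1) * expR (- t))%R%:E)%E.

Definition invgamma {R : realType} (a b s : R) : R :=
  if 0 < s then (b `^ a / Gammaf a) * (s^-1) `^ (a + 1) * expR (- (b / s)) else 0.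

(* A parameter omega_n = (theta_n, sigma^2) is encoded as the (K+1)-tuple
   sigma^2 :: theta_n ; the parameter space is sigma^2 > 0. *)
Definition sig2 {R : realType} (K : nat) (w : K.+1.-tuple R) : R := thead w.
Definition theta {R : realType} (K : nat) (w : K.+1.-tuple R) : seq R := behead w.

Definition prior {R : realType} (al lam zeta : R) (K : nat) (w : K.+1.-tuple R) : R :=
  invgamma al lam (sig2 K w) * \prod_(i < K) gauss 0 (zeta ^+ 2) (nth 0 (theta K w) i).

(* A data set (y_i, x_i)_{i<n} is encoded as an (n*(p+1))-tuple
   y_0 :: x_0 ++ y_1 :: x_1 ++ ... *)
Definition ydat {R : realType} (p n : nat) (d : (n * p.+1).-tuple R) (i : nat) : R :=
  nth 0 d (i * p.+1).
Definition xdat {R : realType} (p n : nat) (d : (n * p.+1).-tuple R) (i : nat)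
  : p.-tuple R := [tuple nth 0 d (i * p.+1 + h.+1) | h < p].

Definition lik {R : realType} (p k n : nat) (d : (n * p.+1).-tuple R)
  (w : (Kpar p k).+1.-tuple R) : R :=
  \prod_(i < n) gauss (fnet p k (theta _ w) (xdat p n d i)) (sig2 _ w) (ydat p n d i).

Definition post {R : realType} (al lam zeta : R) (p k n : nat)
  (d : (n * p.+1).-tuple R) (w : (Kpar p k).+1.-tuple R) : R :=
  lik p k n d w * prior al lam zeta _ w /
  fine (iint _ (fun w' : (Kpar p k).+1.-tuple R => (lik p k n d w' * prior al lam zeta _ w')%:E)).

Definition p0data {R : realType} (p n : nat) (f0 : p.-tuple R -> R) (s0 : R)
  (d : (n * p.+1).-tuple R) : R :=
  \prod_(i < n) ((in_cube (xdat p n d i))%:R * gauss (f0 (xdat p n d i)) s0 (ydat p n d i)).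

Definition P0n {R : realType} (p n : nat) (f0 : p.-tuple R -> R) (s0 : R)
  (A : set ((n * p.+1).-tuple R)) : \bar R :=
  iint _ (fun d => ((\1_A d : R) * p0data p n f0 s0 d)%:E).

(* pointwise integrand q log (q / r), with 0 log 0 = 0 and q log(q/0) = +oo *)
Definition klterm {R : realType} (q r : R) : \bar R :=
  if q == 0 then 0%E else if r <= 0 then +oo%E else (q * ln (q / r))%:E.

Definition KL {R : realType} (m : nat) (q r : m.-tuple R -> R) : \bar R :=
  iint_signed m (fun w => klterm (q w) (r w)).

(* variational parameters (a~, b~, m~, s~) *)
Definition vparam (R : Type) := (R * R * seq R * seq R)%type.

Definition inQ {R : realType} (K : nat) (v : vparam R) : Prop :=
  [/\ 0 < v.1.1.1, 0 < v.1.1.2, size v.1.2 = K, size v.2 = K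
    & all (fun s => 0 < s) v.2].

Definition qdens {R : realType} (K : nat) (v : vparam R) (w : K.+1.-tuple R) : R :=
  invgamma v.1.1.1 v.1.1.2 (sig2 K w) *
  \prod_(i < K) gauss (nth 0 v.1.2 i) (nth 0 v.2 i ^+ 2) (nth 0 (theta K w) i).

Definition is_vb_minimizer {R : realType} (al lam zeta : R) (p k n : nat)
  (d : (n * p.+1).-tuple R) (v : vparam R) : Prop :=
  inQ (Kpar p k) v /\
  forall v', inQ (Kpar p k) v' ->
    (KL _ (qdens _ v) (post al lam zeta p k n d) <= KL _ (qdens _ v') (post al lam zeta p k n d))%E.

(* d_H(l_0, l_omega) = int_{[0,1]^p} int_R (sqrt l_omega - sqrt l_0)^2 dy dx ;
   the point z = y :: x *)
Definition dH {R : realType} (p k : nat) (f0 : p.-tuple R -> R) (s0 : R)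
  (w : (Kpar p k).+1.-tuple R) : \bar R :=
  iint p.+1 (fun z : p.+1.-tuple R =>
    ((in_cube (behead z))%:R *
     (Num.sqrt (gauss (fnet p k (theta _ w) [tuple of behead z]) (sig2 _ w) (thead z))
      - Num.sqrt (gauss (f0 [tuple of behead z]) s0 (thead z))) ^+ 2)%:E).

Definition L2norm {R : realType} (p : nat) (g : p.-tuple R -> R) : \bar R :=
  poweR (iint p (fun x : p.-tuple R => ((in_cube x)%:R * (g x) ^+ 2)%:E)) (2^-1).

Definition mass_Vc {R : realType} (p k : nat) (f0 : p.-tuple R -> R) (s0 eps : R)
  (v : vparam R) : \bar R :=
  iint _ (fun w : (Kpar p k).+1.-tuple R =>
    (((0 < sig2 _ w) && ~~ (dH p k f0 s0 w < eps%:E)%E)%:R * qdens _ v w)%:E).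

(* Main.v *)
(** Let [post] be the posterior and [A] the event that the Hellinger distance is at
    least [r].  The Donsker-Varadhan inequality applied to [T 1_A] gives, for every [q']
    in the variational family,

      T pi*(A) <= KL(pi*, post) + ln E_post[exp(T 1_A)]
               <= KL(q', post) + ln E_post[exp(T 1_A)],

    and the unknown normalising constant of [post] cancels in the last line.  For [q']
    take normals centred at [theta_{0n}] with standard deviation [n^-4] and an inverse
    gamma law of shape [n] and scale [n sigma_0^2]; then the explicit terms are, up to
    an arbitrarily small power of [n], at most [n^{1-delta}] with probability tending
    to one.  It remains to bound the integral of [prior * lik / lik_0 * exp(T 1_A)]:
    its expectation without the exponential is one; outside a sieve the prior mass
    beats [exp T]; on the sieve the likelihood ratio is controlled by covering it with
    [exp(o(n))] small cells, since the expectation of the square root of the ratio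
    decays like [exp(- n r / 2)].  Dividing by [T = n^{1-e}] with [e] small gives the
    rate. *)
Require Import Defs.
From HB Require Import structures.
From mathcomp Require Import all_boot all_order all_algebra.
From mathcomp Require Import all_classical all_reals all_analysis.
From mathcomp Require Import measurable_realfun ring lra.
Import Order.TTheory GRing.Theory Num.Theory.
Import numFieldNormedType.Exports.
Local Open Scope ring_scope.
Local Open Scope classical_set_scope.

(** * Iterated integrals *)

(** The map [qstar] is an arbitrary selection of minimisers, so the event in the conclusion need not
    be measurable, and [P0n] offers only monotonicity on it. All exceptional events are therefore
    packed into one measurable nonnegative variable, to which Markov's inequality is applied; only
    expectations of nonnegative statistics under the true law are needed. The cross term between
    noise and approximation error is removed by Young's inequality with weight [rho = n^-delta]: the
    noise sum, of order [n], then costs [n^(1-delta)], while the bias sum, of order at most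
    [n^(1-2 delta)], is multiplied by [1/rho] and costs the same. The full noise sum and the term
    [n/2] do not appear, since they cancel, up to a constant, between the true log-likelihood and
    the mean of the model log-likelihood under [q']. The inverse-gamma prior has only a polynomial
    tail at infinity, so the sieve must admit variances up to [exp(4 T / alpha)]; this is affordable
    because the number of cells matters only through its logarithm. *)

Section cons_measure.
Context {R : realType} (m : nat).
Variable mu : {sigma_finite_measure set (m.-tuple R) -> \bar R}.

Definition tcons (z : measurableTypeR R * m.-tuple R) : m.+1.-tuple R :=
  [tuple of z.1 :: z.2].
Definition tuncons (t : m.+1.-tuple R) : measurableTypeR R * m.-tuple R :=
  (thead t, [tuple of behead t]).

Lemma tconsK : cancel tcons tuncons.
Proof. by move=> [x t]; rewrite /tuncons /tcons/= theadE; congr pair; apply/val_inj. Qed.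

Lemma measurable_tcons : measurable_fun setT tcons.
Proof.
have h1 : measurable_fun setT (fun z : measurableTypeR R * m.-tuple R => z.1 : R).
  exact: (@measurable_fst _ _ (measurableTypeR R) (m.-tuple R)).
exact: (@measurable_cons _ _ _ _ _ m snd h1).
Qed.

Lemma measurable_tuncons : measurable_fun setT tuncons.
Proof.
apply/measurable_fun_pair; last exact: measurable_behead.
exact: (measurable_tnth ord0).
Qed.

Definition cons_measure := pushforward (@lebesgue_measure R \x mu)%E tcons.

Let cons0 : cons_measure set0 = 0%E.
Proof. by rewrite /cons_measure /pushforward preimage_set0 measure0. Qed.

Let cons_ge0 A : (0 <= cons_measure A)%E. Proof. by rewrite /cons_measure /pushforward measure_ge0. Qed.

Let cons_sigma_additive : semi_sigma_additive cons_measure.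
Proof.
move=> F mF tF mUF; rewrite /cons_measure /pushforward preimage_bigcup.
have mp B : measurable B -> measurable (tcons @^-1` B).
  by move=> mB; rewrite -[X in measurable X]setTI; exact: measurable_tcons.
apply: measure_semi_sigma_additive.
- by move=> n; exact: mp.
- apply/trivIsetP => /= i j _ _ ij; rewrite -preimage_setI.
  by move/trivIsetP : tF => /(_ _ _ _ _ ij) ->//; rewrite preimage_set0.
- by rewrite -preimage_bigcup; exact: mp.
Qed.

HB.instance Definition _ := isMeasure.Build _ _ _ cons_measure
  cons0 cons_ge0 cons_sigma_additive.

Let cons_sigma_finite : sigma_finite setT cons_measure.
Proof.
have /sigma_finiteP[F [TF ndF Foo]] := sigma_finiteT (@lebesgue_measure R).
have /sigma_finiteP[H [TH ndH Hoo]] := sigma_finiteT mu.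
pose G i := F i `*` H i.
have mG i : measurable (G i) by apply: measurableX; [case: (Foo i)|case: (Hoo i)].
have TG : setT = \bigcup_i G i.
  apply/seteqP; split => // -[x y] _.
  have [i _ Fix] : (\bigcup_i F i) x by rewrite -TF.
  have [j _ Hjy] : (\bigcup_j H j) y by rewrite -TH.
  exists (maxn i j) => //; split => /=.
    by move: Fix; exact/subsetPset/ndF/leq_maxl.
  by move: Hjy; exact/subsetPset/ndH/leq_maxr.
exists (fun i => tuncons @^-1` G i).
  by rewrite -preimage_bigcup -TG preimage_setT.
move=> i; have [mF Fi] := Foo i; have [mH Hi] := Hoo i; split.
  by rewrite -[X in measurable X]setTI; exact: measurable_tuncons.
rewrite /cons_measure /pushforward -comp_preimage.
rewrite (_ : tuncons \o tcons = id) ?preimage_id//.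
  by rewrite product_measure1E// lte_mul_pinfty// ge0_fin_numE.
by apply/funext => z /=; rewrite tconsK.
Qed.

HB.instance Definition _ := Measure_isSigmaFinite.Build _ _ _ cons_measure
  cons_sigma_finite.

End cons_measure.

(** [iint] is only a recursive formula; this measure turns it into an integral, so that linearity,
    Tonelli and integrability become available. Sigma-finiteness sits in the result type because
    every step forms a product and applies Tonelli to it. *)
Fixpoint tuple_measure (R : realType) (m : nat) :
    {sigma_finite_measure set (m.-tuple R) -> \bar R} :=
  match m with
  | 0 => (\d_([tuple] : 0.-tuple R))
  | m'.+1 => cons_measure m' (tuple_measure R m')
  end.

Section iint_theory.
Context {R : realType}.
Local Open Scope ereal_scope.

Lemma measurable_tcons1 m (x : R) :
  measurable_fun setT (fun t : m.-tuple R => [tuple of x :: t] : m.+1.-tuple R).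
Proof. by apply: measurable_cons => //; exact: measurable_cst. Qed.

Lemma integral_cons_measure m (mu : {sigma_finite_measure set (m.-tuple R) -> \bar R})
    (f : m.+1.-tuple R -> \bar R) : measurable_fun setT f -> (forall t, 0 <= f t) ->
  \int[cons_measure m mu]_t f t =
  \int[@lebesgue_measure R]_x \int[mu]_t f [tuple of x :: t].
Proof.
move=> mf f0.
rewrite ge0_integral_pushforward//; first last.
- exact: measurable_tcons.
rewrite preimage_setT fubini_tonelli1//=.
by apply: measurableT_comp => //; exact: measurable_tcons.
Qed.

Lemma iintE m (f : m.-tuple R -> \bar R) : measurable_fun setT f ->
  (forall t, 0 <= f t) -> iint m f = \int[tuple_measure R m]_t f t.
Proof.
elim: m f => [|m IH] f mf f0 /=.
  by rewrite integral_dirac// diracT mul1e.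
rewrite integral_cons_measure//; apply: eq_integral => x _.
by rewrite IH//; apply: measurableT_comp => //; exact: measurable_tcons1.
Qed.

(* The integral of a nonnegative function is a supremum over simple minorants,
   hence monotone without any measurability requirement. *)
Lemma le_integral_nomeas d (T : measurableType d) (mu : {measure set T -> \bar R})
    (f g : T -> \bar R) : (forall x, 0 <= f x) -> (forall x, f x <= g x) ->
  \int[mu]_x f x <= \int[mu]_x g x.
Proof.
move=> f0 fg; have g0 x : 0 <= g x by apply: le_trans (fg x).
rewrite !ge0_integralTE//; apply: le_ereal_sup => _ [h hf <-].
by exists h => // x; exact: le_trans (hf x) (fg x).
Qed.

Lemma iint_ge0 m (f : m.-tuple R -> \bar R) : (forall t, 0 <= f t) -> 0 <= iint m f.
Proof.
elim: m f => [|m IH] f f0 //=.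
by apply: integral_ge0 => x _; apply: IH.
Qed.

(** Measurability is asked of neither side, which is what makes events that depend on the arbitrary
    selection of minimisers tractable. *)
Lemma le_iint m (f g : m.-tuple R -> \bar R) : (forall t, 0 <= f t) ->
  (forall t, f t <= g t) -> iint m f <= iint m g.
Proof.
elim: m f g => [|m IH] f g f0 fg //=.
by apply: le_integral_nomeas => x; [exact: iint_ge0|exact: IH].
Qed.

Lemma eq_iint m (f g : m.-tuple R -> \bar R) : f =1 g -> iint m f = iint m g.
Proof. by move=> /funext ->. Qed.

Lemma iint_cat m1 m2 (f : (m1 + m2).-tuple R -> \bar R) :
  iint (m1 + m2) f = iint m1 (fun t => iint m2 (fun u => f [tuple of t ++ u])).
Proof.
elim: m1 f => [|m1 IH] f /=.
  by apply: eq_iint => u; congr f; exact/val_inj.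
apply: eq_integral => x _; rewrite IH.
by apply: eq_iint => t; apply: eq_iint => u; congr f; exact/val_inj.
Qed.

End iint_theory.

(* [lebesgue_measure] lives on the type alias [measurableTypeR R] of [R], whose
   measurable sets are those of [R] but under another display. *)
Lemma measurable_TypeR {R : realType} d (U : measurableType d) (f : R -> U) :
  measurable_fun setT f -> @measurable_fun _ _ (measurableTypeR R) U setT f.
Proof. by []. Qed.
Arguments measurable_TypeR {R d U f}.

Section iint_linear.
Context {R : realType}.
Local Open Scope ereal_scope.
Implicit Types (m : nat).

Lemma iintD m (f g : m.-tuple R -> \bar R) :
  measurable_fun setT f -> measurable_fun setT g ->
  (forall t, 0 <= f t) -> (forall t, 0 <= g t) ->
  iint m (fun t => f t + g t) = iint m f + iint m g.
Proof.
move=> mf mg f0 g0; rewrite !iintE//; last 2 first.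
- exact: emeasurable_funD.
- by move=> t; rewrite adde_ge0.
by rewrite ge0_integralD.
Qed.

Lemma iintZl m (k : \bar R) (f : m.-tuple R -> \bar R) :
  measurable_fun setT f -> (forall t, 0 <= f t) -> 0 <= k ->
  iint m (fun t => k * f t) = k * iint m f.
Proof.
move=> mf f0 k0; rewrite !iintE//; last 2 first.
- exact: emeasurable_funM.
- by move=> t; rewrite mule_ge0.
by rewrite ge0_integralZl.
Qed.

Lemma iint0 m : iint m (fun=> 0 : \bar R) = 0.
Proof. by rewrite iintE// integral0. Qed.

Lemma iint_sum m I (s : seq I) (f : I -> m.-tuple R -> \bar R) :
  (forall i, measurable_fun setT (f i)) -> (forall i t, 0 <= f i t) ->
  iint m (fun t => \sum_(i <- s) f i t) = \sum_(i <- s) iint m (f i).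
Proof.
move=> mf f0; elim: s => [|i s IH].
  by rewrite big_nil -[RHS](iint0 m); apply: eq_iint => t; rewrite big_nil.
rewrite big_cons -IH -iintD//; last 2 first.
- exact: emeasurable_sum.
- by move=> t; apply: sume_ge0.
by apply: eq_iint => t; rewrite big_cons.
Qed.

Lemma measurable_iint_param d (T : measurableType d) m (f : T -> m.-tuple R -> \bar R) :
  measurable_fun setT (fun z : T * m.-tuple R => f z.1 z.2) ->
  (forall x t, 0 <= f x t) -> measurable_fun setT (fun x => iint m (f x)).
Proof.
move=> mf f0.
rewrite (_ : (fun x => _) = fun x => \int[tuple_measure R m]_t f x t).
  exact: (@measurable_fun_fubini_tonelli_F _ _ T (m.-tuple R) R (tuple_measure R m)
    (fun z => f z.1 z.2) mf (fun z => f0 _ _)).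
apply/funext => x; rewrite iintE//.
exact: (measurableT_comp mf (pair1_measurable x)).
Qed.

Lemma iint_swap m1 m2 (f : m1.-tuple R -> m2.-tuple R -> \bar R) :
  measurable_fun setT (fun z : m1.-tuple R * m2.-tuple R => f z.1 z.2) ->
  (forall x t, 0 <= f x t) ->
  iint m1 (fun x => iint m2 (fun t => f x t)) =
  iint m2 (fun t => iint m1 (fun x => f x t)).
Proof.
move=> mf f0.
have mfC : measurable_fun setT (fun z : m2.-tuple R * m1.-tuple R => f z.2 z.1).
  exact: (measurableT_comp mf (measurable_fun_pair measurable_snd measurable_fst)).
rewrite !iintE//; last first.
- by move=> x; exact: iint_ge0.
- exact: measurable_iint_param.
- by move=> x; exact: iint_ge0.
- exact: (@measurable_iint_param _ _ _ (fun t x => f x t)).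
transitivity (\int[tuple_measure R m1]_x \int[tuple_measure R m2]_t f x t).
  apply: eq_integral => x _; rewrite iintE//.
  exact: (measurableT_comp mf (pair1_measurable x)).
rewrite (fubini_tonelli (fun z => f z.1 z.2))//=.
apply: eq_integral => t _; rewrite iintE//.
exact: (measurableT_comp mfC (pair1_measurable t)).
Qed.

(** An observation stores its response at the head; with that integral innermost, the normal density
    can be integrated out for a fixed covariate. *)
Lemma iint_consr m (f : m.+1.-tuple R -> \bar R) :
  measurable_fun setT f -> (forall t, 0 <= f t) ->
  iint m.+1 f =
  iint m (fun t => \int[@lebesgue_measure R]_x f [tuple of x :: t]).
Proof.
move=> mf f0.
have mft : measurable_fun setT (f \o tcons m).
  by apply: measurableT_comp => //; exact: measurable_tcons.
rewrite iintE// integral_cons_measure// iintE//; first last.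
- by move=> t; apply: integral_ge0.
- exact: (@measurable_fun_fubini_tonelli_G _ _ (measurableTypeR R) (m.-tuple R) R
    (@lebesgue_measure R) (f \o tcons m) mft (fun z => f0 _)).
exact: (@fubini_tonelli _ _ (measurableTypeR R) (m.-tuple R) R
    (@lebesgue_measure R) (tuple_measure R m) (f \o tcons m) mft (fun z => f0 _)).
Qed.

Lemma measurable_nth m i : measurable_fun setT (fun t : m.-tuple R => nth 0%R t i).
Proof.
have [im|im] := ltnP i m; last first.
  rewrite (_ : (fun t => _) = cst 0%R)//.
  by apply/funext => t; rewrite nth_default// size_tuple.
rewrite (_ : (fun t => _) = (@tnth _ R ^~ (Ordinal im))); first exact: measurable_tnth.
by apply/funext => t; rewrite (tnth_nth 0%R).
Qed.

(** Induction on the number of coordinates. The families are indexed by [nat] so that the tail has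
    the same form again, with [bump 0 i], that is [i.+1], in place of [i]. *)
Lemma iint_prod m (g : nat -> R -> R) (c : nat -> R) :
  (forall i, measurable_fun setT (g i)) -> (forall i x, (0 <= g i x)%R) ->
  (forall i, (i < m)%N -> \int[@lebesgue_measure R]_x (g i x)%:E = (c i)%:E) ->
  iint m (fun t => (\prod_(i < m) g i (nth 0%R t i))%:E) = (\prod_(i < m) c i)%:E.
Proof.
elim: m g c => [|m IH] g c mg g0 gc /=; first by rewrite !big_ord0.
under eq_integral do under eq_fun do rewrite big_ord_recl/= EFinM.
have mgi : measurable_fun setT (fun t : m.-tuple R =>
    (\prod_(i < m) g (bump 0 i) (nth 0%R t i))%:E).
  apply/measurable_EFinP/measurable_prod => i _.
  by apply: measurableT_comp => //; exact: measurable_nth.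
have c0 : (0 <= c 0%N)%R.
  by rewrite -lee_fin -gc//; apply: integral_ge0 => x _; rewrite lee_fin.
have E x : iint m (fun t => (g 0%N x)%:E *
    (\prod_(i < m) g (bump 0 i) (nth 0%R t i))%:E) =
    (\prod_(i < m) c (bump 0 i))%:E * (g 0%N x)%:E.
  rewrite iintZl ?lee_fin//; last by move=> t; rewrite lee_fin; apply: prodr_ge0.
  rewrite muleC; congr (_ * _).
  by rewrite (IH (fun i => g (bump 0 i)) (fun i => c (bump 0 i)))// => i im; rewrite gc.
under eq_integral do rewrite E.
have C0 : 0 <= (\prod_(i < m) c (bump 0 i))%:E.
  rewrite lee_fin; apply: prodr_ge0 => i _.
  rewrite -lee_fin -gc; last by rewrite /bump/= add1n ltnS.
  by apply: integral_ge0 => x _; rewrite lee_fin.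
have mg0 : measurable_fun setT (fun x => (g 0%N x)%:E) by apply/measurable_EFinP; exact: mg.
rewrite (ge0_integralZl _ _ (measurable_TypeR mg0))//; last by move=> x _; rewrite lee_fin; exact: g0.
by rewrite gc// big_ord_recl/= mulrC EFinM.
Qed.

End iint_linear.

(** * Splitting a data set into its observations *)

Section blocks.
Context {R : realType} (p : nat).
Local Open Scope ereal_scope.

(* the [i]-th observation [y_i :: x_i] of a data set *)
Definition obs {n} (d : (n * p.+1).-tuple R) (i : nat) : p.+1.-tuple R :=
  [tuple nth 0%R d (i * p.+1 + h) | h < p.+1].

Lemma ydatE n (d : (n * p.+1).-tuple R) i : ydat p n d i = thead (obs d i).
Proof. by rewrite /thead tnth_mktuple/= addn0. Qed.

Lemma xdatE n (d : (n * p.+1).-tuple R) i : xdat p n d i = [tuple of behead (obs d i)].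
Proof.
apply: eq_from_tnth => h; rewrite tnth_mktuple.
rewrite (tnth_nth 0%R) [RHS]nth_behead.
have -> : nth 0%R (obs d i) h.+1 = tnth (obs d i) (lift ord0 h).
  by rewrite (tnth_nth 0%R).
by rewrite tnth_mktuple.
Qed.

Lemma measurable_obs n i : measurable_fun setT (fun d : (n * p.+1).-tuple R => obs d i).
Proof.
apply/measurable_fun_tnthP => h.
rewrite (_ : _ \o _ = fun d : (n * p.+1).-tuple R => nth 0%R d (i * p.+1 + h)).
  exact: measurable_nth.
by apply/funext => d /=; rewrite tnth_mktuple.
Qed.

(** Independence of the observations. Since [n.+1 * p.+1] is convertible with [p.+1 + n * p.+1],
    [iint_cat] splits off the first block, and what remains is the same product for the shifted
    families. *)
Lemma iint_blocks n (F : nat -> p.+1.-tuple R -> R) (c : nat -> R) :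
  (forall i, measurable_fun setT (F i)) -> (forall i z, (0 <= F i z)%R) ->
  (forall i, (i < n)%N -> iint p.+1 (fun z => (F i z)%:E) = (c i)%:E) ->
  iint (n * p.+1) (fun d => (\prod_(i < n) F i (obs d i))%:E) = (\prod_(i < n) c i)%:E.
Proof.
elim: n F c => [|n IH] F c mF F0 Fc; first by rewrite /= !big_ord0.
rewrite [LHS](@iint_cat R p.+1 (n * p.+1)).
have E (t : p.+1.-tuple R) (u : (n * p.+1).-tuple R) :
    ((\prod_(i < n.+1) F i (@obs n.+1 [tuple of t ++ u] i))%:E =
    (F 0%N t)%:E * (\prod_(i < n) F (bump 0 i) (obs u i))%:E)%E.
  rewrite big_ord_recl EFinM; congr (_%:E * _%:E).
    congr (F _ _); apply: eq_from_tnth => h.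
    by rewrite tnth_mktuple/= mul0n add0n nth_cat size_tuple ltn_ord -tnth_nth.
  apply: eq_bigr => i _; congr (F _ _); apply: eq_from_tnth => h.
  rewrite !tnth_mktuple/= nth_cat size_tuple /bump/= add1n mulSn -addnA.
  by rewrite ltnNge leq_addr/= addKn.
under eq_iint do under eq_iint do rewrite E.
have mP : measurable_fun setT (fun u : (n * p.+1).-tuple R =>
    (\prod_(i < n) F (bump 0 i) (obs u i))%:E).
  apply/measurable_EFinP/measurable_prod => i _.
  by apply: measurableT_comp => //; exact: measurable_obs.
have G t : iint (n * p.+1) (fun u : (n * p.+1).-tuple R => (F 0%N t)%:E *
    (\prod_(i < n) F (bump 0 i) (obs u i))%:E) =
    (\prod_(i < n) c (bump 0 i))%:E * (F 0%N t)%:E.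
  rewrite iintZl ?lee_fin//; last by move=> u; rewrite lee_fin; apply: prodr_ge0.
  rewrite muleC; congr (_ * _).
  by rewrite (IH (fun i => F (bump 0 i)) (fun i => c (bump 0 i)))// => i im; rewrite Fc.
under eq_iint do rewrite G.
have C0 : 0 <= (\prod_(i < n) c (bump 0 i))%:E.
  rewrite lee_fin; apply: prodr_ge0 => i _.
  rewrite -lee_fin -Fc; last by rewrite /bump/= add1n ltnS.
  by apply: iint_ge0 => t; rewrite lee_fin.
have mF0 : measurable_fun setT (fun z => (F 0%N z)%:E) by apply/measurable_EFinP; exact: mF.
rewrite (iintZl _ _ _ mF0)//; last by move=> t; rewrite lee_fin.
by rewrite Fc// big_ord_recl/= mulrC EFinM.
Qed.

End blocks.

(** * Gamma, inverse-gamma and normal densities *)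

Section gamma_function.
Context {R : realType}.
Notation mu := (@lebesgue_measure R).
Implicit Types (a b : R) (f F G : R -> R).

(** Compact intervals exhausting the positive half-line; the shift by two keeps the endpoints
    distinct already at [n = 0]. *)
Let J (n : nat) : set R := `[n.+2%:R^-1, n.+2%:R].

Lemma derivable_oo_LRcontinuous_pos F f a b : 0 < a ->
  (forall x : R, 0 < x -> is_derive x 1 F (f x)) -> a < b -> derivable_oo_LRcontinuous F a b.
Proof.
move=> a0 dF ab.
have cF (x : R) : 0 < x -> {for x, continuous F}.
  move=> x0; apply: differentiable_continuous; apply/derivable1_diffP.
  by have := dF x x0; move=> [].
split.
- move=> x; rewrite in_itv/= => /andP[ax _].
  by have [] := dF x (lt_trans a0 ax).
- by apply: cvg_at_right_filter; exact: cF.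
- by apply: cvg_at_left_filter; exact: cF (lt_trans a0 ab).
Qed.

Lemma within_continuous_pos f a b : 0 < a ->
  (forall x : R, 0 < x -> {for x, continuous f}) -> {within `[a, b], continuous f}.
Proof.
move=> a0 cf; apply: continuous_in_subspaceT => x; rewrite inE/= in_itv/= => /andP[ax _].
exact: cf (lt_le_trans a0 ax).
Qed.

Lemma bigcup_J : \bigcup_n J n = [set t : R | 0 < t].
Proof.
apply/seteqP; split => [x [n _]|x x0]; rewrite /J/=.
  by rewrite in_itv/= => /andP[+ _]; apply: lt_le_trans; rewrite invr_gt0.
have x'0 : 0 <= x by exact: ltW.
have y0 : 0 <= x^-1 by rewrite invr_ge0.
exists (maxn (Num.truncn x) (Num.truncn x^-1)) => //=; rewrite in_itv/=; apply/andP; split.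
  rewrite -[leRHS]invrK lef_pV2 ?posrE ?invr_gt0 ?ltr0n//.
  apply: le_trans (ltW (truncnS_gt _)) _.
  by rewrite ler_nat ltnS ltnW// ltnS leq_maxr.
apply: le_trans (ltW (truncnS_gt _)) _.
by rewrite ler_nat ltnS ltnW// ltnS leq_maxl.
Qed.

Lemma nondecreasing_J : nondecreasing_seq J.
Proof.
move=> m n mn; apply/subsetPset => x; rewrite /J/= !in_itv/= => /andP[h1 h2].
apply/andP; split.
  by apply: le_trans h1; rewrite lef_pV2 ?posrE ?ltr0n// ler_nat !ltnS.
by apply: le_trans h2 _; rewrite ler_nat !ltnS.
Qed.

Lemma cvg_integral_J f : measurable_fun setT f -> (forall x, 0 < x -> 0 <= f x) ->
  (\int[mu]_(x in J n) (f x)%:E)%E @[n --> \oo] -->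
  (\int[mu]_(x in [set t : R | (0 < t)%R]) (f x)%:E)%E.
Proof.
move=> mf f0; rewrite -bigcup_J; apply: ge0_nondecreasing_set_cvg_integral.
- exact: nondecreasing_J.
- by move=> i; exact: measurable_itv.
- by move=> i; apply: measurable_funTS; exact/measurable_EFinP.
- move=> i x ; rewrite /J/= in_itv/= => /andP[ix _]; rewrite lee_fin f0//.
  by apply: lt_le_trans ix; rewrite invr_gt0 ltr0n.
Qed.

Definition gamma_int (a t : R) : R := powR t (a - 1) * expR (- t).

Lemma measurable_gamma_int a : measurable_fun setT (gamma_int a).
Proof.
apply: measurable_funM; first exact: measurable_powR.
by apply: measurableT_comp => //; exact: measurable_expR.
Qed.

Lemma gamma_int_ge0 a t : 0 <= gamma_int a t.
Proof. by rewrite mulr_ge0// ?powR_ge0 ?expR_ge0. Qed.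

(** Kept in the extended reals: [Gammaf] is its [fine] part and carries information only once
    [Gammae_fin] is known. *)
Definition Gammae a : \bar R := (\int[mu]_(t in [set t : R | (0 < t)%R]) (gamma_int a t)%:E)%E.

Lemma GammafE a : Gammaf a = fine (Gammae a). Proof. by []. Qed.

Lemma continuous_powR_pos a (x : R) : 0 < x -> {for x, continuous (fun t : R => t `^ a)}.
Proof.
move=> x0; apply: differentiable_continuous; apply/derivable1_diffP.
by have [] := @is_derive1_powR R a x x0.
Qed.

Lemma continuous_expRN (x : R) : {for x, continuous (fun t : R => expR (- t))}.
Proof.
apply: differentiable_continuous; apply/derivable1_diffP.
exact: ex_derive.
Qed.

(** Integration by parts on a compact interval away from zero, where all functions are smooth. The
    boundary terms stay explicit and vanish in the limit by [cvg_Gamma_boundary]. *)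
Lemma Gamma_parts a n :
  (\int[mu]_(t in J n) (gamma_int (a + 1) t)%:E =
   a%:E * \int[mu]_(t in J n) (gamma_int a t)%:E +
   (n.+2%:R^-1 `^ a * expR (- n.+2%:R^-1) - n.+2%:R `^ a * expR (- n.+2%:R))%:E)%E.
Proof.
have n1 : (n.+2%:R^-1 < n.+2%:R :> R).
  by apply: (@lt_trans _ _ 1); rewrite ?invf_lt1 ?ltr0n// ltr1n.
have p0 : 0 < n.+2%:R^-1 :> R by rewrite invr_gt0.
have dE (x : R) : is_derive x 1 (fun t : R => - expR (- t)) (expR (- x)).
  by apply: is_derive_eq; rewrite mulrN mulr1 opprK.
have dP (x : R) : 0 < x -> is_derive x 1 (fun t : R => t `^ a) (a * x `^ (a - 1)).
  by move=> x0; exact: is_derive1_powR.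
have cE (x : R) : 0 < x -> {for x, continuous (fun t : R => expR (- t))}.
  by move=> _; exact: continuous_expRN.
have cP (x : R) : 0 < x -> {for x, continuous (fun t : R => a * t `^ (a - 1))}.
  by move=> x0; apply: continuousM; [exact: cst_continuous|exact: continuous_powR_pos].
have dEE : {in `]n.+2%:R^-1, n.+2%:R[%R, (fun t : R => - expR (- t))^`() =1 (fun t => expR (- t))}.
  by move=> x _; rewrite derive1E; apply: (@derive_val _ _ _ _ _ _ _ (dE x)).
have dPE : {in `]n.+2%:R^-1, n.+2%:R[%R, (fun t : R => t `^ a)^`() =1 (fun t => a * t `^ (a - 1))}.
  move=> x; rewrite in_itv/= => /andP[nx _]; rewrite derive1E.
  exact: (@derive_val _ _ _ _ _ _ _ (dP x (lt_trans p0 nx))).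
have := @integration_by_parts R (fun t => t `^ a) (fun t => - expR (- t))
  (fun t => a * t `^ (a - 1)) (fun t => expR (- t)) _ _ n1
  (within_continuous_pos _ _ _ p0 cP)
  (derivable_oo_LRcontinuous_pos _ _ _ _ p0 dP n1) dPE
  (within_continuous_pos _ _ _ p0 cE)
  (derivable_oo_LRcontinuous_pos _ _ _ _ p0 (fun x _ => dE x) n1) dEE.
rewrite /J /gamma_int addrK => ->.
have iG : mu.-integrable `[n.+2%:R^-1, n.+2%:R] (EFin \o gamma_int a).
  apply: continuous_compact_integrable; first exact: segment_compact.
  apply: (within_continuous_pos _ _ _ p0) => x x0.
  by apply: continuousM; [exact: continuous_powR_pos|exact: continuous_expRN].
have -> : (\int[mu]_(x in `[n.+2%:R^-1%R, n.+2%:R%R]) (a * x `^ (a - 1) * - expR (- x))%:E =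
   (- a)%:E * \int[mu]_(x in `[n.+2%:R^-1%R, n.+2%:R%R]) (gamma_int a x)%:E)%E.
  rewrite -integralZl//; apply: eq_integral => x _.
  by rewrite -EFinM /gamma_int; congr EFin; ring.
rewrite EFinN mulNe oppeK addeC; congr (_ + _%:E)%E; ring.
Qed.

(** The inequality [exp(t/(m+1)) >= t/(m+1)] is raised to the power [m+1]; the one power of [t] in
    excess of [t^m] leaves the factor [1/t]. *)
Lemma powR_expRN_le a (m : nat) (t : R) : 1 <= t -> a <= m%:R ->
  t `^ a * expR (- t) <= m.+1%:R ^+ m.+1 / t.
Proof.
move=> t1 am; have t0 : 0 < t by exact: lt_le_trans t1.
have h1 : t `^ a <= t ^+ m by rewrite -(powR_mulrn m (ltW t0)); exact: (ler_powR t1).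
have h2 : (t / m.+1%:R) ^+ m.+1 <= expR t.
  have -> : expR t = expR (t / m.+1%:R) ^+ m.+1.
    by rewrite -expRM_natl mulrC divfK// pnatr_eq0.
  have tm : 0 <= t / m.+1%:R by rewrite divr_ge0 // ltW.
  apply: lerXn2r; rewrite ?nnegrE ?expR_ge0//.
  by move: (_ / _) tm => u u0; have := expR_ge1Dx u; lra.
rewrite expRN ler_pdivrMr ?expR_gt0//.
apply: (le_trans h1).
have -> : t ^+ m = m.+1%:R ^+ m.+1 / t * (t / m.+1%:R) ^+ m.+1.
  rewrite expr_div_n [t ^+ m.+1]exprS; field.
  by rewrite expf_neq0 ?pnatr_eq0// gt_eqF.
by rewrite ler_wpM2l// divr_ge0 ?exprn_ge0 ?ltW.
Qed.

Lemma cvg_Gamma_boundary a : 0 < a ->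
  (n.+2%:R^-1 `^ a * expR (- n.+2%:R^-1) - n.+2%:R `^ a * expR (- n.+2%:R)) @[n --> \oo]
  --> (0 : R).
Proof.
move=> a0.
have inv0 : (n.+2%:R^-1 : R) @[n --> \oo] --> (0 : R).
  by have := @cvg_harmonic R; rewrite -(@cvg_shiftS R (@harmonic R)).
rewrite -[X in _ --> X](subr0 0); apply: cvgB.
  apply: (@squeeze_cvgr _ _ _ _ (fun=> 0) (fun n => n.+2%:R^-1 `^ a)).
  - near=> n; rewrite mulr_ge0 ?powR_ge0 ?expR_ge0//=.
    by rewrite ler_piMr ?powR_ge0// expR_le1// oppr_le0 invr_ge0.
  - exact: cvg_cst.
  - have := powR_cvg0 a0.
    move=> /cvg_at_rightP; apply; split => // n; rewrite invr_gt0//.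
pose m := (Num.truncn a).+1.
have am : a <= m%:R by exact: ltW (truncnS_gt _).
apply: (@squeeze_cvgr _ _ _ _ (fun=> 0) (fun n => m.+1%:R ^+ m.+1 * n.+2%:R^-1)).
- near=> n; rewrite mulr_ge0 ?powR_ge0 ?expR_ge0//=.
  by apply: powR_expRN_le => //; rewrite ler1n.
- exact: cvg_cst.
- by rewrite -[X in _ --> X](mulr0 (m.+1%:R ^+ m.+1)); apply: cvgM => //; exact: cvg_cst.
Unshelve. all: by end_near. Qed.

Lemma cvg_Gammae a : (\int[mu]_(t in J n) (gamma_int a t)%:E)%E @[n --> \oo] --> Gammae a.
Proof.
by apply: cvg_integral_J => [|x _]; [exact: measurable_gamma_int|exact: gamma_int_ge0].
Qed.

Lemma Gammae_ge0 a : (0 <= Gammae a)%E.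
Proof. by apply: integral_ge0 => x _; rewrite lee_fin gamma_int_ge0. Qed.

Lemma measurable_pos : measurable [set t : R | 0 < t].
Proof. by rewrite -set_itvoy; exact: measurable_itv. Qed.

Lemma Gammae_rec a : 0 < a -> (Gammae (a + 1) = a%:E * Gammae a)%E.
Proof.
move=> a0.
have h : (a%:E * \int[mu]_(t in J n) (gamma_int a t)%:E)%E @[n --> \oo] --> (a%:E * Gammae a)%E.
  by apply: cvgeZl => //; exact: cvg_Gammae.
have h2 : (\int[mu]_(t in J n) (gamma_int (a + 1) t)%:E)%E @[n --> \oo] --> (a%:E * Gammae a + 0)%E.
  rewrite (_ : (fun n => _) = (fun n => a%:E * \int[mu]_(t in J n) (gamma_int a t)%:E +
    (n.+2%:R^-1 `^ a * expR (- n.+2%:R^-1) - n.+2%:R `^ a * expR (- n.+2%:R))%:E)%E); last first.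
    by apply/funext => n; rewrite Gamma_parts.
  apply: cvgeD => //; first by rewrite fin_num_adde_defl.
  by apply: cvg_EFin; [exact: nearW|exact: cvg_Gamma_boundary].
by rewrite adde0 in h2; apply: cvg_unique h2 => //; exact: cvg_Gammae.
Qed.

Lemma Gammae1 : Gammae 1 = 1%E.
Proof.
have -> : Gammae 1 = (\int[mu]_(t in `]0%R, +oo[) (expR (- t))%:E)%E.
  rewrite set_itvoy; apply: eq_integral => t; rewrite inE/= => t0.
  by rewrite /gamma_int subrr powRr0 mul1r.
have mE : measurable_fun setT (fun t : R => expR (- t)).
  by apply: measurableT_comp => //; exact: measurable_expR.
rewrite integral_itv_obnd_cbnd; last by apply: measurable_funTS; exact/measurable_EFinP.
have dE (x : R) : is_derive x 1 (fun t : R => - expR (- t)) (expR (- x)).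
  by apply: is_derive_eq; rewrite mulrN mulr1 opprK.
rewrite (@ge0_continuous_FTC2y R (fun t => expR (- t)) (fun t => - expR (- t)) 0 0).
- by rewrite oppr0 expR0 EFinN oppeK add0e.
- by move=> x _; exact: expR_ge0.
- by apply: continuous_subspaceT => x; exact: continuous_expRN.
- rewrite -[X in _ --> X]oppr0; apply: cvgN.
  exact: cvgr_expR.
- by move=> x _; have [] := dE x.
- have cF : {for 0, continuous (fun t : R => - expR (- t))}.
    apply: differentiable_continuous; apply/derivable1_diffP.
    by have [] := dE 0.
  exact: cvg_at_right_filter.
- by move=> x _; rewrite derive1E; apply: (@derive_val _ _ _ _ _ _ _ (dE x)).
Qed.

Lemma Gammae_nat n : Gammae n.+1%:R = (n`!%:R)%:E.
Proof.
elim: n => [|n IH]; first exact: Gammae1.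
by rewrite -addn1 natrD Gammae_rec ?ltr0n// IH factS natrM EFinM.
Qed.

(** By [Gammae_rec] it suffices to treat [a + 1], whose integrand has no singularity at zero and is
    at most [(1 + t^m) exp(-t)]; the latter integrates to [Gamma(1) + Gamma(m+1)], known from
    factorials. *)
Lemma Gammae_fin a : 0 < a -> Gammae a \is a fin_num.
Proof.
move=> a0; suff : (Gammae (a + 1) < +oo)%E.
  rewrite Gammae_rec//; have := Gammae_ge0 a; case: (Gammae a) => // _.
  by rewrite mulry gtr0_sg// mul1e.
pose m := (Num.truncn a).+1.
have am : a <= m%:R by exact: ltW (truncnS_gt _).
apply: (@le_lt_trans _ _ (Gammae 1 + Gammae m.+1%:R)%E); last first.
  by rewrite Gammae1 Gammae_nat ltry.
have mG b : measurable_fun [set t : R | 0 < t] (fun t => (gamma_int b t)%:E).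
  by apply: measurable_funTS; apply/measurable_EFinP; exact: measurable_gamma_int.
have G0 b (x : R) : (0 < x)%R -> (0 <= (gamma_int b x)%:E)%E.
  by move=> _; rewrite lee_fin gamma_int_ge0.
rewrite /Gammae -(ge0_integralD mu measurable_pos (G0 1) (mG 1) (G0 m.+1%:R) (mG _)).
have mS : measurable_fun [set t : R | 0 < t] (fun x => (gamma_int 1 x)%:E + (gamma_int m.+1%:R x)%:E)%E.
  exact: (emeasurable_funD (mG _) (mG _)).
apply: ge0_le_integral; [exact: measurable_pos|exact: G0|exact: mG|exact: mS|move=> x x0]. rewrite -EFinD lee_fin /gamma_int subrr powRr0 -mulrDl addrK.
rewrite ler_wpM2r ?expR_ge0// -natr1 addrK.
have [x1|x1] := leP x 1.
  rewrite (@le_trans _ _ 1)//; last by rewrite lerDl powR_ge0.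
  rewrite -[leRHS](powRr0 x); apply: ger_powR; last exact: ltW.
  by rewrite x1 andbT.
by rewrite (le_trans (ler_powR (ltW x1) am))// lerDr.
Qed.

Lemma Gammaf_gt0 a : 0 < a -> 0 < Gammaf a.
Proof.
move=> a0; rewrite GammafE -lte_fin fineK ?Gammae_fin//.
(* On [[1, 2]] one has [0 <= ln t <= 1], so [t^(a-1)] is at least [exp(-|a-1|)], and [exp(-t)] is at
   least [exp(-2)]. *)
apply: (@lt_le_trans _ _ (\int[mu]_(t in `[1%R, 2%R]) (expR (- `|a - 1| - 2))%:E)%E).
  rewrite integral_cst//= lebesgue_measure_itv/= lte_fin ltr1n/= -EFinB -EFinM lte_fin.
  by rewrite mulr_gt0 ?expR_gt0// subr_gt0 ltr1n.
apply: (@le_trans _ _ (\int[mu]_(t in `[1%R, 2%R]) (gamma_int a t)%:E)%E).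
  apply: ge0_le_integral => //.
  - by apply: measurable_funTS; apply/measurable_EFinP; exact: measurable_gamma_int.
  move=> x; rewrite /= in_itv/= => /andP[x1 x2]; rewrite lee_fin /gamma_int.
  have x0 : 0 < x by exact: lt_le_trans x1.
  rewrite /powR gt_eqF// -expRD ler_expR.
  have l0 : 0 <= ln x by rewrite ln_ge0.
  have l1 : ln x <= 1 by have := @le_ln1Dx R (x - 1); rewrite [1 + _]addrC subrK => /(_ ltac:(lra)); lra.
  have := ler_norm (- (a - 1)); rewrite normrN => ha.
  have hm : (- `|a - 1|) <= (a - 1) * ln x.
    have : `|(a - 1) * ln x| <= `|a - 1|.
      by rewrite normrM (ger0_norm l0) ler_piMr.
    by rewrite ler_norml => /andP[].
  lra.
apply: ge0_subset_integral => //.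
- exact: measurable_pos.
- by apply: measurable_funTS; apply/measurable_EFinP; exact: measurable_gamma_int.
- by move=> ? _; rewrite lee_fin gamma_int_ge0.
- by move=> x; rewrite /= in_itv/= => /andP[x1 _]; exact: lt_le_trans x1.
Qed.

End gamma_function.

(** * Inverse-gamma densities: total mass, moments and a Stirling bound *)

Section invgamma_theory.
Context {R : realType}.
Notation mu := (@lebesgue_measure R).
Implicit Types (a b s : R).

Lemma Gammaf_rec a : 0 < a -> Gammaf (a + 1) = a * Gammaf a.
Proof. by move=> a0; rewrite !GammafE Gammae_rec// fineM// Gammae_fin. Qed.

Lemma Gammaf_nat n : Gammaf n.+1%:R = n`!%:R :> R.
Proof. by rewrite GammafE Gammae_nat. Qed.

(** The interval [J n] scaled by [c]: the map [s -> b / s] carries [Jc 1 n] onto [Jc b n], so both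
    sides of the substitution below are exhausted by intervals of this form. *)
Let Jc (c : R) (n : nat) : set R := `[c / n.+2%:R, c * n.+2%:R].

Lemma bigcup_Jc c : 0 < c -> \bigcup_n Jc c n = [set t : R | 0 < t].
Proof.
move=> c0; rewrite -bigcup_J; apply/seteqP; split => x.
  move=> [n _]; rewrite /Jc/= in_itv/= => /andP[h _].
  by rewrite bigcup_J/=; apply: lt_le_trans h; rewrite divr_gt0.
move=> h; have x0 : 0 < x by move: h; rewrite bigcup_J.
have : (\bigcup_n `[n.+2%:R^-1, (n.+2%:R : R)]) (x / c) by rewrite bigcup_J/= divr_gt0.
move=> [n _ /=]; rewrite in_itv/= => /andP[h1 h2]; exists n => //.
rewrite /Jc/= in_itv/= [c / _]mulrC -ler_pdivlMr// h1/=.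
by rewrite mulrC -ler_pdivrMr.
Qed.

Lemma nondecreasing_Jc c : 0 < c -> nondecreasing_seq (Jc c).
Proof.
move=> c0 m n mn; apply/subsetPset => x; rewrite /Jc/= !in_itv/= => /andP[h1 h2].
apply/andP; split.
  by apply: le_trans h1; rewrite ler_pM2l// lef_pV2 ?posrE ?ltr0n// ler_nat !ltnS.
by apply: le_trans h2 _; rewrite ler_pM2l// ler_nat !ltnS.
Qed.

Lemma cvg_integral_Jc c (f : R -> R) : 0 < c -> measurable_fun setT f -> (forall x, 0 <= f x) ->
  (\int[mu]_(x in Jc c n) (f x)%:E)%E @[n --> \oo] -->
  (\int[mu]_(x in [set t : R | (0 < t)%R]) (f x)%:E)%E.
Proof.
move=> c0 mf f0; rewrite -(bigcup_Jc _ c0); apply: ge0_nondecreasing_set_cvg_integral.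
- exact: nondecreasing_Jc.
- by move=> i; exact: measurable_itv.
- by move=> i; apply: measurable_funTS; exact/measurable_EFinP.
- by move=> i x _; rewrite lee_fin.
Qed.

Lemma measurable_invr : measurable_fun setT (fun x : R => x^-1).
Proof.
rewrite (_ : (fun x => _) = (fun x => if x < 0 then - ((- x) `^ (-1)) else x `^ (-1))).
  apply: measurable_fun_ifT.
  - by apply: measurable_fun_ltr => //; exact: measurable_cst.
  - apply: measurable_funN; apply: (measurableT_comp (measurable_powR (-1))).
    exact: measurable_funN.
  - exact: measurable_powR.
apply/funext => x; case: ltP => x0; last by rewrite powR_inv1.
by rewrite powR_inv1 ?oppr_ge0 ?ltW// invrN opprK.
Qed.

Definition invgamma_kernel (a b s : R) : R := (s^-1) `^ (a + 1) * expR (- (b / s)).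

Lemma measurable_invgamma_kernel a b : measurable_fun setT (invgamma_kernel a b).
Proof.
apply: measurable_funM.
  by apply: (measurableT_comp (measurable_powR (a + 1))); exact: measurable_invr.
apply: measurableT_comp; first exact: measurable_expR.
apply: measurable_funN; apply: measurable_funM; first exact: measurable_cst.
exact: measurable_invr.
Qed.

Lemma invgamma_kernel_ge0 a b s : 0 <= invgamma_kernel a b s.
Proof. by rewrite mulr_ge0 ?powR_ge0 ?expR_ge0. Qed.

(** The substitution [t = b / s] turns the kernel into the Gamma integrand. It is carried out on
    [Jc 1 n], where everything is smooth and bounded, before passing to the limit on both sides. *)
Lemma integral_invgamma_kernel a b : 0 < a -> 0 < b ->
  (\int[mu]_(s in [set s | (0 < s)%R]) (invgamma_kernel a b s)%:E = (b `^ (- a) * Gammaf a)%:E)%E.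
Proof.
move=> a0 b0.
have h1 := cvg_integral_Jc 1 (invgamma_kernel a b) ltr01 (measurable_invgamma_kernel a b)
  (invgamma_kernel_ge0 a b).
apply: cvg_unique h1 _ => //.
have E n : (\int[mu]_(x in Jc 1 n) (invgamma_kernel a b x)%:E =
    (b `^ (- a))%:E * \int[mu]_(x in Jc b n) (gamma_int a x)%:E)%E.
  have n0 : 0 < n.+2%:R :> R by rewrite ltr0n.
  have p0 : 0 < n.+2%:R^-1 :> R by rewrite invr_gt0.
  have n1 : (n.+2%:R^-1 < n.+2%:R :> R).
    by apply: (@lt_trans _ _ 1); rewrite ?invf_lt1 ?ltr0n// ltr1n.
  have dF (x : R) : 0 < x -> is_derive x 1 (fun t : R => b / t) (- (b / x ^+ 2)).
    move=> x0; have xn0 : x != 0 by rewrite gt_eqF.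
    have := @is_deriveZ R R R _ b x 1 _ (@is_deriveV R id x 1 1 xn0 (is_derive_id x 1)).
    move=> /(@is_derive_eq _ _ _ _ _ _ _ _); apply.
    by rewrite /GRing.scale/=; field.
  have dFE (x : R) : 0 < x -> (fun t : R => b / t)^`() x = - (b / x ^+ 2).
    by move=> x0; rewrite derive1E; apply: (@derive_val _ _ _ _ _ _ _ (dF x x0)).
  have cF' (x : R) : 0 < x -> {for x, continuous (fun t : R => - (b / t ^+ 2))}.
    move=> x0; have xn0 : x != 0 by rewrite gt_eqF.
    apply: differentiable_continuous; apply/derivable1_diffP.
    have x2 : x ^+ 2 != 0 by rewrite expf_neq0.
    exact: ex_derive.
  have cF'' (x : R) : 0 < x -> {for x, continuous ((fun t : R => b / t)^`())}.
    move=> x0; suff : (fun t : R => b / t)^`() y @[y --> x] --> - (b / x ^+ 2) by rewrite -dFE.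
    apply: cvg_trans (cF' x x0); apply: near_eq_cvg.
    have : nbhs x [set y : R | 0 < y] by apply: open_nbhs_nbhs; split => //; exact: open_gt.
    by apply: filterS => y /= y0; rewrite dFE.
  have subE (x : R) : 0 < x -> ((gamma_int a \o (fun t => b / t)) * - derive1 (fun t : R => b / t)) x =
      gamma_int a (b / x) * (b / x ^+ 2).
    by move=> x0; rewrite -[LHS]/(gamma_int a (b / x) * - (derive1 (fun t : R => b / t) x)) dFE// opprK.
  have := @integration_by_substitution_decreasing R (fun t => b / t) (gamma_int a)
    n.+2%:R^-1 n.+2%:R (ltW n1).
  rewrite invrK.
  have -> : `[b / n.+2%:R, b * n.+2%:R]%classic = Jc b n by [].
  move=> ->.
  - have -> : Jc 1 n = `[n.+2%:R^-1, n.+2%:R] by rewrite /Jc !mul1r.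
    rewrite -ge0_integralZl_EFin//; last 3 first.
    + move=> x; rewrite /= in_itv/= => /andP[h _]; have x0 : 0 < x by exact: lt_le_trans h.
      rewrite lee_fin subE// mulr_ge0 ?gamma_int_ge0//.
      by rewrite divr_ge0 ?exprn_ge0 ?ltW.
    + apply/measurable_EFinP.
      have mm : measurable_fun setT (fun x : R => gamma_int a (b / x) * (b / x ^+ 2)).
        apply: measurable_funM.
          apply: (measurableT_comp (measurable_gamma_int a)).
          by apply: measurable_funM; [exact: measurable_cst|exact: measurable_invr].
        apply: measurable_funM; first exact: measurable_cst.
        by apply: (measurableT_comp measurable_invr); exact: measurable_funX.
      apply: (eq_measurable_fun (fun x : R => gamma_int a (b / x) * (b / x ^+ 2))).
        move=> x; rewrite inE/= in_itv/= => /andP[h _]; have x0 : 0 < x by exact: lt_le_trans h.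
        by rewrite subE.
      exact: (measurable_funTS (measurable_TypeR mm)).
    + exact: powR_ge0.
    apply: eq_integral => x; rewrite inE/= in_itv/= => /andP[h _].
    have x0 : 0 < x by exact: lt_le_trans h.
    rewrite subE// -EFinM; congr EFin.
    rewrite /invgamma_kernel /gamma_int; set e := expR _.
    have xi0 : 0 < x^-1 by rewrite invr_gt0.
    rewrite (@powRM _ b x^-1) ?ltW//.
    have -> : x^-1 `^ (a + 1) = x^-1 `^ (a - 1) * x^-1 ^+ 2.
      rewrite -powR_mulrn ?ltW// -powRD; last by rewrite (gt_eqF xi0) implybT.
      by congr (_ `^ _); ring.
    have bE : b `^ (- a) * b `^ (a - 1) * b = 1.
      rewrite -{3}(powRr1 (ltW b0)) -!powRD ?(gt_eqF b0) ?implybT//.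
      by rewrite (_ : _ + _ + _ = 0) ?powRr0//; ring.
    transitivity ((b `^ (- a) * b `^ (a - 1) * b) * (x^-1 `^ (a - 1) * x^-1 ^+ 2 * e)).
      by rewrite bE mul1r.
    by rewrite exprVn; ring.
  - move=> x y; rewrite !in_itv/= => /andP[hx _] /andP[hy _] xy.
    have x0 : 0 < x by exact: lt_le_trans hx.
    have y0 : 0 < y by exact: lt_le_trans hy.
    by rewrite ltr_pM2l// ltf_pV2 ?posrE.
  - move=> x; rewrite in_itv/= => /andP[hx _]; exact: cF'' (lt_trans p0 hx).
  - apply/cvg_ex; exists ((fun t : R => b / t)^`() n.+2%:R^-1).
    by apply: cvg_at_right_filter; exact: cF''.
  - apply/cvg_ex; exists ((fun t : R => b / t)^`() n.+2%:R).
    by apply: cvg_at_left_filter; exact: cF''.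
  - exact: (derivable_oo_LRcontinuous_pos _ _ _ _ p0 dF n1).
  - apply: within_continuous_pos; first by rewrite divr_gt0.
    by move=> x x0; apply: continuousM; [exact: continuous_powR_pos|exact: continuous_expRN].
rewrite (_ : (fun n => _) = (fun n => (b `^ (- a))%:E * \int[mu]_(x in Jc b n) (gamma_int a x)%:E)%E); last first.
  by apply/funext => n; rewrite E.
rewrite EFinM GammafE fineK ?Gammae_fin//; apply: cvgeZl => //.
by apply: cvg_integral_Jc => //; [exact: measurable_gamma_int|exact: gamma_int_ge0].
Unshelve. all: by end_near. Qed.

Lemma invgammaE a b s : invgamma a b s =
  (b `^ a / Gammaf a) * ((invgamma_kernel a b \_ [set s | 0 < s]) s).
Proof.
rewrite /invgamma patchE; case: ifPn => s0.
  by rewrite ifT ?inE// /invgamma_kernel mulrA.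
by rewrite ifF ?mulr0//; apply/negbTE; apply: contra s0; rewrite inE.
Qed.

Lemma measurable_invgamma a b : measurable_fun setT (invgamma a b).
Proof.
rewrite (_ : invgamma a b = fun s => (b `^ a / Gammaf a) * ((invgamma_kernel a b \_ [set s | 0 < s]) s)).
  apply: measurable_funM; first exact: measurable_cst.
  apply/(measurable_restrictT _ measurable_pos).
  by apply: measurable_funTS; exact: measurable_invgamma_kernel.
by apply/funext => s; rewrite invgammaE.
Qed.

Lemma invgamma_ge0 a b s : 0 < a -> 0 <= invgamma a b s.
Proof.
move=> a0; rewrite /invgamma; case: ifP => // s0.
by rewrite !mulr_ge0 ?powR_ge0 ?expR_ge0// invr_ge0 ltW// Gammaf_gt0.
Qed.

Lemma invgamma_gt0 a b s : 0 < a -> 0 < b -> 0 < s -> 0 < invgamma a b s.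
Proof.
move=> a0 b0 s0; rewrite /invgamma s0.
by rewrite !mulr_gt0 ?powR_gt0 ?expR_gt0 ?invr_gt0 ?Gammaf_gt0.
Qed.

Lemma integral_invgamma a b : 0 < a -> 0 < b ->
  (\int[mu]_s (invgamma a b s)%:E = 1)%E.
Proof.
move=> a0 b0.
transitivity ((b `^ a / Gammaf a)%:E *
    \int[mu]_(s in [set s | (0 < s)%R]) (invgamma_kernel a b s)%:E)%E.
  rewrite [in RHS]integral_mkcond -ge0_integralZl_EFin//; last 3 first.
  - by move=> x _; rewrite patchE; case: ifP => // _; rewrite lee_fin invgamma_kernel_ge0.
  - apply/(measurable_restrictT _ measurable_pos).
    by apply: measurable_funTS; apply/measurable_EFinP; exact: measurable_invgamma_kernel.
  - by rewrite divr_ge0 ?powR_ge0// ltW// Gammaf_gt0.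
  apply: eq_integral => x _; rewrite invgammaE EFinM; congr (_ * _)%E.
  by rewrite !patchE; case: ifP.
rewrite integral_invgamma_kernel// -EFinM powRN; congr EFin; field.
by rewrite !gt_eqF ?powR_gt0 ?Gammaf_gt0.
Qed.

(** A factor [1 / s] is absorbed by raising the shape by one. Together with [invgamma_mulr] this
    reduces the moments of the variance to total mass one. *)
Lemma invgamma_divr a b s : 0 < a -> 0 < b ->
  invgamma a b s / s = a / b * invgamma (a + 1) b s.
Proof.
move=> a0 b0; rewrite /invgamma; case: ifPn => s0; last by rewrite mul0r mulr0.
have si0 : 0 < s^-1 by rewrite invr_gt0.
rewrite Gammaf_rec// (@powRD _ s^-1 (a + 1) 1) ?(gt_eqF si0) ?implybT//.
rewrite (@powRD _ b a 1) ?(gt_eqF b0) ?implybT// !powRr1 ?(ltW b0) ?(ltW si0)//.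
by field; rewrite !gt_eqF// Gammaf_gt0.
Qed.

Lemma invgamma_mulr a b s : 0 < a -> 0 < b ->
  invgamma (a + 1) b s * s = b / a * invgamma a b s.
Proof.
move=> a0 b0; have [s0|s0] := ltP 0 s; last by rewrite /invgamma ltNge s0/= mul0r mulr0.
have := invgamma_divr a b s a0 b0 => /(congr1 (fun x => x * s * (b / a))).
rewrite divfK ?gt_eqF// => e; rewrite [RHS]mulrC e; field.
by rewrite !gt_eqF.
Qed.

(** Half of the scale is spent on an exponential moment of [1 / s]; this measures how little mass
    lies near zero variance. *)
Lemma invgamma_expR a b s : 0 < a -> 0 < b ->
  invgamma a b s * expR (b / 2 / s) = 2 `^ a * invgamma a (b / 2) s.
Proof.
move=> a0 b0; rewrite /invgamma; case: ifPn => s0; last by rewrite mul0r mulr0.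
rewrite -mulrA -expRD (_ : - (b / s) + b / 2 / s = - (b / 2 / s)); last first.
  by field; rewrite gt_eqF.
rewrite (@powRM _ b 2^-1) ?(ltW b0) ?invr_ge0//.
have -> : (2^-1 : R) `^ a = (2 `^ a)^-1 by rewrite -powR_inv1// -powRrM mulN1r powRN.
by field; rewrite !gt_eqF ?powR_gt0 ?Gammaf_gt0.
Qed.

(** At infinity the density decays only like a power, so a fractional moment has to serve; the order
    [a / 2] stays below the critical order [a]. *)
Lemma invgamma_powR a b s : 0 < a -> 0 < b ->
  invgamma a b s * s `^ (a / 2) =
  b `^ (a / 2) * Gammaf (a / 2) / Gammaf a * invgamma (a / 2) b s.
Proof.
move=> a0 b0; rewrite /invgamma; case: ifPn => s0; last by rewrite mul0r mulr0.
have si0 : 0 < s^-1 by rewrite invr_gt0.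
have -> : a + 1 = (a / 2 + 1) + a / 2 by field.
rewrite (@powRD _ s^-1 (a / 2 + 1) (a / 2)) ?(gt_eqF si0) ?implybT//.
have -> : b `^ a = b `^ (a / 2) * b `^ (a / 2).
  by rewrite -powRD ?(gt_eqF b0) ?implybT//; congr powR; field.
have -> : s^-1 `^ (a / 2) = (s `^ (a / 2))^-1.
  by rewrite -powR_inv1 ?ltW// -powRrM mulN1r powRN.
by field; rewrite !gt_eqF ?powR_gt0 ?Gammaf_gt0// divr_gt0.
Qed.

(** The induction step is [(1 + 1/n)^n <= e], with the case [n = 0] apart. *)
Lemma expn_le_fact n : (n%:R : R) ^+ n <= expR n%:R * n`!%:R.
Proof.
elim: n => [|n IH]; first by rewrite expr0 expR0 fact0 mulr1.
rewrite factS exprS natrM mulrCA ler_pM2l ?ltr0n//.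
have [->|n0] := posnP n; first by rewrite expr0 fact0 mulr1 -expR0 ler_expR.
have nR : 0 < n%:R :> R by rewrite ltr0n.
have -> : n.+1%:R = n%:R * (1 + n%:R^-1) :> R by rewrite mulrDr mulr1 divff ?gt_eqF// natr1.
rewrite exprMn (_ : n%:R * (1 + n%:R^-1) = n%:R + 1); last first.
  by rewrite mulrDr mulr1 divff ?gt_eqF.
rewrite expRD -mulrA [expR 1 * _]mulrC mulrA.
apply: ler_pM => //; rewrite ?exprn_ge0 ?addr_ge0 ?invr_ge0 ?ler0n//.
have -> : expR (1 : R) = expR n%:R^-1 ^+ n by rewrite -expRM_natl divff ?gt_eqF.
by apply: lerXn2r; rewrite ?nnegrE ?addr_ge0 ?invr_ge0 ?expR_ge0// expR_ge1Dx.
Qed.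

(** Here [Gamma(n) = n! / n], which accounts for the last [ln n]; the rest is [expn_le_fact]. *)
Lemma ln_Gammaf_nat n : (0 < n)%N ->
  n%:R * ln n%:R - n%:R - ln n%:R <= ln (Gammaf (n%:R : R)).
Proof.
case: n => // n _; rewrite Gammaf_nat.
have h := expn_le_fact n.+1; have f0 : 0 < n`!%:R :> R by rewrite ltr0n fact_gt0.
have n0 : 0 < n.+1%:R :> R by rewrite ltr0n.
have : ln ((n.+1%:R : R) ^+ n.+1) <= ln (expR n.+1%:R * n.+1`!%:R).
  by rewrite ler_ln ?posrE ?exprn_gt0// mulr_gt0 ?expR_gt0// ltr0n fact_gt0.
rewrite lnXn// lnM ?posrE ?expR_gt0 ?ltr0n ?fact_gt0// expRK factS natrM lnM ?posrE//.
by rewrite -mulr_natl; lra.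
Qed.

End invgamma_theory.

(** * Normal densities and the doubling of their variance *)

Section gauss_theory.
Context {R : realType}.
Notation mu := (@lebesgue_measure R).
Implicit Types (m v y : R).

Lemma gaussE m v y : 0 < v -> gauss m v y = normal_pdf m (Num.sqrt v) y.
Proof.
move=> v0; rewrite normal_pdfE ?sqrtr_eq0 -?ltNge//.
rewrite /normal_peak /normal_fun sqr_sqrtr ?ltW// /gauss.
congr (_^-1 * expR _); first by congr Num.sqrt; rewrite -mulr_natr; ring.
by rewrite [2 * v]mulrC mulr_natr.
Qed.

Lemma integral_gauss m v : 0 < v -> (\int[mu]_y (gauss m v y)%:E = 1)%E.
Proof.
move=> v0; under eq_integral do rewrite gaussE//.
exact: integral_normal_pdf.
Qed.

Lemma gauss_ge0 m v y : 0 <= gauss m v y.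
Proof. by rewrite mulr_ge0 ?invr_ge0 ?sqrtr_ge0 ?expR_ge0. Qed.

Lemma gauss_gt0 m v y : 0 < v -> 0 < gauss m v y.
Proof.
by move=> v0; rewrite mulr_gt0 ?expR_gt0// invr_gt0 sqrtr_gt0 !mulr_gt0// pi_gt0.
Qed.

Lemma measurable_sqrtr : measurable_fun setT (@Num.sqrt R).
Proof.
by apply: nondecreasing_measurable => // x y xy; exact: ler_wsqrtr.
Qed.

Lemma measurable_gauss d (T : measurableType d) (f g h : T -> R) :
  measurable_fun setT f -> measurable_fun setT g -> measurable_fun setT h ->
  measurable_fun setT (fun t => gauss (f t) (g t) (h t)).
Proof.
move=> mf mg mh; apply: measurable_funM.
  apply: (measurableT_comp measurable_invr); apply: (measurableT_comp measurable_sqrtr).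
  by apply: measurable_funM => //; exact: measurable_cst.
apply: (measurableT_comp (@measurable_expR R)); apply: measurable_funM.
  by apply: measurable_funN; apply: measurable_funX; exact: measurable_funB.
apply: (measurableT_comp measurable_invr).
by apply: measurable_funM => //; exact: measurable_cst.
Qed.

(** Half of the exponent is set aside and the other half read as a normal density of twice the
    variance. Polynomial and exponential weights are then paid by the first half, and the second
    still has mass one. *)
Lemma gauss_half m v y : 0 < v ->
  gauss m v y = Num.sqrt 2 * expR (- ((y - m) ^+ 2 / (4 * v))) * gauss m (2 * v) y.
Proof.
move=> v0; rewrite /gauss.
have -> : expR (- (y - m) ^+ 2 / (2 * v)) =
    expR (- ((y - m) ^+ 2 / (4 * v))) * expR (- (y - m) ^+ 2 / (2 * (2 * v))).
  by rewrite -expRD; congr expR; field; rewrite gt_eqF.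
have -> : Num.sqrt (2 * pi * (2 * v)) = Num.sqrt 2 * Num.sqrt (2 * pi * v).
  by rewrite -sqrtrM//; congr Num.sqrt; ring.
have s2 : Num.sqrt 2 != 0 :> R by rewrite sqrtr_eq0 -ltNge.
have sp : Num.sqrt (2 * pi * v) != 0 by rewrite sqrtr_eq0 -ltNge !mulr_gt0// pi_gt0.
by field; rewrite s2 sp.
Qed.

Lemma sqrtr2_le2 : Num.sqrt 2 <= 2 :> R.
Proof. by rewrite -[leRHS](@ger0_norm R)// -sqrtr_sqr ler_wsqrtr//; lra. Qed.

Lemma mul_expRN_le1 (u : R) : u * expR (- u) <= 1.
Proof.
rewrite expRN ler_pdivrMr ?expR_gt0// mul1r.
by apply: le_trans (expR_ge1Dx u); rewrite lerDr.
Qed.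

Lemma gauss_sq_le m v y : 0 < v -> (y - m) ^+ 2 * gauss m v y <= 8 * v * gauss m (2 * v) y.
Proof.
move=> v0; rewrite gauss_half// mulrA ler_wpM2r ?gauss_ge0//.
(* With this [u] the square is [4 v u]; the bounds [u exp(-u) <= 1] and [sqrt 2 <= 2] produce the
   constant 8. *)
set u := (y - m) ^+ 2 / (4 * v).
have -> : (y - m) ^+ 2 = 4 * v * u by rewrite /u; field; rewrite gt_eqF.
have := mul_expRN_le1 u; have := expR_ge0 (- u); have := sqrtr2_le2.
have := sqrtr_ge0 (2 : R); move: (Num.sqrt 2) (expR (- u)) => s e s0 s2 e0 ue.
have : s * (u * e) <= 2.
  by apply: le_trans (_ : s * 1 <= _); rewrite ?ler_wpM2l// mulr1.
have : 0 <= v by exact: ltW.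
by nra.
Qed.

Lemma gauss_expR m v y : 0 < v ->
  expR ((y - m) ^+ 2 / (4 * v)) * gauss m v y <= 2 * gauss m (2 * v) y.
Proof.
move=> v0; rewrite gauss_half// mulrA ler_wpM2r ?gauss_ge0//.
by rewrite mulrCA -expRD subrr expR0 mulr1 sqrtr2_le2.
Qed.

Lemma ln_gauss m v y : 0 < v ->
  ln (gauss m v y) = - (ln (2 * pi * v) / 2) - (y - m) ^+ 2 / (2 * v).
Proof.
move=> v0; have p0 : 0 < 2 * pi * v by rewrite !mulr_gt0// pi_gt0.
have s0 : 0 < Num.sqrt (2 * pi * v) by rewrite sqrtr_gt0.
have si0 : 0 < (Num.sqrt (2 * pi * v))^-1 by rewrite invr_gt0.
rewrite /gauss (@lnM _ _ _ si0 (expR_gt0 _)) expRK (@lnV _ _ s0).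
by rewrite -powR12_sqrt ?ltW// ln_powR mulNr [2^-1 * _]mulrC.
Qed.

End gauss_theory.

(** * Joint densities of a variance and independent normal weights *)

Section ignorm.
Context {R : realType}.
Notation mu := (@lebesgue_measure R).

(* the density of an inverse-gamma variance and independent normal weights;
   both the prior and the members of the variational family have this form *)
Definition ignorm (a b : R) (m v : nat -> R) (K : nat) (w : K.+1.-tuple R) : R :=
  invgamma a b (sig2 K w) * \prod_(i < K) gauss (m i) (v i) (nth 0 (theta K w) i).
Arguments ignorm a b m v K w : clear implicits.

Lemma priorE al lam zeta K w :
  prior al lam zeta K w = ignorm al lam (fun=> 0) (fun=> zeta ^+ 2) K w.
Proof. by []. Qed.

Lemma qdensE K (u : vparam R) w :
  qdens K u w = ignorm u.1.1.1 u.1.1.2 (nth 0 u.1.2) (fun i => nth 0 u.2 i ^+ 2) K w.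
Proof. by []. Qed.

Lemma measurable_sig2 K : measurable_fun setT (@sig2 R K).
Proof. exact: (measurable_tnth ord0). Qed.

Lemma measurable_theta K i : measurable_fun setT (fun w : K.+1.-tuple R => nth 0 (theta K w) i).
Proof.
rewrite (_ : (fun w => _) = fun w : K.+1.-tuple R => nth 0 w i.+1).
  exact: measurable_nth.
by apply/funext => w; rewrite /theta nth_behead.
Qed.

Lemma measurable_ignorm a b m v K : measurable_fun setT (ignorm a b m v K).
Proof.
apply: measurable_funM.
  by apply: (measurableT_comp (measurable_invgamma a b)); exact: measurable_sig2.
apply: measurable_prod => i _; apply: measurable_gauss; try exact: measurable_cst.
exact: measurable_theta.
Qed.

Lemma ignorm_ge0 a b m v K w : 0 < a -> 0 <= ignorm a b m v K w.
Proof.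
by move=> a0; rewrite mulr_ge0 ?invgamma_ge0//; apply: prodr_ge0 => i _; exact: gauss_ge0.
Qed.

Lemma ignorm_gt0 a b m v K w : 0 < a -> 0 < b -> (forall i, (i < K)%N -> 0 < v i) ->
  0 < sig2 K w -> 0 < ignorm a b m v K w.
Proof.
move=> a0 b0 v0 s0; rewrite mulr_gt0 ?invgamma_gt0//.
by apply: prodr_gt0 => i _; rewrite gauss_gt0// v0.
Qed.

Lemma ignorm_npos a b m v K w : sig2 K w <= 0 -> ignorm a b m v K w = 0.
Proof. by move=> s0; rewrite /ignorm /invgamma ltNge s0 mul0r. Qed.

Lemma iint_gauss (m v : nat -> R) K : (forall i, (i < K)%N -> 0 < v i) ->
  iint K (fun t => (\prod_(i < K) gauss (m i) (v i) (nth 0 t i))%:E) = 1%E.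
Proof.
move=> v0; rewrite (iint_prod K (fun i => gauss (m i) (v i)) (fun=> 1)).
- by rewrite big1.
- by move=> i; apply: measurable_gauss; try exact: measurable_cst.
- by move=> i x; exact: gauss_ge0.
- by move=> i iK; rewrite integral_gauss// v0.
Qed.

Lemma iint_ignorm a b m v K : 0 < a -> 0 < b -> (forall i, (i < K)%N -> 0 < v i) ->
  iint K.+1 (fun w => (ignorm a b m v K w)%:E) = 1%E.
Proof.
move=> a0 b0 v0 /=; rewrite -[RHS](integral_invgamma a b a0 b0).
apply: eq_integral => x _.
have -> : (fun t : K.-tuple R => (ignorm a b m v K [tuple of x :: t])%:E) =
    (fun t : K.-tuple R => (invgamma a b x)%:E * (\prod_(i < K) gauss (m i) (v i) (nth 0 t i))%:E)%E.
  by apply/funext => t; rewrite -EFinM.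
rewrite iintZl ?iint_gauss// ?mule1//.
- apply/measurable_EFinP/measurable_prod => i _.
  by apply: measurable_gauss; try exact: measurable_cst; exact: measurable_nth.
- by move=> t; rewrite lee_fin; apply: prodr_ge0 => i _; exact: gauss_ge0.
- by rewrite lee_fin invgamma_ge0.
Qed.

(* A squared coordinate times a normal density is at most a multiple of the density
   with that variance doubled. *)
Definition dbl (v : nat -> R) (j i : nat) : R := if i == j then 2 * v i else v i.

Lemma dbl_gt0 v j i : 0 < v i -> 0 < dbl v j i.
Proof. by move=> v0; rewrite /dbl; case: ifP => // _; rewrite mulr_gt0. Qed.

(** Only factor [j] of the product changes, so a one-dimensional bound on that factor passes to the
    joint density. *)
Lemma ignorm_dblE (c : R) (g : R -> R) a b (m v : nat -> R) K w (j : 'I_K) : 0 < a ->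
  (forall y, g y * gauss (m j) (v j) y <= c * gauss (m j) (2 * v j) y) ->
  g (nth 0 (theta K w) j) * ignorm a b m v K w <= c * ignorm a b m (dbl v j) K w.
Proof.
move=> a0 gc; rewrite /ignorm (bigD1 j)//= [X in _ <= c * (_ * X)](bigD1 j)//=.
have -> : \prod_(i < K | i != j) gauss (m i) (dbl v j i) (nth 0 (theta K w) i) =
    \prod_(i < K | i != j) gauss (m i) (v i) (nth 0 (theta K w) i).
  by apply: eq_bigr => i ij; rewrite /dbl ifF//; apply/negbTE.
have -> : dbl v j j = 2 * v j by rewrite /dbl eqxx.
set t := nth 0 _ j; set Q := \prod_(i < K | _) _; set I := invgamma _ _ _.
have I0 : 0 <= I by exact: invgamma_ge0.
have Q0 : 0 <= Q by apply: prodr_ge0 => i _; exact: gauss_ge0.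
have := gc t; set x := gauss _ _ _; set y := gauss _ _ _ => h.
rewrite (_ : g t * _ = (I * Q) * (g t * x)); last by ring.
rewrite (_ : c * _ = (I * Q) * (c * y)); last by ring.
by rewrite ler_wpM2l// mulr_ge0.
Qed.

Lemma ignorm_sqr a b (m v : nat -> R) K w (j : 'I_K) : 0 < a -> 0 < v j ->
  (nth 0 (theta K w) j - m j) ^+ 2 * ignorm a b m v K w <=
  8 * v j * ignorm a b m (dbl v j) K w.
Proof.
move=> a0 v0; apply: (ignorm_dblE _ (fun y => (y - m j) ^+ 2)) => // y.
exact: gauss_sq_le.
Qed.

Lemma ignorm_expR a b (m v : nat -> R) K w (j : 'I_K) : 0 < a -> 0 < v j ->
  expR ((nth 0 (theta K w) j - m j) ^+ 2 / (4 * v j)) * ignorm a b m v K w <=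
  2 * ignorm a b m (dbl v j) K w.
Proof.
move=> a0 v0; apply: (ignorm_dblE _ (fun y => expR ((y - m j) ^+ 2 / (4 * v j)))) => // y.
exact: gauss_expR.
Qed.

End ignorm.

(** * The variational inequality *)

Section variational_bound.
Context {R : realType} (m : nat).
Notation mu := (tuple_measure R m).
Implicit Types (f q r : m.-tuple R -> R).

Lemma iint_integrable f (c : R) : measurable_fun setT f -> (forall w, 0 <= f w) ->
  (iint m (fun w => (f w)%:E) = c%:E)%E ->
  mu.-integrable setT (EFin \o f) /\ (\int[mu]_w (f w)%:E = c%:E)%E.
Proof.
move=> mf f0; rewrite iintE//; last exact/measurable_EFinP; move=> fc.
split => //; apply/integrableP; split; first exact/measurable_EFinP.
rewrite (eq_integral (fun w => (f w)%:E)) ?fc ?ltry// => w _ /=.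
by rewrite ger0_norm.
Qed.

Lemma KL_integral q r : measurable_fun setT q -> measurable_fun setT r ->
  (forall w, 0 < q w /\ 0 < r w \/ q w = 0) ->
  KL m q r = (\int[mu]_w (q w * ln (q w / r w))%:E)%E.
Proof.
move=> mq mr qr; rewrite /KL /iint_signed.
have E w : klterm (q w) (r w) = (q w * ln (q w / r w))%:E.
  rewrite /klterm; case: (qr w) => [[q0 r0]|->]; last by rewrite eqxx mul0r.
  by rewrite gt_eqF// leNgt r0.
have mk : measurable_fun setT (fun w => (q w * ln (q w / r w))%:E).
  apply/measurable_EFinP; apply: measurable_funM => //.
  apply: (measurableT_comp (@measurable_ln R)); apply: measurable_funM => //.
  exact: (measurableT_comp measurable_invr).
rewrite [RHS]integralE !iintE; first last.
- by move=> w; rewrite E le_max lexx orbT.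
- under eq_fun do rewrite E.
  by apply: measurable_maxe; [exact: mk|exact: measurable_cst].
- by move=> w; rewrite E le_max lexx orbT.
- under eq_fun do rewrite E.
  apply: measurable_maxe; last exact: measurable_cst.
  by apply/measurable_EFinP; apply: measurable_funN; exact/measurable_EFinP.
by congr (_ - _)%E; apply: eq_integral => w _; rewrite E ?funeposE ?funenegE.
Qed.

Lemma sube_le_fin_lty (x y : \bar R) (a b : R) : (0 <= y)%E -> (y <= a%:E)%E ->
  (x - y <= b%:E)%E -> (x < +oo)%E.
Proof. by case: x => [x| |] //=; rewrite ?ltry ?ltNyr//; case: y. Qed.

(** This is [ln t <= t - 1] at [t = y / x], the pointwise form of the nonnegativity of the
    Kullback-Leibler divergence. *)
Lemma mul_ln_div_ge (x y : R) : 0 < x -> 0 < y -> x - y <= x * ln (x / y).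
Proof.
move=> x0 y0; have h : ln (y / x) <= y / x - 1.
  have yx : 0 < y / x by rewrite divr_gt0.
  have := @le_ln1Dx R (y / x - 1); rewrite [1 + _]addrC subrK; apply; lra.
have -> : ln (x / y) = - ln (y / x) by rewrite -lnV ?posrE ?divr_gt0// invf_div.
have : x * ln (y / x) <= x * (y / x - 1) by rewrite ler_wpM2l// ltW.
by rewrite mulrBr mulr1 mulrCA divff ?gt_eqF// mulr1; lra.
Qed.

(* [P] is the prior, [L] the likelihood and [r] the posterior. *)
Lemma vb_bound q q' (P L U : m.-tuple R -> R) (A : m.-tuple R -> bool) (T B c G : R) :
  measurable_fun setT q -> measurable_fun setT q' -> measurable_fun setT P ->
  measurable_fun setT L -> measurable_fun setT U ->
  measurable_fun setT (fun w => (A w)%:R : R) ->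
  (forall w, [/\ 0 < q w, 0 < q' w, 0 < P w & 0 < L w] \/
             [/\ q w = 0, q' w = 0, P w = 0 & 0 <= L w]) ->
  (iint m (fun w => (q w)%:E) = 1)%E -> (iint m (fun w => (q' w)%:E) = 1)%E ->
  0 <= T -> (forall w, 0 <= U w) ->
  (forall w, 0 < q' w -> ln (q' w / (L w * P w)) <= U w + c) ->
  (iint m (fun w => (q' w * U w)%:E) <= B%:E)%E ->
  (iint m (fun w => (L w * P w * expR (T * (A w)%:R))%:E) <= G%:E)%E ->
  let r := fun w => L w * P w / fine (iint m (fun w => (L w * P w)%:E)) in
  (KL m q r <= KL m q' r)%E ->
  (T%:E * iint m (fun w => ((A w)%:R * q w)%:E) <= (B + c + ln G)%:E)%E.
Proof.
move=> mq mq' mP mL mU mA D iq iq' T0 U0 hU hB hG r hKL.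
have q0 w : 0 <= q w by case: (D w) => [[/ltW//]|[->]].
have q'0 w : 0 <= q' w by case: (D w) => [[_ /ltW//]|[_ ->]].
have LP0 w : 0 <= L w * P w.
  by case: (D w) => [[_ _ /ltW h1 /ltW h2]|[_ _ -> _]]; rewrite ?mulr0// mulr_ge0.
pose e w := expR (T * (A w)%:R).
have e1 w : 1 <= e w by rewrite -expR0 ler_expR mulr_ge0.
have mLP : measurable_fun setT (fun w => L w * P w) by exact: measurable_funM.
have me : measurable_fun setT e.
  apply: (measurableT_comp (@measurable_expR R)).
  by apply: measurable_funM; [exact: measurable_cst|exact: mA].
have LPe0 w : 0 <= L w * P w * e w by rewrite mulr_ge0// expR_ge0.
have mLPe : measurable_fun setT (fun w => L w * P w * e w) by exact: measurable_funM.
pose N := fine (iint m (fun w => (L w * P w * e w)%:E)).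
have NE : (iint m (fun w => (L w * P w * e w)%:E) = N%:E)%E.
  rewrite fineK// fin_numElt; apply/andP; split.
    by apply: (@lt_le_trans _ _ 0%E) => //; apply: iint_ge0.
  exact: le_lt_trans hG (ltry _).
have NG : N <= G by rewrite -lee_fin -NE.
have LPle w : L w * P w <= L w * P w * e w by rewrite ler_peMr.
set Z := fine (iint m (fun w => (L w * P w)%:E)) in r hKL.
have ZN' : (iint m (fun w => (L w * P w)%:E) <= N%:E)%E.
  by rewrite -NE; apply: le_iint => w; rewrite lee_fin.
have ZE : (iint m (fun w => (L w * P w)%:E) = Z%:E)%E.
  rewrite fineK// fin_numElt; apply/andP; split.
    by apply: (@lt_le_trans _ _ 0%E) => //; apply: iint_ge0.
  exact: le_lt_trans ZN' (ltry _).
have ZN : Z <= N by rewrite -lee_fin -ZE.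
have [iqI Eq] := iint_integrable _ _ mq q0 iq.
have [iq'I Eq'] := iint_integrable _ _ mq' q'0 iq'.
have [iLP ELP] := iint_integrable _ _ mLP LP0 ZE.
have [iLPe ELPe] := iint_integrable _ _ mLPe LPe0 NE.
(* If [Z] were zero, [L * P] would vanish almost everywhere, and with it [q], which is positive only
   where [L * P] is; but [q] has integral one. *)
have Z0 : 0 < Z.
  rewrite lt_neqAle; apply/andP; split; last first.
    by rewrite -lee_fin -ZE; apply: iint_ge0.
  apply/negP => /eqP Z0.
  have : (\int[mu]_w `|(L w * P w)%:E| = 0)%E.
    transitivity (Z%:E); last by rewrite -Z0.
    by rewrite -ELP; apply: eq_integral => w _; rewrite gee0_abs// lee_fin.
  move=> /(ae_eq_integral_abs mu measurableT (measurable_int _ iLP)) h.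
  have : (\int[mu]_w (q w)%:E = \int[mu]_w (cst 0%E w))%E.
    apply: ge0_ae_eq_integral => //; first exact/measurable_EFinP.
      by move=> w _; rewrite lee_fin.
    apply: filterS h => w /= hw _; have := hw I.
    case: (D w) => [[_ _ p l]|[->]//] /eqP.
    by rewrite eqe gt_eqF// mulr_gt0.
  by rewrite Eq integral0 => /eqP; rewrite eqe oner_eq0.
have N0 : 0 < N by exact: lt_le_trans Z0 ZN.
pose lZ := ln Z; pose lC := ln (N / Z).
have mr : measurable_fun setT r by apply: measurable_funM => //; exact: measurable_cst.
have r0 w : 0 <= r w by rewrite mulr_ge0// invr_ge0 ltW.
have Dq w : 0 < q w /\ 0 < r w \/ q w = 0.
  case: (D w) => [[a b p l]|[]]; [left; split => //|by right].
  by rewrite divr_gt0// mulr_gt0.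
have Dq' w : 0 < q' w /\ 0 < r w \/ q' w = 0.
  case: (D w) => [[a b p l]|[]]; [left; split => //|by right].
  by rewrite divr_gt0// mulr_gt0.
move: hKL; rewrite !KL_integral//.
pose k q w := q w * ln (q w / r w).
have mk (f : m.-tuple R -> R) : measurable_fun setT f -> measurable_fun setT (k f).
  move=> mf; apply: measurable_funM => //.
  apply: (measurableT_comp (@measurable_ln R)); apply: measurable_funM => //.
  exact: (measurableT_comp measurable_invr).
(* The divergence integrand can only be negative down to [- r], and [r] is integrable; so negative
   parts never cause trouble. *)
have kge (f : m.-tuple R -> R) w : 0 < f w /\ 0 < r w \/ f w = 0 -> - r w <= k f w.
  move=> [[f0 rw]|f0]; last by rewrite /k f0 mul0r oppr_le0.
  by have := mul_ln_div_ge _ _ f0 rw; rewrite /k; lra.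
have ir : mu.-integrable setT (EFin \o r) /\ (\int[mu]_w (r w)%:E = 1)%E.
  split.
    have := @integrableZr _ _ _ mu setT measurableT Z^-1 _ iLP.
    by apply: eq_integrable => // w _; rewrite /= -EFinM.
  apply: (eq_trans _ (eq_trans (@integralZr _ _ _ mu setT measurableT _ iLP Z^-1) _)).
    by apply: eq_integral => w _; rewrite /= -EFinM.
  by rewrite [X in (X * _)%E]ELP -EFinM divff ?gt_eqF.
have [irI Er] := ir.
have iq'U : mu.-integrable setT (EFin \o (fun w => q' w * U w)) /\
    (\int[mu]_w (q' w * U w)%:E <= B%:E)%E.
  have m' : measurable_fun setT (fun w => q' w * U w) by exact: measurable_funM.
  have g0 w : 0 <= q' w * U w by rewrite mulr_ge0.
  have E : (iint m (fun w => (q' w * U w)%:E) = (fine (iint m (fun w => (q' w * U w)%:E)))%:E)%E.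
    rewrite fineK// fin_numElt; apply/andP; split.
      by apply: (@lt_le_trans _ _ 0%E) => //; apply: iint_ge0 => w; rewrite lee_fin.
    exact: le_lt_trans hB (ltry _).
  have [i1 i2] := iint_integrable _ _ m' g0 E.
  by split => //; rewrite i2 -E.
have [iq'UI Bq'U] := iq'U.
(* An integrable majorant of the divergence integrand of [q']; [lZ] comes from the normalisation of
   [r]. *)
pose h w := q' w * U w + (c + lZ) * q' w.
have ih : mu.-integrable setT (EFin \o h).
  have := integrableD measurableT iq'UI (integrableZl measurableT (c + lZ) iq'I).
  by apply: eq_integrable => // w _.
have Eh : (\int[mu]_w (h w)%:E <= (B + c + lZ)%:E)%E.
  have i2 := @integrableZl _ _ _ mu setT measurableT (c + lZ) _ iq'I.
  have -> : (\int[mu]_w (h w)%:E = \int[mu]_w (q' w * U w)%:E + (c + lZ)%:E * \int[mu]_w (q' w)%:E)%E.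
    rewrite -(integralZl measurableT iq'I) -(integralD measurableT iq'UI i2).
    by apply: eq_integral => w _.
  have -> : ((B + c + lZ)%:E = B%:E + (c + lZ)%:E)%E by rewrite -EFinD addrA.
  by rewrite Eq' mule1; exact: leeD2r.
have kh w : k q' w <= h w.
  case: (D w) => [[_ qw p l]|[_ qw _ _]]; last by rewrite /k /h qw !mul0r mulr0 addr0.
  have lp : 0 < L w * P w by rewrite mulr_gt0.
  rewrite /k /h [(c + _) * _]mulrC -mulrDr ler_wpM2l ?(ltW qw)//.
  have -> : q' w / r w = q' w / (L w * P w) * Z by rewrite /r; field; rewrite !gt_eqF.
  by rewrite lnM ?posrE ?divr_gt0//; have := hU w qw; rewrite /lZ; lra.
have ik' : mu.-integrable setT (EFin \o k q').
  (* From [- r <= k <= h] follows [|k| <= h + 2 r]: one copy of [r] makes [h + r] nonnegative, the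
     other dominates the negative part of [k]. *)
  apply: (@le_integrable _ _ _ mu setT measurableT _ (fun w => (h w)%:E + (r w)%:E + (r w)%:E)%E).
  - by apply/measurable_EFinP; exact: mk.
  - move=> w _ /=; rewrite lee_fin.
    have a1 := kge q' w (Dq' w); have a2 := kh w; have a3 := r0 w.
    apply: (le_trans _ (ler_norm _)).
    by rewrite ler_norml; apply/andP; split; lra.
  - by apply: integrableD => //; apply: integrableD.
have Ek' : (\int[mu]_w (k q' w)%:E <= (B + c + lZ)%:E)%E.
  by apply: le_trans Eh; apply: le_integral => // w _; rewrite lee_fin.
move=> hKL; have {}hKL : (\int[mu]_w (k q w)%:E <= (B + c + lZ)%:E)%E by exact: le_trans hKL Ek'.
have mkq : measurable_fun setT (fun w => (k q w)%:E) by apply/measurable_EFinP; exact: mk.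
have ikn : (\int[mu]_w ((fun w => (k q w)%:E)^\- w) <= 1)%E.
  rewrite -Er; apply: ge0_le_integral => //.
  - exact: measurable_funeneg.
  - exact/measurable_EFinP.
  - move=> w _; rewrite funenegE; have := kge q w (Dq w); have := r0 w => a1 a2.
    by rewrite -EFinN -EFin_max lee_fin ge_max a1 andbT; lra.
(* The positive part is integrable because the divergence of [q] is at most that of [q'], which is
   finite, and the subtracted negative part is at most one. *)
have ik : mu.-integrable setT (EFin \o k q).
  apply/integrableP; split => //.
  rewrite (eq_integral (fun w => (fun w => (k q w)%:E)^\+ w + (fun w => (k q w)%:E)^\- w)%E); last first.
    by move=> w _; have := fune_abse (fun w => (k q w)%:E) => /(congr1 (@^~ w)).
  rewrite ge0_integralD//; [|exact: measurable_funepos|exact: measurable_funeneg].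
  apply: lte_add_pinfty; last exact: le_lt_trans ikn (ltry _).
  have n0 : (0 <= \int[mu]_w ((fun w => (k q w)%:E)^\- w))%E by apply: integral_ge0.
  by rewrite integralE in hKL; exact: (sube_le_fin_lty _ _ _ _ n0 ikn hKL).
(* The posterior tilted by [exp(T 1_A)] and renormalised. The Donsker-Varadhan inequality is the
   nonnegativity of the divergence of [q] from this density. *)
pose g w := L w * P w * e w / N.
have ig : mu.-integrable setT (EFin \o g) /\ (\int[mu]_w (g w)%:E = 1)%E.
  split.
    have := @integrableZr _ _ _ mu setT measurableT N^-1 _ iLPe.
    by apply: eq_integrable => // w _; rewrite /= -EFinM.
  apply: (eq_trans _ (eq_trans (@integralZr _ _ _ mu setT measurableT _ iLPe N^-1) _)).
    by apply: eq_integral => w _; rewrite /= -EFinM.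
  by rewrite [X in (X * _)%E]ELPe -EFinM divff ?gt_eqF.
have [igI Eg] := ig.
have mqA : measurable_fun setT (fun w => (A w)%:R * q w) by exact: measurable_funM.
have qA0 w : 0 <= (A w)%:R * q w by rewrite mulr_ge0.
have EA : (iint m (fun w => ((A w)%:R * q w)%:E) = (fine (iint m (fun w => ((A w)%:R * q w)%:E)))%:E)%E.
  rewrite fineK// fin_numElt; apply/andP; split.
    by apply: (@lt_le_trans _ _ 0%E) => //; apply: iint_ge0 => w; rewrite lee_fin.
  apply: (@le_lt_trans _ _ 1%E); rewrite ?ltry// -iq; apply: le_iint => w; rewrite lee_fin//.
  by case: (A w); rewrite ?mul1r// mul0r.
have [iA EAi] := iint_integrable _ _ mqA qA0 EA.
move: EA EAi; set a := fine _ => EA EAi; rewrite EA -EFinM lee_fin.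
(* A minorant of [q ln(q / r)] that is linear in integrable functions: [q ln(q / g)] is replaced by
   [q - g], so integrability of the tilted divergence never comes up. *)
pose l w := q w - g w + (T * ((A w)%:R * q w) - lC * q w).
have lk w : l w <= k q w.
  case: (D w) => [[qw _ p lw]|[qw _ pw lw]]; last first.
    by rewrite /l /k qw /g pw !(mulr0, mul0r) !subr0 addr0.
  have lp : 0 < L w * P w by rewrite mulr_gt0.
  have e0 : 0 < e w by exact: expR_gt0.
  have gw : 0 < g w by rewrite divr_gt0// mulr_gt0.
  rewrite /k; have -> : q w / r w = q w / g w * (e w / (N / Z)).
    by rewrite /r /g; field; rewrite !gt_eqF.
  have NZ : 0 < N / Z by rewrite divr_gt0.
  have -> : ln (q w / g w * (e w / (N / Z))) = ln (q w / g w) + (T * (A w)%:R - lC).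
    have p1 : 0 < q w / g w by exact: divr_gt0.
    have p2 : 0 < e w / (N / Z) by exact: divr_gt0.
    by rewrite (@lnM _ _ _ p1 p2) (@ln_div _ _ _ e0 NZ) expRK.
  rewrite mulrDr.
  have := mul_ln_div_ge _ _ qw gw; rewrite /l; set x := q w * ln _ => hx.
  have -> : q w * (T * (A w)%:R - lC) = T * ((A w)%:R * q w) - lC * q w by ring.
  by rewrite lerD2r.
have i1 := integrableB measurableT iqI igI.
have i2 := @integrableZl _ _ _ mu setT measurableT T _ iA.
have i3 := @integrableZl _ _ _ mu setT measurableT lC _ iqI.
have i4 := integrableB measurableT i2 i3.
have il : mu.-integrable setT (EFin \o l).
  by have := integrableD measurableT i1 i4; apply: eq_integrable.
have El : (\int[mu]_w (l w)%:E = (T * a - lC)%:E)%E.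
  transitivity (\int[mu]_w (((EFin \o q) \- (EFin \o g)) w +
    ((fun x => T%:E * (EFin \o (fun w => ((A w)%:R * q w)%R)) x) \- (fun x => lC%:E * (EFin \o q) x)) w))%E.
    by apply: eq_integral.
  rewrite (integralD measurableT i1 i4) (integralB measurableT iqI igI).
  rewrite (integralB measurableT i2 i3) !integralZl//.
  by rewrite [in LHS]/comp Eq Eg EAi subee// add0e mule1 -EFinM.
have : (\int[mu]_w (l w)%:E <= \int[mu]_w (k q w)%:E)%E.
  by apply: le_integral => // w _; rewrite lee_fin.
rewrite El => /le_trans/(_ hKL); rewrite lee_fin => hfin.
(* Both sides contain [ln Z], which cancels here; the unknown normalising constant leaves the
   bound. *)
have lCE : lC = ln N - lZ by rewrite /lC lnM ?posrE ?invr_gt0// lnV ?posrE.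
have : ln N <= ln G by rewrite ler_ln ?posrE// (lt_le_trans N0).
by lra.
Qed.

End variational_bound.

(** * The log-likelihood ratio of networks *)

Section network.
Context {R : realType}.
Implicit Types (u v : R) (p k : nat).

Lemma measurable_fnet d (T : measurableType d) p k (th : T -> seq R) (x : T -> p.-tuple R) :
  (forall i, measurable_fun setT (fun t => nth 0 (th t) i)) -> measurable_fun setT x ->
  measurable_fun setT (fun t => fnet p k (th t) (x t)).
Proof.
move=> mth mx; apply: measurable_funD; first exact: mth.
apply: measurable_sum => j; apply: measurable_funM; first exact: mth.
apply: (@measurableT_comp _ _ _ _ _ _ (@sigmoid R)).
  apply: measurable_funM; first exact: measurable_cst.
  apply: (measurableT_comp measurable_invr); apply: measurable_funD; first exact: measurable_cst.
  by apply: (measurableT_comp (@measurable_expR R)); exact: measurable_funN.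
apply: measurable_funD; first exact: mth.
apply: measurable_sum => h; apply: measurable_funM; first exact: mth.
exact: (measurableT_comp (measurable_tnth h) mx).
Qed.

Lemma sigmoid_ge0 u : 0 <= sigmoid u.
Proof. by rewrite divr_ge0// addr_ge0// expR_ge0. Qed.

Lemma sigmoid_le1 u : sigmoid u <= 1.
Proof.
have e0 := expR_gt0 (- u).
by rewrite /sigmoid ler_pdivrMr ?mul1r ?lerDl ?ltW// ltr_wpDl.
Qed.

(** For [u <= v] the tangent of the exponential bounds the numerator of the difference by
    [(v - u) exp(-u)], and [exp(-u)] is absorbed by the denominator. *)
Lemma sigmoid_lip u v : `|sigmoid u - sigmoid v| <= `|u - v|.
Proof.
wlog uv : u v / u <= v.
  move=> h; have [/h//|/ltW/h] := leP u v.
  by rewrite distrC [X in _ <= X -> _]distrC.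
have eu := expR_gt0 (- u); have ev := expR_gt0 (- v).
have E : sigmoid u - sigmoid v =
    (expR (- v) - expR (- u)) / ((1 + expR (- u)) * (1 + expR (- v))).
  by rewrite /sigmoid; field; rewrite !gt_eqF// ltr_wpDl.
have d0 : 0 < (1 + expR (- u)) * (1 + expR (- v)) by rewrite mulr_gt0// ltr_wpDl.
rewrite E normrM normfV (ger0_norm (ltW d0)) ler_pdivrMr//.
have h1 : expR (- v) <= expR (- u) by rewrite ler_expR lerN2.
rewrite distrC ger0_norm ?subr_ge0// distrC ger0_norm ?subr_ge0//.
have h2 : expR (- v) >= expR (- u) * (1 + (u - v)).
  rewrite (_ : expR (- v) = expR (- u) * expR (u - v)); last by rewrite -expRD; congr expR; ring.
  by rewrite ler_wpM2l ?expR_ge0// expR_ge1Dx.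
have : (v - u) * expR (- u) <= (v - u) * ((1 + expR (- u)) * (1 + expR (- v))).
  by rewrite ler_wpM2l ?subr_ge0//; nra.
by nra.
Qed.

Lemma sum_ord_mul (g : nat -> R) k m :
  \sum_(i < k * m) g i = \sum_(j < k) \sum_(h < m) g (j * m + h)%N.
Proof.
elim: k => [|k IH]; first by rewrite mul0n !big_ord0.
rewrite big_ord_recr/= -IH.
have -> : (k.+1 * m = k * m + m)%N by rewrite mulSn addnC.
by rewrite big_split_ord/=.
Qed.

Lemma sum_Kpar (g : nat -> R) p k :
  \sum_(i < Kpar p k) g i =
  \sum_(j < k.+1) g j + \sum_(j < k) \sum_(h < p.+1) g (k.+1 + j * p.+1 + h)%N.
Proof.
rewrite /Kpar add1n big_split_ord/=; congr (_ + _).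
rewrite (sum_ord_mul (fun i => g (k.+1 + i)%N)).
by apply: eq_bigr => j _; apply: eq_bigr => h _; rewrite addnA.
Qed.

Lemma in_cubeP p (x : p.-tuple R) (h : 'I_p) : in_cube x -> 0 <= tnth x h <= 1.
Proof. by move=> /all_tnthP/(_ h). Qed.

Lemma ltn_Kpar p k (j : 'I_k) : (j.+1 < Kpar p k)%N.
Proof. by rewrite /Kpar add1n addSn ltnS ltn_addr. Qed.

(** The splitting [b psi(u) - b' psi(u') = (b - b') psi(u) + b' (psi(u) - psi(u'))] requires a size
    bound for one parameter vector only. This matters under [q'], where the other vector is an
    unbounded normal draw. *)
Lemma fnet_lip p k (th th' : seq R) (x : p.-tuple R) (M : R) : in_cube x -> 0 <= M ->
  (forall i, (i < Kpar p k)%N -> `|nth 0 th' i| <= M) ->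
  `|fnet p k th x - fnet p k th' x| <=
  (1 + M) * \sum_(i < Kpar p k) `|nth 0 th i - nth 0 th' i|.
Proof.
move=> xc M0 thM; rewrite (sum_Kpar (fun i => `|nth 0 th i - nth 0 th' i|)).
pose D i := `|nth 0 th i - nth 0 th' i|; rewrite -!/(D _).
have D0 i : 0 <= D i by exact: normr_ge0.
set u := fun (t : seq R) (j : 'I_k) => gamma_ p k t j 0 +
  \sum_(h < p) gamma_ p k t j h.+1 * tnth x h.
have ud j : `|u th j - u th' j| <= \sum_(h < p.+1) D (k.+1 + j * p.+1 + h)%N.
  have -> : u th j - u th' j = (gamma_ p k th j 0 - gamma_ p k th' j 0) +
      \sum_(h < p) (gamma_ p k th j h.+1 - gamma_ p k th' j h.+1) * tnth x h.
    rewrite /u opprD addrACA -sumrB; congr (_ + _).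
    by apply: eq_bigr => h _; rewrite mulrBl.
  rewrite big_ord_recl; apply: (le_trans (ler_normD _ _)); apply: lerD => //.
  apply: (le_trans (ler_norm_sum _ _ _)); apply: ler_sum => h _.
  rewrite normrM; have /andP[x0 x1] := in_cubeP _ _ h xc.
  by rewrite (ger0_norm x0) ler_piMr.
have -> : fnet p k th x - fnet p k th' x = (nth 0 th 0 - nth 0 th' 0) +
   \sum_(j < k) ((nth 0 th j.+1 - nth 0 th' j.+1) * sigmoid (u th j) +
     nth 0 th' j.+1 * (sigmoid (u th j) - sigmoid (u th' j))).
  rewrite /fnet opprD addrACA -sumrB; congr (_ + _); apply: eq_bigr => j _.
  by rewrite /beta_ /u; ring.
apply: (le_trans (ler_normD _ _)).
have h1 : `|\sum_(j < k) ((nth 0 th j.+1 - nth 0 th' j.+1) * sigmoid (u th j) +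
     nth 0 th' j.+1 * (sigmoid (u th j) - sigmoid (u th' j)))| <=
     \sum_(j < k) D j.+1 + M * \sum_(j < k) \sum_(h < p.+1) D (k.+1 + j * p.+1 + h)%N.
  rewrite mulr_sumr -big_split/=; apply: (le_trans (ler_norm_sum _ _ _)).
  apply: ler_sum => j _; apply: (le_trans (ler_normD _ _)); apply: lerD.
    by rewrite normrM (ger0_norm (sigmoid_ge0 _)) ler_piMr// sigmoid_le1.
  rewrite normrM; apply: ler_pM => //; first exact: (thM _ (ltn_Kpar _ _ j)).
  exact: le_trans (sigmoid_lip _ _) (ud j).
rewrite big_ord_recl/=.
have s1 : 0 <= \sum_(i < k) D (bump 0 i) by apply: sumr_ge0.
have s2 : 0 <= \sum_(j < k) \sum_(h < p.+1) D (k.+1 + j * p.+1 + h)%N.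
  by apply: sumr_ge0 => j _; apply: sumr_ge0.
have d0 := D0 0%N.
have bE : \sum_(i < k) D (bump 0 i) = \sum_(i < k) D i.+1 by apply: eq_bigr.
move: h1 s1 s2; rewrite bE; set A := `|_|; set B := \sum_(j < k) D j.+1.
set C := \sum_(j < k) _ => h1 s1 s2.
rewrite -/(D 0%N); nra.
Qed.

Lemma fnet_bound p k (th : seq R) (x : p.-tuple R) (M : R) : 0 <= M ->
  (forall i, (i < Kpar p k)%N -> `|nth 0 th i| <= M) -> `|fnet p k th x| <= (Kpar p k)%:R * M.
Proof.
move=> M0 thM; apply: (@le_trans _ _ (k.+1%:R * M)); last first.
  by rewrite ler_wpM2r// ler_nat /Kpar add1n leq_addr.
rewrite -natr1 mulrDl mul1r [leRHS]addrC; apply: (le_trans (ler_normD _ _)); apply: lerD; first exact: thM.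
apply: (le_trans (ler_norm_sum _ _ _)).
rewrite mulr_natl -[X in _ *+ X]card_ord -sumr_const; apply: ler_sum => j _.
rewrite normrM (ger0_norm (sigmoid_ge0 _)) -[leRHS]mulr1; apply: ler_pM => //.
- exact: sigmoid_ge0.
- exact: (thM _ (ltn_Kpar _ _ j)).
- exact: sigmoid_le1.
Qed.

(** Cauchy-Schwarz, read off from the nonnegative double sum of [(g i - g j) ^+ 2]. *)
Lemma sqr_sum_le K (g : 'I_K -> R) : (\sum_i g i) ^+ 2 <= K%:R * \sum_i g i ^+ 2.
Proof.
have h : 0 <= \sum_(i < K) \sum_(j < K) (g i - g j) ^+ 2.
  by apply: sumr_ge0 => i _; apply: sumr_ge0 => j _; exact: sqr_ge0.
have E : \sum_(i < K) \sum_(j < K) (g i - g j) ^+ 2 =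
   2 * (K%:R * \sum_i g i ^+ 2 - (\sum_i g i) ^+ 2).
  transitivity (\sum_(i < K) (K%:R * g i ^+ 2 - 2 * g i * \sum_j g j + \sum_j g j ^+ 2)).
    apply: eq_bigr => i _; rewrite mulr_sumr.
    rewrite -[K in K%:R](card_ord K) -sum1_card natr_sum mulr_suml -sumrB -big_split/=.
    by apply: eq_bigr => j _; ring.
  rewrite big_split sumrB/= -mulr_suml -!mulr_sumr sumr_const card_ord.
  by rewrite -mulr_natl; ring.
by lra.
Qed.

Lemma fnet_sqr_lip p k (th th0 : seq R) (x : p.-tuple R) : in_cube x ->
  (fnet p k th x - fnet p k th0 x) ^+ 2 <=
  (2 + \sum_(i < Kpar p k) nth 0 th0 i ^+ 2) ^+ 2 * (Kpar p k)%:R *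
  \sum_(i < Kpar p k) (nth 0 th i - nth 0 th0 i) ^+ 2.
Proof.
move=> xc; set S := \sum_(i < _) nth 0 th0 i ^+ 2; set D := \sum_(i < _) (_ - _) ^+ 2.
have S0 : 0 <= S by apply: sumr_ge0 => i _; exact: sqr_ge0.
(* From [|t| <= 1 + t^2], which keeps square roots of [S] out of the constants. *)
have thM i : (i < Kpar p k)%N -> `|nth 0 th0 i| <= 1 + S.
  move=> iK; have : nth 0 th0 i ^+ 2 <= S.
    rewrite /S (bigD1 (Ordinal iK))//= lerDl; apply: sumr_ge0 => j _; exact: sqr_ge0.
  rewrite -real_normK ?num_real//; have := normr_ge0 (nth 0 th0 i).
  by move: (`|_|) => u; nra.
have lip := fnet_lip p k th th0 x (1 + S) xc (addr_ge0 ler01 S0) thM.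
have sq := sqr_sum_le _ (fun i : 'I_(Kpar p k) => `|nth 0 th i - nth 0 th0 i|).
have DE : \sum_(i < Kpar p k) `|nth 0 th i - nth 0 th0 i| ^+ 2 = D.
  by apply: eq_bigr => i _; rewrite real_normK ?num_real.
rewrite DE in sq; rewrite -real_normK ?num_real//.
set N := \sum_(i < _) `|_| in lip sq.
have N0 : 0 <= N by apply: sumr_ge0.
apply: (@le_trans _ _ (((2 + S) * N) ^+ 2)).
  rewrite lerXn2r ?nnegrE// ?mulr_ge0 ?addr_ge0//.
  by apply: (le_trans lip); rewrite ler_wpM2r//; lra.
by rewrite exprMn -mulrA ler_wpM2l// sqr_ge0.
Qed.

End network.

(** * The log-ratio of [q'] to likelihood times prior *)

Section log_ratio.
Context {R : realType}.

Lemma sum_sqr_dist_ge0 K (w : K.+1.-tuple R) (m : nat -> R) :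
  0 <= \sum_(j < K) (nth 0 (theta K w) j - m j) ^+ 2.
Proof. by apply: sumr_ge0 => j _; exact: sqr_ge0. Qed.

Lemma measurable_sum_sqr K (m : nat -> R) : measurable_fun setT
  (fun w : K.+1.-tuple R => \sum_(j < K) (nth 0 (theta K w) j - m j) ^+ 2).
Proof.
apply: measurable_sum => j; apply: measurable_funX; apply: measurable_funB.
  exact: measurable_theta.
exact: measurable_cst.
Qed.

Lemma ln_invgamma (a b s : R) : 0 < a -> 0 < b -> 0 < s ->
  ln (invgamma a b s) = a * ln b - ln (Gammaf a) - (a + 1) * ln s - b / s.
Proof.
move=> a0 b0 s0; rewrite /invgamma s0; have g0 := Gammaf_gt0 _ a0.
have p1 : 0 < b `^ a by exact: powR_gt0.
have p2 : 0 < b `^ a / Gammaf a by exact: divr_gt0.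
have p3 : 0 < s^-1 `^ (a + 1) by rewrite powR_gt0// invr_gt0.
rewrite (@lnM _ _ _ (mulr_gt0 p2 p3) (expR_gt0 _)) (@lnM _ _ _ p2 p3).
rewrite (@ln_div _ _ _ p1 g0) !ln_powR expRK (@lnV _ _ s0).
by ring.
Qed.

Lemma ln_le_subr1 (x : R) : 0 < x -> ln x <= x - 1.
Proof.
by move=> x0; have := @le_ln1Dx R (x - 1); rewrite [1 + _]addrC subrK; apply; lra.
Qed.

(* With shape [n] and scale [n s0] the posterior variational factor concentrates
   at [s0]; the Stirling-type bound on [Gamma(n)] makes its divergence from the
   prior only logarithmic in [n]. *)
Lemma ln_invgamma_ratio (n : nat) (al lam s0 s : R) : (0 < n)%N -> al <= n%:R ->
  0 < al -> 0 < lam -> 0 < s0 -> 0 < s ->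
  ln (invgamma n%:R (n%:R * s0) s) - ln (invgamma al lam s) <=
  ln n%:R + (al * ln s0 + al - al * ln lam + ln (Gammaf al)) + lam / s.
Proof.
move=> n0 aln al0 lam0 s00 sp; have nR : 0 < n%:R :> R by rewrite ltr0n.
rewrite !ln_invgamma ?mulr_gt0//; have := @ln_Gammaf_nat R n n0.
rewrite (@lnM _ _ _ nR s00).
(* Weighted by [n - al], this gives [(n - al) (s0 / s - 1)]: its [n s0 / s] cancels the exponent of
   the density of scale [n s0], and its [- n] cancels the linear term of Stirling's bound, so that
   [ln n] is the only growing term. *)
have h : ln s0 - ln s <= s0 / s - 1.
  by rewrite -ln_div ?posrE//; apply: ln_le_subr1; rewrite divr_gt0.
have h2 : (n%:R - al) * (ln s0 - ln s) <= (n%:R - al) * (s0 / s - 1).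
  by rewrite ler_wpM2l// subr_ge0.
have h3 : 0 <= al * (s0 / s) by rewrite mulr_ge0 ?divr_ge0 ?ltW.
have -> : n%:R * s0 / s = n%:R * (s0 / s) by rewrite mulrA.
move: (s0 / s) (lam / s) h h2 h3 aln nR => u t h h2 h3 aln nR.
move: (ln s0) (ln s) (ln lam) (ln n%:R) (ln (Gammaf n%:R)) (ln (Gammaf al)) h h2 h3 aln nR.
move: (n%:R) => N l0 ls ll ln lG lGa h h2 h3 aln NR hG.
have {}h2 : N * l0 - N * ls - al * l0 + al * ls <= N * u - N - al * u + al.
  by move: h2; rewrite !(mulrBl, mulrBr); lra.
lra.
Qed.

Lemma ln_gauss_ratio (m v z t : R) : 0 < v -> 0 < z ->
  ln (gauss m v t) - ln (gauss 0 z t) <= (ln z - ln v) / 2 + ((t - m) ^+ 2 + m ^+ 2) / z.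
Proof.
move=> v0 z0; have p0 : 0 < 2 * pi :> R by rewrite mulr_gt0// pi_gt0.
rewrite !ln_gauss// !(@lnM _ (2 * pi)) ?posrE//.
have h1 : 0 <= (t - m) ^+ 2 / (2 * v) by rewrite divr_ge0 ?sqr_ge0// mulr_ge0// ltW.
have h2 : (t - 0) ^+ 2 / (2 * z) <= ((t - m) ^+ 2 + m ^+ 2) / z.
  have -> : (t - 0) ^+ 2 / (2 * z) = (t ^+ 2 / 2) / z by field; rewrite gt_eqF.
  by rewrite ler_pM2r ?invr_gt0//; have := sqr_ge0 (t - 2 * m); nra.
by lra.
Qed.

Lemma ln_prod n (f : 'I_n -> R) : (forall i, 0 < f i) ->
  ln (\prod_(i < n) f i) = \sum_(i < n) ln (f i).
Proof.
elim: n f => [|n IH] f f0; first by rewrite !big_ord0 ln1.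
rewrite !big_ord_recr/= lnM ?posrE ?IH//.
by apply: prodr_gt0 => i _; exact: f0.
Qed.

Lemma ln_ignorm (a b : R) (m v : nat -> R) K (w : K.+1.-tuple R) : 0 < a -> 0 < b ->
  (forall i, 0 < v i) -> 0 < sig2 K w ->
  ln (ignorm a b m v K w) = ln (invgamma a b (sig2 K w)) +
    \sum_(i < K) ln (gauss (m i) (v i) (nth 0 (theta K w) i)).
Proof.
move=> a0 b0 v0 s0; rewrite /ignorm.
have g0 (i : 'I_K) : 0 < gauss (m i) (v i) (nth 0 (theta K w) i) by exact: gauss_gt0.
have p0 : 0 < \prod_(i < K) gauss (m i) (v i) (nth 0 (theta K w) i) by apply: prodr_gt0.
by rewrite (@lnM _ _ _ (invgamma_gt0 _ _ _ a0 b0 s0) p0) ln_prod.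
Qed.

Lemma sum_affine n (A B : nat -> R) (c b e e' g s : R) :
  \sum_(i < n) (c - A i / b + (e * A i + e' * B i + g) / s) =
  n%:R * c - (\sum_(i < n) A i) / b +
  (e * (\sum_(i < n) A i) + e' * (\sum_(i < n) B i) + n%:R * g) / s.
Proof.
elim: n => [|n IH]; first by rewrite !big_ord0; ring.
rewrite !big_ord_recr/= IH -natr1; move: (\sum_(i < n) A i) (\sum_(i < n) B i) => a d.
by ring.
Qed.

Section fixed_data.
Variables (p k n : nat) (f0 : p.-tuple R -> R) (s0 al lam zeta v rho : R).
Variables (th0 : seq R) (d : (n * p.+1).-tuple R).
Hypotheses (s00 : 0 < s0) (al0 : 0 < al) (lam0 : 0 < lam) (zeta0 : 0 < zeta).
Hypotheses (v0 : 0 < v) (rho0 : 0 < rho).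
Notation K := (Kpar p k).
Notation x i := (xdat p n d i).
Notation y i := (ydat p n d i).

Definition lik0 : R := \prod_(i < n) gauss (f0 (x i)) s0 (y i).
Definition noise_ss : R := \sum_(i < n) (y i - f0 (x i)) ^+ 2.
Definition bias_ss : R := \sum_(i < n) (f0 (x i) - fnet p k th0 (x i)) ^+ 2.
Definition lip_sqr : R := (2 + \sum_(i < K) nth 0 th0 i ^+ 2) ^+ 2 * K%:R.
(** The part of the log-ratio that depends on the parameter. The variance and the squared distance
    [D] enter only through [1/s], [s], [D] and [D/s], whose means under [q'] are explicit or easily
    bounded. *)
Definition Uterm (w : K.+1.-tuple R) : R :=
  let D := \sum_(j < K) (nth 0 (theta K w) j - nth 0 th0 j) ^+ 2 in
  (lam + (1 + rho) / 2 * noise_ss + (1 + rho^-1) * bias_ss) / sig2 K w +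
  n%:R / (2 * s0) * sig2 K w + (zeta ^+ 2)^-1 * D +
  (1 + rho^-1) * (n%:R * lip_sqr) * (D / sig2 K w).
(** The part independent of the parameter. Its [- noise_ss / (2 s0)] and [- n / 2] are there to
    cancel the leading terms of the mean of [Uterm]. *)
Definition cterm : R :=
  ln n%:R + (al * ln s0 + al - al * ln lam + ln (Gammaf al)) +
  (K%:R * ((ln (zeta ^+ 2) - ln v) / 2) + (\sum_(j < K) nth 0 th0 j ^+ 2) / zeta ^+ 2) -
  n%:R / 2 - ln lik0 - noise_ss / (2 * s0).

Lemma lik0_gt0 : 0 < lik0.
Proof. by apply: prodr_gt0 => i _; exact: gauss_gt0. Qed.

Lemma ln_lik w : 0 < sig2 K w ->
  ln (lik p k n d w) = \sum_(i < n) ln (gauss (fnet p k (theta K w) (x i)) (sig2 K w) (y i)).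
Proof. by move=> sp; rewrite /lik ln_prod// => i; exact: gauss_gt0. Qed.

(* [(y - f)^2 <= (1 + rho) (y - f0)^2 + (1 + 1/rho) (f0 - f)^2] *)
Lemma ln_gauss_data_ratio (f g y0 f1 s : R) : 0 < s ->
  ln (gauss g s0 y0) - ln (gauss f s y0) <=
  s / (2 * s0) - 2^-1 - (y0 - g) ^+ 2 / (2 * s0) +
  ((1 + rho) / 2 * (y0 - g) ^+ 2 + (1 + rho^-1) * (g - f1) ^+ 2 +
   (1 + rho^-1) * (f - f1) ^+ 2) / s.
Proof.
move=> sp; have p0 : 0 < 2 * pi :> R by rewrite mulr_gt0// pi_gt0.
rewrite !ln_gauss// !(@lnM _ (2 * pi)) ?posrE//.
have h1 : ln s - ln s0 <= s / s0 - 1.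
  by rewrite -ln_div ?posrE//; apply: ln_le_subr1; rewrite divr_gt0.
have -> : s / (2 * s0) = (s / s0) / 2 by field; rewrite gt_eqF.
have h2 : (y0 - f) ^+ 2 <= (1 + rho) * (y0 - g) ^+ 2 + (1 + rho^-1) * (g - f) ^+ 2.
  have := sqr_ge0 (rho * (y0 - g) - (g - f)) => h.
  have : 0 <= rho^-1 * (rho * (y0 - g) - (g - f)) ^+ 2 by rewrite mulr_ge0// invr_ge0 ltW.
  have -> : rho^-1 * (rho * (y0 - g) - (g - f)) ^+ 2 =
    rho * (y0 - g) ^+ 2 - 2 * (y0 - g) * (g - f) + rho^-1 * (g - f) ^+ 2.
    by field; rewrite gt_eqF.
  have -> : (y0 - f) ^+ 2 = (y0 - g) ^+ 2 + 2 * (y0 - g) * (g - f) + (g - f) ^+ 2 by ring.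
  move: ((y0 - g) ^+ 2) ((g - f) ^+ 2) (2 * _ * _) (rho^-1) => a b c e.
  rewrite !mulrDl !mul1r; move: (rho * a) (e * b) => u t; lra.
have h3 : (g - f) ^+ 2 <= 2 * (g - f1) ^+ 2 + 2 * (f - f1) ^+ 2.
  have := sqr_ge0 (g - f1 + (f - f1)).
  have -> : (g - f1 + (f - f1)) ^+ 2 = 2 * (g - f1) ^+ 2 + 2 * (f - f1) ^+ 2 - (g - f) ^+ 2 by ring.
  by lra.
have r1 : 0 <= 1 + rho^-1 by rewrite addr_ge0// invr_ge0 ltW.
have h4 : (1 + rho^-1) * (g - f) ^+ 2 <=
    2 * ((1 + rho^-1) * (g - f1) ^+ 2) + 2 * ((1 + rho^-1) * (f - f1) ^+ 2).
  apply: le_trans (ler_wpM2l r1 h3) _; rewrite le_eqVlt; apply/orP; left; apply/eqP; ring.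
have h5 : (y0 - f) ^+ 2 / (2 * s) <= ((1 + rho) / 2 * (y0 - g) ^+ 2 + (1 + rho^-1) * (g - f1) ^+ 2 +
   (1 + rho^-1) * (f - f1) ^+ 2) / s.
  have -> : (y0 - f) ^+ 2 / (2 * s) = ((y0 - f) ^+ 2 / 2) / s by field; rewrite gt_eqF.
  rewrite ler_pM2r ?invr_gt0//.
  have -> : (1 + rho) / 2 * (y0 - g) ^+ 2 = (1 + rho) * (y0 - g) ^+ 2 / 2 by ring.
  move: h2 h4; move: (_ * (g - f1) ^+ 2) (_ * (f - f1) ^+ 2) (_ * (y0 - g) ^+ 2).
  by move: (_ * (g - f) ^+ 2) ((y0 - f) ^+ 2) => *; lra.
move: h5; move: (_ / s) ((y0 - f) ^+ 2 / (2 * s)) ((y0 - g) ^+ 2 / (2 * s0)).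
move: (ln (2 * pi)) (ln s) (ln s0) (s / s0) h1 => *; lra.
Qed.

(** The term [ln lik0] is inserted so that each observation is compared with the truth separately.
    It remains in [cterm] and later cancels against the factor [lik0] of [evidence_bound]. *)
Lemma log_ratio_bound w : (0 < n)%N -> al <= n%:R -> 0 < sig2 K w ->
  (forall i, (i < n)%N -> in_cube (x i)) ->
  ln (ignorm n%:R (n%:R * s0) (nth 0 th0) (fun=> v) K w /
      (lik p k n d w * prior al lam zeta K w)) <= Uterm w + cterm.
Proof.
move=> n0 aln sp xc; have nR : 0 < n%:R :> R by rewrite ltr0n.
have z2 : 0 < zeta ^+ 2 by rewrite exprn_gt0.
have l0 : 0 < lik p k n d w by apply: prodr_gt0 => i _; exact: gauss_gt0.
have p0 : 0 < prior al lam zeta K w by rewrite priorE; exact: ignorm_gt0.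
have q0 : 0 < ignorm n%:R (n%:R * s0) (nth 0 th0) (fun=> v) K w.
  by apply: ignorm_gt0 => //; rewrite mulr_gt0.
rewrite (@ln_div _ _ _ q0 (mulr_gt0 l0 p0)) (@lnM _ _ _ l0 p0) priorE.
rewrite !ln_ignorm ?mulr_gt0// ln_lik//.
set s := sig2 K w in sp *.
have h1 := ln_invgamma_ratio n al lam s0 s n0 aln al0 lam0 s00 sp.
pose D := \sum_(j < K) (nth 0 (theta K w) j - nth 0 th0 j) ^+ 2.
pose M2 := \sum_(j < K) nth 0 th0 j ^+ 2.
have h2 : \sum_(i < K) ln (gauss (nth 0 th0 i) v (nth 0 (theta K w) i)) -
    \sum_(i < K) ln (gauss 0 (zeta ^+ 2) (nth 0 (theta K w) i)) <=
    K%:R * ((ln (zeta ^+ 2) - ln v) / 2) + (D + M2) / zeta ^+ 2.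
  rewrite -sumrB; apply: (@le_trans _ _ (\sum_(i < K) ((ln (zeta ^+ 2) - ln v) / 2 +
    ((nth 0 (theta K w) i - nth 0 th0 i) ^+ 2 + nth 0 th0 i ^+ 2) / zeta ^+ 2))).
    by apply: ler_sum => i _; exact: ln_gauss_ratio.
  by rewrite big_split/= sumr_const card_ord -mulr_suml big_split/= mulr_natl.
have D0 : 0 <= D by exact: sum_sqr_dist_ge0.
have h3 : ln lik0 - \sum_(i < n) ln (gauss (fnet p k (theta K w) (x i)) s (y i)) <=
    n%:R * (s / (2 * s0) - 2^-1) - noise_ss / (2 * s0) +
    ((1 + rho) / 2 * noise_ss + (1 + rho^-1) * bias_ss + (1 + rho^-1) * (n%:R * (lip_sqr * D))) / s.
  rewrite /lik0 ln_prod; last by move=> i; exact: gauss_gt0.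
  rewrite -sumrB.
  apply: (@le_trans _ _ (\sum_(i < n) ((s / (2 * s0) - 2^-1) - (y i - f0 (x i)) ^+ 2 / (2 * s0) +
   ((1 + rho) / 2 * (y i - f0 (x i)) ^+ 2 + (1 + rho^-1) * (f0 (x i) - fnet p k th0 (x i)) ^+ 2 +
   (1 + rho^-1) * (lip_sqr * D)) / s))).
    apply: ler_sum => i _.
    apply: (le_trans (ln_gauss_data_ratio (fnet p k (theta K w) (x i)) (f0 (x i)) (y i)
      (fnet p k th0 (x i)) s sp)).
    rewrite lerD2l ler_pM2r ?invr_gt0// lerD2l ler_wpM2l ?addr_ge0 ?invr_ge0 ?(ltW rho0)//.
    exact: fnet_sqr_lip (xc i (ltn_ord i)).
  rewrite (sum_affine n (fun i => (y i - f0 (x i)) ^+ 2)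
    (fun i => (f0 (x i) - fnet p k th0 (x i)) ^+ 2)).
  by rewrite le_eqVlt; apply/orP; left; apply/eqP; rewrite /noise_ss /bias_ss; ring.
rewrite /Uterm -/D /cterm -/M2.
have e1 : (1 + rho^-1) * (n%:R * lip_sqr) * (D / s) = (1 + rho^-1) * (n%:R * (lip_sqr * D)) / s by ring.
rewrite e1 -/s; move: h1 h2 h3; rewrite !mulrDl.
lra.
Qed.

End fixed_data.
End log_ratio.

Section ignorm_moments.
Context {R : realType}.

Definition sqdist (m : nat -> R) K (w : K.+1.-tuple R) : R :=
  \sum_(j < K) (nth 0 (theta K w) j - m j) ^+ 2.
Arguments sqdist m K w : clear implicits.

(** The inverse variance has mean [a / b], and the variance has mean [b / (a - 1)], whence [1 < a].
    The weights [1/s] and [s] only shift the shape and leave the normal factors alone, and each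
    squared coordinate costs at most [8 v] by doubling its variance. *)
Lemma iint_ignorm_U (a b c1 c2 c3 c4 v : R) (m : nat -> R) K : 1 < a -> 0 < b -> 0 < v ->
  0 <= c1 -> 0 <= c2 -> 0 <= c3 -> 0 <= c4 ->
  (iint K.+1 (fun w => (ignorm a b m (fun=> v) K w *
     (c1 / sig2 K w + c2 * sig2 K w + c3 * sqdist m K w + c4 * (sqdist m K w / sig2 K w)))%:E) <=
   (c1 * (a / b) + c2 * (b / (a - 1)) + (c3 + c4 * (a / b)) * (8 * v * K%:R))%:E)%E.
Proof.
move=> a1 b0 v0 c10 c20 c30 c40; pose D := sqdist m K.
have a0 : 0 < a by exact: lt_trans a1.
have a10 : 0 < a - 1 by rewrite subr_gt0.
have a1p : 0 < a + 1 by rewrite addr_gt0.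
have ab0 : 0 < a / b by rewrite divr_gt0.
pose X := ignorm (a + 1) b m (fun=> v) K.
pose Y := ignorm (a - 1) b m (fun=> v) K.
pose A j := ignorm a b m (dbl (fun=> v) j) K.
pose B j := ignorm (a + 1) b m (dbl (fun=> v) j) K.
have dv j i : 0 < dbl (fun=> v) j i by exact: dbl_gt0.
have E1 w : ignorm a b m (fun=> v) K w / sig2 K w = a / b * X w.
  by rewrite /ignorm mulrAC invgamma_divr// -!mulrA.
have E2 w : ignorm a b m (fun=> v) K w * sig2 K w = b / (a - 1) * Y w.
  rewrite /ignorm mulrAC -[in LHS](subrK 1 a) invgamma_mulr//.
  by rewrite -!mulrA.
have E3 w : ignorm a b m (fun=> v) K w * D w <= 8 * v * \sum_(j < K) A j w.
  rewrite /D /sqdist !mulr_sumr; apply: ler_sum => j _; rewrite mulrC.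
  exact: ignorm_sqr.
have E4 w : X w * D w <= 8 * v * \sum_(j < K) B j w.
  rewrite /D /sqdist !mulr_sumr; apply: ler_sum => j _; rewrite mulrC.
  exact: ignorm_sqr.
apply: (@le_trans _ _ (iint K.+1 (fun w => (c1 * (a / b))%:E * (X w)%:E + (c2 * (b / (a - 1)))%:E * (Y w)%:E +
   \sum_(j < K) ((c3 * (8 * v))%:E * (A j w)%:E + (c4 * (a / b) * (8 * v))%:E * (B j w)%:E))%E)).
  apply: le_iint => w.
    rewrite lee_fin; have [s0|s0] := ltP 0 (sig2 K w); last by rewrite ignorm_npos// mul0r.
    have D0 : 0 <= D w by exact: sum_sqr_dist_ge0.
    have s0' := ltW s0; apply: mulr_ge0; first exact: ignorm_ge0.
    by rewrite !addr_ge0// !mulr_ge0// invr_ge0.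
  under eq_bigr do rewrite -!EFinM -EFinD; rewrite sumEFin -!EFinM -!EFinD lee_fin.
  have -> : \sum_(j < K) (c3 * (8 * v) * A j w + c4 * (a / b) * (8 * v) * B j w) =
      c3 * (8 * v) * \sum_(j < K) A j w + c4 * (a / b) * (8 * v) * \sum_(j < K) B j w.
    by rewrite !mulr_sumr big_split.
  have -> : ignorm a b m (fun=> v) K w *
     (c1 / sig2 K w + c2 * sig2 K w + c3 * D w + c4 * (D w / sig2 K w)) =
     c1 * (ignorm a b m (fun=> v) K w / sig2 K w) + c2 * (ignorm a b m (fun=> v) K w * sig2 K w) +
     c3 * (ignorm a b m (fun=> v) K w * D w) + c4 * (ignorm a b m (fun=> v) K w / sig2 K w * D w).
    by ring.
  rewrite E1 E2; move: (E3 w) (E4 w).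
  move: (X w) (Y w) (D w) (ignorm _ _ _ _ _ _) (\sum_(j < K) A j w) (\sum_(j < K) B j w).
  move=> X1 Y1 D1 q SA SB h3 h4.
  have {}h3 : 0 <= c3 * (8 * v * SA - q * D1) by apply: mulr_ge0 => //; rewrite subr_ge0.
  have {}h4 : 0 <= c4 * (a / b) * (8 * v * SB - X1 * D1).
    by apply: mulr_ge0; [rewrite mulr_ge0// ltW|rewrite subr_ge0].
  rewrite -subr_ge0 (_ : _ - _ = c3 * (8 * v * SA - q * D1) + c4 * (a / b) * (8 * v * SB - X1 * D1)).
    exact: addr_ge0.
  by ring.
have mI a' m' v' : measurable_fun setT (fun w => (ignorm a' b m' v' K w)%:E).
  by apply/measurable_EFinP; exact: measurable_ignorm.
have gI a' m' v' : 0 < a' -> forall w, (0 <= (ignorm a' b m' v' K w)%:E)%E.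
  by move=> a'0 w; rewrite lee_fin ignorm_ge0.
have mZ c a' m' v' : measurable_fun setT (fun w => c%:E * (ignorm a' b m' v' K w)%:E)%E.
  by apply: emeasurable_funM; [exact: measurable_cst|exact: mI].
have gZ c a' m' v' : 0 <= c -> 0 < a' -> forall w, (0 <= c%:E * (ignorm a' b m' v' K w)%:E)%E.
  by move=> c0 a'0 w; rewrite mule_ge0// ?lee_fin// ignorm_ge0.
have k1 : 0 <= c1 * (a / b) by rewrite mulr_ge0// ltW.
have k2 : 0 <= c2 * (b / (a - 1)) by rewrite mulr_ge0// divr_ge0 ?ltW.
have k3 : 0 <= c3 * (8 * v) by rewrite !mulr_ge0// ltW.
have k4 : 0 <= c4 * (a / b) * (8 * v) by apply: mulr_ge0; apply: mulr_ge0 => //; exact: ltW.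
have gS w : (0 <= \sum_(j < K) ((c3 * (8 * v))%:E * (A j w)%:E + (c4 * (a / b) * (8 * v))%:E * (B j w)%:E))%E.
  by apply: sume_ge0 => j _; apply: adde_ge0; exact: gZ.
have mAB (j : 'I_K) : measurable_fun setT (fun w => ((c3 * (8 * v))%:E * (A j w)%:E + (c4 * (a / b) * (8 * v))%:E * (B j w)%:E)%E).
  exact: (emeasurable_funD (mZ _ _ _ _) (mZ _ _ _ _)).
rewrite (iintD _ (fun w => (c1 * (a / b))%:E * (X w)%:E + (c2 * (b / (a - 1)))%:E * (Y w)%:E)%E); first last.
- exact: gS.
- by move=> w; apply: adde_ge0; exact: gZ.
- by apply: emeasurable_sum => j; exact: mAB.
- exact: (emeasurable_funD (mZ _ _ _ _) (mZ _ _ _ _)).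
rewrite (iintD _ (fun w => (c1 * (a / b))%:E * (X w)%:E)%E (fun w => (c2 * (b / (a - 1)))%:E * (Y w)%:E)%E (mZ _ _ _ _) (mZ _ _ _ _) (gZ _ _ _ _ k1 a1p) (gZ _ _ _ _ k2 a10)).
rewrite !iintZl//; try exact: gI; try exact: mI.
rewrite !iint_ignorm// !mule1 iint_sum//; last first.
  by move=> j w; apply: adde_ge0; exact: gZ.
rewrite (eq_bigr (fun=> (c3 * (8 * v) + c4 * (a / b) * (8 * v))%:E)); last first.
  move=> j _; rewrite (iintD _ (fun w => (c3 * (8 * v))%:E * (A j w)%:E)%E (fun w => (c4 * (a / b) * (8 * v))%:E * (B j w)%:E)%E (mZ _ _ _ _) (mZ _ _ _ _) (gZ _ _ _ _ k3 a0) (gZ _ _ _ _ k4 a1p)).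
  rewrite !iintZl//; try exact: gI; try exact: mI.
  by rewrite !iint_ignorm// !mule1.
rewrite sumEFin sumr_const card_ord -!EFinD lee_fin -mulr_natr.
by rewrite le_eqVlt; apply/orP; left; apply/eqP; ring.
Qed.

End ignorm_moments.

(** * Expectations under the true law *)

Section data_expectation.
Context {R : realType} (p : nat).
Variables (f0 : p.-tuple R -> R) (s0 : R).
Hypotheses (mf0 : measurable_fun setT f0) (s00 : 0 < s0).

Lemma in_cubeE q (x : q.-tuple R) :
  (in_cube x)%:R = \prod_(i < q) ((0 <= nth 0 x i <= 1)%R%:R : R).
Proof.
rewrite /in_cube; case: (boolP (all _ _)) => [/all_tnthP h|].
  rewrite big1// => i _; have := h i; rewrite (tnth_nth 0) => ->; exact.
rewrite -has_predC => /hasP[y /tnthP[i ->]] /= /negbTE.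
by rewrite (tnth_nth 0) => e; rewrite (bigD1 i)//= e mul0r.
Qed.

Lemma measurable_unit : measurable_fun setT (fun u : R => ((0 <= u <= 1)%R%:R : R)).
Proof.
rewrite (_ : (fun u => _) = \1_(`[0%R, 1%R] : set R)).
  by apply: measurable_indic; exact: measurable_itv.
by apply/funext => u; rewrite indicE mem_setE in_itv.
Qed.

Lemma measurable_in_cube q : measurable_fun setT (fun x : q.-tuple R => (in_cube x)%:R : R).
Proof.
rewrite (_ : (fun x => _) = fun x : q.-tuple R => \prod_(i < q) ((0 <= nth 0 x i <= 1)%R%:R : R)).
  apply: measurable_prod => i _; apply: (measurableT_comp measurable_unit).
  exact: measurable_nth.
by apply/funext => x; exact: in_cubeE.
Qed.

Lemma iint_in_cube q : (iint q (fun x : q.-tuple R => ((in_cube x)%:R : R)%:E) = 1)%E.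
Proof.
under eq_iint do rewrite in_cubeE.
rewrite (iint_prod q (fun=> fun u => (0 <= u <= 1)%R%:R) (fun=> 1)) ?big1//.
- by move=> i; exact: measurable_unit.
- move=> i _; transitivity (\int[lebesgue_measure]_x (\1_(`[0%R, 1%R] : set R) x)%:E)%E.
    by apply: eq_integral => u _; rewrite indicE mem_setE in_itv.
  by rewrite integral_indic//= setIT lebesgue_measure_itv/= lte_fin ltr01 oppr0 adde0.
Qed.

Definition hd (z : p.+1.-tuple R) : R := thead z.
Definition tl (z : p.+1.-tuple R) : p.-tuple R := [tuple of behead z].

Lemma measurable_hd : measurable_fun setT hd. Proof. exact: (measurable_tnth ord0). Qed.
Lemma measurable_tl : measurable_fun setT tl. Proof. exact: measurable_behead. Qed.

Definition p0obs (z : p.+1.-tuple R) : R := (in_cube (tl z))%:R * gauss (f0 (tl z)) s0 (hd z).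

Lemma p0dataE n (d : (n * p.+1).-tuple R) : p0data p n f0 s0 d = \prod_(i < n) p0obs (obs p d i).
Proof. by apply: eq_bigr => i _; rewrite ydatE xdatE. Qed.

(** With the response integrated first, the normal density contributes one and an expectation over
    uniform covariates remains. *)
Lemma iint_obs (phi m : p.-tuple R -> R) (v : R) : measurable_fun setT phi ->
  measurable_fun setT m -> 0 < v -> (forall x : p.-tuple R, in_cube x -> 0 <= phi x) ->
  (iint p.+1 (fun z => ((in_cube (tl z))%:R * phi (tl z) * gauss (m (tl z)) v (hd z))%:E) =
  iint p (fun x => ((in_cube x)%:R * phi x)%:E))%E.
Proof.
move=> mphi mm v0 phi0.
have c0 (x : p.-tuple R) : 0 <= (in_cube x)%:R * phi x.
  by case: (boolP (in_cube x)) => [/phi0|]; rewrite ?mul1r ?mul0r.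
have mg : measurable_fun setT (fun z : p.+1.-tuple R => gauss (m (tl z)) v (hd z)).
  apply: measurable_gauss; [exact: (measurableT_comp mm measurable_tl)|exact: measurable_cst|exact: measurable_hd].
rewrite iint_consr; first last.
- by move=> z; rewrite lee_fin mulr_ge0 ?gauss_ge0.
- apply/measurable_EFinP; apply: measurable_funM; last exact: mg.
  apply: measurable_funM; first exact: (measurableT_comp (measurable_in_cube p) measurable_tl).
  exact: (measurableT_comp mphi measurable_tl).
apply: eq_iint => x.
have tlE y : tl [tuple of y :: x] = x by apply/val_inj.
have hdE y : hd [tuple of y :: x] = y by [].
under eq_integral do rewrite tlE hdE EFinM.
rewrite ge0_integralZl_EFin ?integral_gauss ?mule1//.
- by move=> y _; rewrite lee_fin gauss_ge0.
- apply/measurable_EFinP.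
  have := @measurable_gauss R _ _ (fun=> m x) (fun=> v) id (measurable_cst _) (measurable_cst _) (@measurable_id _ _ _).
  exact.
Qed.

Lemma measurable_p0obs : measurable_fun setT p0obs.
Proof.
apply: measurable_funM; first exact: (measurableT_comp (measurable_in_cube p) measurable_tl).
apply: measurable_gauss; [exact: (measurableT_comp mf0 measurable_tl)|exact: measurable_cst|exact: measurable_hd].
Qed.

Lemma p0obs_ge0 z : 0 <= p0obs z.
Proof. by rewrite mulr_ge0// gauss_ge0. Qed.

Lemma iint_p0obs : (iint p.+1 (fun z => (p0obs z)%:E) = 1)%E.
Proof.
transitivity (iint p.+1 (fun z : p.+1.-tuple R => ((in_cube (tl z))%:R * 1 * gauss (f0 (tl z)) s0 (hd z))%:E)).
  by apply: eq_iint => z; rewrite mulr1.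
rewrite (iint_obs (fun=> 1) f0 s0 (measurable_cst (1 : R)) mf0 s00 (fun _ _ => ler01)).
by under eq_iint do rewrite mulr1; exact: iint_in_cube.
Qed.

Lemma iint_1p0obs : (iint p.+1 (fun z => (1 * p0obs z)%:E) = 1%:E)%E.
Proof. by under eq_iint do rewrite mul1r; exact: iint_p0obs. Qed.

Variable n : nat.

Definition expect0 (h : (n * p.+1).-tuple R -> R) : \bar R :=
  iint (n * p.+1) (fun d => (h d * p0data p n f0 s0 d)%:E).

Lemma measurable_p0data : measurable_fun setT (p0data p n f0 s0).
Proof.
rewrite (_ : p0data p n f0 s0 = fun d => \prod_(i < n) p0obs (obs p d i)).
  apply: measurable_prod => i _.
  exact: (measurableT_comp measurable_p0obs (measurable_obs p n i)).
by apply/funext => d; exact: p0dataE.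
Qed.

Lemma p0data_ge0 d : 0 <= p0data p n f0 s0 d.
Proof. by rewrite p0dataE; apply: prodr_ge0 => i _; exact: p0obs_ge0. Qed.

Lemma expect0_prod (F : nat -> p.+1.-tuple R -> R) (c : nat -> R) :
  (forall i, measurable_fun setT (F i)) -> (forall i z, 0 <= F i z) ->
  (forall i, (i < n)%N -> iint p.+1 (fun z => (F i z * p0obs z)%:E) = (c i)%:E) ->
  expect0 (fun d => \prod_(i < n) F i (obs p d i)) = (\prod_(i < n) c i)%:E.
Proof.
move=> mF F0 Fc; rewrite /expect0 -(iint_blocks p n (fun i z => F i z * p0obs z) c)//.
- by apply: eq_iint => d; rewrite p0dataE -big_split.
- by move=> i; apply: measurable_funM => //; exact: measurable_p0obs.
- by move=> i z; rewrite mulr_ge0// p0obs_ge0.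
Qed.

Lemma expect0_1 : expect0 (fun=> 1) = 1%E.
Proof.
have := expect0_prod (fun=> fun=> 1) (fun=> 1) (fun=> measurable_cst (1 : R)) (fun _ _ => ler01)
  (fun _ _ => iint_1p0obs).
rewrite [in RHS]big1// => <-; rewrite /expect0; apply: eq_iint => d.
by rewrite big1.
Qed.

Lemma expect0D (h g : (n * p.+1).-tuple R -> R) : measurable_fun setT h -> measurable_fun setT g ->
  (forall d, 0 <= h d) -> (forall d, 0 <= g d) ->
  expect0 (fun d => h d + g d) = (expect0 h + expect0 g)%E.
Proof.
move=> mh mg h0 g0; rewrite /expect0 -iintD.
- by apply: eq_iint => d; rewrite mulrDl EFinD.
- by apply/measurable_EFinP/measurable_funM => //; exact: measurable_p0data.
- by apply/measurable_EFinP/measurable_funM => //; exact: measurable_p0data.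
- by move=> d; rewrite lee_fin mulr_ge0// p0data_ge0.
- by move=> d; rewrite lee_fin mulr_ge0// p0data_ge0.
Qed.

Lemma expect0Z (c : R) (h : (n * p.+1).-tuple R -> R) : measurable_fun setT h -> (forall d, 0 <= h d) -> 0 <= c ->
  expect0 (fun d => c * h d) = (c%:E * expect0 h)%E.
Proof.
move=> mh h0 c0; rewrite /expect0 -iintZl//.
- by apply: eq_iint => d; rewrite -mulrA EFinM.
- by apply/measurable_EFinP/measurable_funM => //; exact: measurable_p0data.
- by move=> d; rewrite lee_fin mulr_ge0// p0data_ge0.
Qed.

Lemma expect0_sum I (s : seq I) (h : I -> (n * p.+1).-tuple R -> R) :
  (forall i, measurable_fun setT (h i)) -> (forall i d, 0 <= h i d) ->
  expect0 (fun d => \sum_(i <- s) h i d) = (\sum_(i <- s) expect0 (h i))%E.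
Proof.
move=> mh h0; rewrite /expect0 -iint_sum.
- by apply: eq_iint => d; rewrite sumEFin mulr_suml.
- by move=> i; apply/measurable_EFinP/measurable_funM => //; exact: measurable_p0data.
- by move=> i d; rewrite lee_fin mulr_ge0// p0data_ge0.
Qed.

Lemma expect0_obs_sum (g : p.+1.-tuple R -> R) (c : R) :
  measurable_fun setT g -> (forall z, 0 <= g z) ->
  (iint p.+1 (fun z => (g z * p0obs z)%:E) <= c%:E)%E ->
  (expect0 (fun d => (\sum_(i < n) g (obs p d i))%R) <= (n%:R * c)%:E)%E.
Proof.
move=> mg g0 gc.
have gE : (iint p.+1 (fun z => (g z * p0obs z)%:E) = (fine (iint p.+1 (fun z => (g z * p0obs z)%:E)))%:E)%E.
  rewrite fineK// fin_numElt; apply/andP; split.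
    apply: (@lt_le_trans _ _ 0%E) => //; apply: iint_ge0 => z.
    by rewrite lee_fin mulr_ge0// p0obs_ge0.
  exact: le_lt_trans gc (ltry _).
move: gE gc; set e := fine _ => gE gc.
have {gc} ec : e <= c by rewrite -lee_fin -gE.
rewrite expect0_sum//; last first.
  by move=> i; exact: (measurableT_comp mg (measurable_obs p n i)).
rewrite (eq_bigr (fun=> e%:E)); last first.
  move=> i _.
  (* One summand is viewed as a product over all observations, equal to [g] at index [i] and to one
     elsewhere. *)
  have := expect0_prod (fun j z => if j == i :> nat then g z else 1) (fun j => if j == i :> nat then e else 1).
  rewrite [X in _ -> _ -> _ -> _ = X%:E](bigD1 i)//= eqxx big1 ?mulr1; last first.
    by move=> j /negbTE ji; rewrite val_eqE ji.
  move=> <-.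
  - rewrite /expect0; apply: eq_iint => d; rewrite (bigD1 i)//= eqxx big1 ?mulr1//.
    by move=> j /negbTE ji; rewrite val_eqE ji.
  - by move=> j; case: eqP => // _; exact: measurable_cst.
  - by move=> j z; case: ifP.
  - move=> j _; case: ifP => _; first exact: gE.
    exact: iint_1p0obs.
by rewrite sumEFin sumr_const card_ord lee_fin -(mulr_natl e) ler_wpM2l.
Qed.

End data_expectation.

(** * Expectations of likelihood ratios and of the sums of squares *)

Section likelihood_ratio.
Context {R : realType} (p k n : nat).
Variables (f0 : p.-tuple R -> R) (s0 : R).
Hypotheses (mf0 : measurable_fun setT f0) (s00 : 0 < s0).
Notation K := (Kpar p k).
Notation E0 := (expect0 p f0 s0 n).
Notation lik0 := (lik0 p n f0 s0).
Notation lik := (lik p k n).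
Notation dat := ((n * p.+1).-tuple R).
Notation par := (K.+1.-tuple R).

Let g0 (z : p.+1.-tuple R) := gauss (f0 (tl p z)) s0 (hd p z).
Let gw (w : par) (z : p.+1.-tuple R) := gauss (fnet p k (theta K w) (tl p z)) (sig2 K w) (hd p z).

Let g0_gt0 z : 0 < g0 z. Proof. exact: gauss_gt0. Qed.
Let gw_ge0 w z : 0 <= gw w z. Proof. exact: gauss_ge0. Qed.

Let mg0 : measurable_fun setT g0.
Proof.
apply: measurable_gauss; [exact: (measurableT_comp mf0 (measurable_tl p))|exact: measurable_cst|].
exact: measurable_hd.
Qed.

Lemma measurable_fnet_fix (th : seq R) : measurable_fun setT (fnet p k th).
Proof.
by apply: (@measurable_fnet R _ _ p k (fun=> th) id) => [i|]; exact: measurable_cst || exact: measurable_id.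
Qed.

Let mgw w : measurable_fun setT (gw w).
Proof.
apply: measurable_gauss; [|exact: measurable_cst|exact: measurable_hd].
exact: (measurableT_comp (measurable_fnet_fix _) (measurable_tl p)).
Qed.

Lemma iint_gw w : 0 < sig2 K w ->
  (iint p.+1 (fun z => ((in_cube (tl p z))%:R * gw w z)%:E) = 1)%E.
Proof.
move=> sp; rewrite -[RHS](iint_in_cube p).
have := @iint_obs R p (fun=> 1) (fnet p k (theta K w)) (sig2 K w) (measurable_cst (1 : R))
  (measurable_fnet_fix _) sp (fun _ _ => ler01).
under eq_iint do rewrite mulr1; move=> ->.
by apply: eq_iint => x; rewrite mulr1.
Qed.

Lemma likE d w : lik d w = \prod_(i < n) gw w (obs p d i).
Proof. by apply: eq_bigr => i _; rewrite ydatE xdatE. Qed.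

Lemma lik0E d : lik0 d = \prod_(i < n) g0 (obs p d i).
Proof. by apply: eq_bigr => i _; rewrite ydatE xdatE. Qed.

Lemma lik_ge0 (d : dat) w : 0 <= lik d w.
Proof. by rewrite likE; apply: prodr_ge0 => i _. Qed.

Lemma measurable_lik0 : measurable_fun setT (lik0 : dat -> R).
Proof.
rewrite (_ : lik0 = fun d => \prod_(i < n) g0 (obs p d i)); last by apply/funext => d; exact: lik0E.
by apply: measurable_prod => i _; exact: (measurableT_comp mg0 (measurable_obs p n i)).
Qed.

Lemma measurable_lik2 : measurable_fun setT (fun z : dat * par => lik z.1 z.2).
Proof.
rewrite (_ : (fun z => _) = fun z : dat * par => \prod_(i < n) gw z.2 (obs p z.1 i)); last first.
  by apply/funext => z; exact: likE.
have mo (i : 'I_n) : measurable_fun setT (fun z : dat * par => obs p z.1 i).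
  exact: (measurableT_comp (measurable_obs p n i) measurable_fst).
apply: measurable_prod => i _; apply: measurable_gauss.
- apply: measurable_fnet => [j|]; last exact: (measurableT_comp (measurable_tl p) (mo i)).
  exact: (measurableT_comp (measurable_theta K j) measurable_snd).
- exact: (measurableT_comp (measurable_sig2 K) measurable_snd).
- exact: (measurableT_comp (measurable_hd p) (mo i)).
Qed.

Lemma measurable_lik1 (d : dat) : measurable_fun setT (lik d).
Proof. exact: (measurableT_comp measurable_lik2 (pair1_measurable d)). Qed.

(** The true density is positive and cancels, which leaves for each observation the total mass of
    the model density over the cube and the line. *)
Lemma expect0_lik_ratio w : 0 < sig2 K w -> E0 (fun d => lik d w / lik0 d) = 1%E.
Proof.
move=> sp.
have mF : measurable_fun setT (fun z => gw w z / g0 z).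
  by apply: measurable_funM => //; exact: (measurableT_comp measurable_invr mg0).
have H : (iint p.+1 (fun z => (gw w z / g0 z * p0obs p f0 s0 z)%:E) = 1%:E)%E.
  rewrite -[RHS](iint_gw w sp); apply: eq_iint => z; congr EFin.
  by rewrite /p0obs -/(g0 z); field; rewrite gt_eqF.
have := expect0_prod p f0 s0 mf0 n (fun=> fun z => gw w z / g0 z) (fun=> 1) (fun=> mF)
  (fun _ z => divr_ge0 (gw_ge0 w z) (ltW (g0_gt0 z))) (fun _ _ => H).
rewrite [in RHS]big1// => <-; rewrite /expect0; apply: eq_iint => d.
by rewrite likE lik0E prodf_div.
Qed.

Lemma sqrtr_prod m (f : 'I_m -> R) : (forall i, 0 <= f i) ->
  Num.sqrt (\prod_(i < m) f i) = \prod_(i < m) Num.sqrt (f i).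
Proof.
elim: m f => [|m IH] f f0'; first by rewrite !big_ord0 sqrtr1.
by rewrite !big_ord_recr/= sqrtrM ?IH//; apply: prodr_ge0.
Qed.

Lemma sqr_sub_sqrtr (x y : R) : 0 <= x -> 0 <= y ->
  (Num.sqrt x - Num.sqrt y) ^+ 2 = x + y - 2 * Num.sqrt (x * y).
Proof. by move=> x0 y0; rewrite sqrtrM// sqrrB !sqr_sqrtr// mulr_natl; ring. Qed.

(* [d_H = 2 - 2 rho] with [rho] the Hellinger affinity of one observation, and the
   affinity of [n] observations is [rho ^ n <= exp (- n d_H / 2)]. *)
Lemma expect0_sqrt_lik_ratio w r : 0 < sig2 K w -> 0 < r -> ~~ (dH p k f0 s0 w < r%:E)%E ->
  (E0 (fun d => Num.sqrt (lik d w / lik0 d)) <= (expR (- (n%:R * (r / 2))))%:E)%E.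
Proof.
move=> sp r0 hr.
have msq (f : p.+1.-tuple R -> R) : measurable_fun setT f -> measurable_fun setT (fun z => Num.sqrt (f z)).
  by move=> mf; exact: (measurableT_comp measurable_sqrtr mf).
pose c (z : p.+1.-tuple R) : R := (in_cube (tl p z))%:R.
have mc : measurable_fun setT c by exact: (measurableT_comp (measurable_in_cube p) (measurable_tl p)).
have c0 z : 0 <= c z by [].
pose aff z := c z * Num.sqrt (gw w z * g0 z).
have maff : measurable_fun setT aff.
  by apply: measurable_funM => //; apply: msq; exact: measurable_funM.
have aff0 z : 0 <= aff z by rewrite mulr_ge0// sqrtr_ge0.
pose hd2 z := c z * (Num.sqrt (gw w z) - Num.sqrt (g0 z)) ^+ 2.
have mhd2 : measurable_fun setT hd2.
  by apply: measurable_funM => //; apply: measurable_funX; apply: measurable_funB; exact: msq.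
have hd20 z : 0 <= hd2 z by rewrite mulr_ge0// sqr_ge0.
have dHE : dH p k f0 s0 w = iint p.+1 (fun z => (hd2 z)%:E) by [].
have S : (iint p.+1 (fun z => (hd2 z)%:E) + iint p.+1 (fun z => (2%:E * (aff z)%:E)) = 2%:E)%E.
  rewrite -iintD; first last.
  - by move=> z; rewrite lee_fin mulr_ge0.
  - by move=> z; rewrite lee_fin.
  - by apply: emeasurable_funM; [exact: measurable_cst|exact/measurable_EFinP].
  - exact/measurable_EFinP.
  transitivity (iint p.+1 (fun z => ((c z * gw w z)%:E + (p0obs p f0 s0 z)%:E)%E)).
    apply: eq_iint => z; rewrite -EFinM -!EFinD; congr EFin.
    rewrite /hd2 /aff /p0obs -/(g0 z) -/(c z) (sqr_sub_sqrtr _ _ (gw_ge0 w z) (ltW (g0_gt0 z))).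
    by ring.
  rewrite iintD.
  - by rewrite (iint_gw w sp) (iint_p0obs p f0 s0 mf0 s00) -EFinD.
  - by apply/measurable_EFinP; exact: measurable_funM.
  - by apply/measurable_EFinP; exact: measurable_p0obs.
  - by move=> z; rewrite lee_fin mulr_ge0.
  - by move=> z; rewrite lee_fin p0obs_ge0.
have i2 : (iint p.+1 (fun z => (2%:E * (aff z)%:E)) = 2%:E * iint p.+1 (fun z => (aff z)%:E))%E.
  by rewrite iintZl//; exact/measurable_EFinP.
have a0 : (0 <= iint p.+1 (fun z => (aff z)%:E))%E by apply: iint_ge0 => z; rewrite lee_fin.
have h0 : (0 <= iint p.+1 (fun z => (hd2 z)%:E))%E by apply: iint_ge0 => z; rewrite lee_fin.
rewrite -leNgt dHE in hr; rewrite i2 in S.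
have [rho [rhoE rho0 rhor]] : exists rho : R, [/\ (iint p.+1 (fun z => (aff z)%:E) = rho%:E)%E,
    0 <= rho & rho <= 1 - r / 2].
  move: S a0 h0 hr; case: (iint p.+1 (fun z => (aff z)%:E)) => [x| |]//; last first.
    by case: (iint _ _) => [y| |]//; rewrite mulry gtr0_sg// mul1e.
  case: (iint p.+1 (fun z => (hd2 z)%:E)) => [y| |]//.
  rewrite -EFinM -EFinD => -[S]; rewrite !lee_fin => x0 y0 ry.
  by exists x; split => //; lra.
have H : (iint p.+1 (fun z => (Num.sqrt (gw w z / g0 z) * p0obs p f0 s0 z)%:E) = rho%:E)%E.
  rewrite -rhoE; apply: eq_iint => z; congr EFin.
  rewrite /p0obs -/(g0 z) /aff -/(c z) mulrCA; congr (_ * _).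
  have -> : gw w z * g0 z = gw w z / g0 z * (g0 z) ^+ 2 by field; rewrite gt_eqF.
  have gr : 0 <= gw w z / g0 z by rewrite divr_ge0// ltW.
  by rewrite (sqrtrM _ gr) sqrtr_sqr gtr0_norm.
have mF : measurable_fun setT (fun z => Num.sqrt (gw w z / g0 z)).
  by apply: msq; apply: measurable_funM => //; exact: (measurableT_comp measurable_invr mg0).
have := expect0_prod p f0 s0 mf0 n (fun=> fun z => Num.sqrt (gw w z / g0 z)) (fun=> rho) (fun=> mF)
  (fun _ z => sqrtr_ge0 _) (fun _ _ => H).
rewrite prodr_const card_ord => e.
have -> : E0 (fun d => Num.sqrt (lik d w / lik0 d)) =
    E0 (fun d => \prod_(i < n) Num.sqrt (gw w (obs p d i) / g0 (obs p d i))).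
  rewrite /expect0; apply: eq_iint => d; rewrite -sqrtr_prod; last first.
    by move=> i; rewrite divr_ge0// ltW.
  by rewrite likE lik0E prodf_div.
rewrite e lee_fin -mulrN mulrC expRM_natr.
apply: lerXn2r; rewrite ?nnegrE ?expR_ge0//.
by apply: le_trans rhor _; exact: expR_ge1Dx.
Qed.

(** The variance-doubling inequality costs a factor 8 over the exact mean; only the order [n]
    matters. *)
Lemma expect0_noise_ss : (E0 (noise_ss p n f0) <= (n%:R * (8 * s0))%:E)%E.
Proof.
have -> : E0 (noise_ss p n f0) = E0 (fun d => \sum_(i < n) (hd p (obs p d i) - f0 (tl p (obs p d i))) ^+ 2).
  by rewrite /expect0; apply: eq_iint => d; rewrite /noise_ss; under eq_bigr do rewrite ydatE xdatE.
apply: (expect0_obs_sum p f0 s0 mf0 s00 n (fun z => (hd p z - f0 (tl p z)) ^+ 2)).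
- apply: measurable_funX; apply: measurable_funB; first exact: measurable_hd.
  exact: (measurableT_comp mf0 (measurable_tl p)).
- by move=> z; exact: sqr_ge0.
have c8 : 0 <= 8 * s0 by rewrite mulr_ge0// ltW.
apply: (@le_trans _ _ (iint p.+1 (fun z => (8 * s0)%:E * ((in_cube (tl p z))%:R * 1 * gauss (f0 (tl p z)) (2 * s0) (hd p z))%:E))%E).
  apply: le_iint => z; first by rewrite lee_fin mulr_ge0 ?sqr_ge0// p0obs_ge0.
  rewrite -EFinM lee_fin mulr1 /p0obs mulrCA [leRHS]mulrCA ler_wpM2l//.
  exact: gauss_sq_le.
rewrite iintZl//; last 2 first.
- apply/measurable_EFinP; apply: measurable_funM.
    apply: measurable_funM; last exact: measurable_cst.
    exact: (measurableT_comp (measurable_in_cube p) (measurable_tl p)).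
  by apply: measurable_gauss; [exact: (measurableT_comp mf0 (measurable_tl p))|exact: measurable_cst|exact: measurable_hd].
- by move=> z; rewrite lee_fin mulr_ge0// ?gauss_ge0// mulr1.
rewrite (@iint_obs R p (fun=> 1) f0 (2 * s0) (measurable_cst (1 : R)) mf0 _ (fun _ _ => ler01)) ?mulr_gt0//.
by under eq_iint do rewrite mulr1; rewrite iint_in_cube mule1.
Qed.

Lemma iint_p0obs_x (phi : p.-tuple R -> R) : measurable_fun setT phi -> (forall x, 0 <= phi x) ->
  (iint p.+1 (fun z => (phi (tl p z) * p0obs p f0 s0 z)%:E) =
   iint p (fun x => ((in_cube x)%:R * phi x)%:E))%E.
Proof.
move=> mphi phi0; rewrite -(iint_obs p phi f0 s0 mphi mf0 s00)//.
by apply: eq_iint => z; rewrite /p0obs mulrCA mulrA.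
Qed.

Lemma expect0_bias_ss th0 e : (iint p (fun x => ((in_cube x)%:R * (f0 x - fnet p k th0 x) ^+ 2)%:E) <= e%:E)%E ->
  (E0 (bias_ss p k n f0 th0) <= (n%:R * e)%:E)%E.
Proof.
move=> he.
have -> : E0 (bias_ss p k n f0 th0) = E0 (fun d => \sum_(i < n) (f0 (tl p (obs p d i)) - fnet p k th0 (tl p (obs p d i))) ^+ 2).
  by rewrite /expect0; apply: eq_iint => d; rewrite /bias_ss; under eq_bigr do rewrite xdatE.
have mphi : measurable_fun setT (fun x => (f0 x - fnet p k th0 x) ^+ 2).
  by apply: measurable_funX; apply: measurable_funB => //; exact: measurable_fnet_fix.
apply: (expect0_obs_sum p f0 s0 mf0 s00 n (fun z => (f0 (tl p z) - fnet p k th0 (tl p z)) ^+ 2)).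
- exact: (measurableT_comp mphi (measurable_tl p)).
- by move=> z; exact: sqr_ge0.
by rewrite (iint_p0obs_x (fun x => (f0 x - fnet p k th0 x) ^+ 2))// => x; exact: sqr_ge0.
Qed.

Lemma expect0_sum_f0_sqr F2 : (iint p (fun x => ((in_cube x)%:R * f0 x ^+ 2)%:E) <= F2%:E)%E ->
  (E0 (fun d => (\sum_(i < n) f0 (xdat p n d i) ^+ 2)%R) <= (n%:R * F2)%:E)%E.
Proof.
move=> he.
have -> : E0 (fun d => \sum_(i < n) f0 (xdat p n d i) ^+ 2) = E0 (fun d => \sum_(i < n) f0 (tl p (obs p d i)) ^+ 2).
  by rewrite /expect0; apply: eq_iint => d; under eq_bigr do rewrite xdatE.
have mphi : measurable_fun setT (fun x => f0 x ^+ 2) by exact: measurable_funX.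
apply: (expect0_obs_sum p f0 s0 mf0 s00 n (fun z => f0 (tl p z) ^+ 2)).
- exact: (measurableT_comp mphi (measurable_tl p)).
- by move=> z; exact: sqr_ge0.
by rewrite (iint_p0obs_x (fun x => f0 x ^+ 2))// => x; exact: sqr_ge0.
Qed.

Variables (al lam zeta : R).
Hypotheses (al0 : 0 < al) (lam0 : 0 < lam) (zeta0 : 0 < zeta).
Notation prior := (prior al lam zeta K).

Definition evidence (phi : par -> R) (d : dat) : \bar R :=
  iint K.+1 (fun w => (prior w * phi w * (lik d w / lik0 d))%:E).

Lemma prior_ge0 w : 0 <= prior w.
Proof. by rewrite priorE ignorm_ge0. Qed.

Lemma measurable_prior : measurable_fun setT prior.
Proof. exact: (measurable_ignorm al lam (fun=> 0) (fun=> zeta ^+ 2) K). Qed.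

Let ratio_ge0 (d : dat) w : 0 <= lik d w / lik0 d.
Proof. by rewrite divr_ge0 ?lik_ge0// ltW// lik0_gt0. Qed.

Lemma measurable_ratio2 : measurable_fun setT (fun z : dat * par => lik z.1 z.2 / lik0 z.1).
Proof.
apply: measurable_funM; first exact: measurable_lik2.
apply: (measurableT_comp measurable_invr).
exact: (measurableT_comp measurable_lik0 measurable_fst).
Qed.

Let Gint_ge0 (phi : par -> R) (d : dat) w : 0 <= phi w ->
  0 <= prior w * phi w * (lik d w / lik0 d).
Proof. by move=> phi0; rewrite mulr_ge0// mulr_ge0// prior_ge0. Qed.

Lemma evidence_ge0 (phi : par -> R) (d : dat) : (forall w, 0 <= phi w) -> (0 <= evidence phi d)%E.
Proof.
by move=> phi0; apply: iint_ge0 => w; rewrite lee_fin Gint_ge0.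
Qed.

Let mevidence2 (phi : par -> R) : measurable_fun setT phi -> measurable_fun setT
  (fun z : dat * par => prior z.2 * phi z.2 * (lik z.1 z.2 / lik0 z.1)).
Proof.
move=> mphi; apply: measurable_funM; last exact: measurable_ratio2.
apply: measurable_funM; first exact: (measurableT_comp measurable_prior measurable_snd).
exact: (measurableT_comp mphi measurable_snd).
Qed.

Lemma measurable_evidence (phi : par -> R) : measurable_fun setT phi -> (forall w, 0 <= phi w) ->
  measurable_fun setT (evidence phi).
Proof.
move=> mphi phi0.
apply: (@measurable_iint_param R _ dat K.+1 (fun d w => (prior w * phi w * (lik d w / lik0 d))%:E)).
  by apply/measurable_EFinP; exact: mevidence2.
by move=> d w; rewrite lee_fin Gint_ge0.
Qed.

(** By Tonelli the data are integrated first: at positive variance the likelihood ratio has mean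
    one, and at nonpositive variance the prior vanishes. *)
Lemma iint_evidence (phi : par -> R) : measurable_fun setT phi -> (forall w, 0 <= phi w) ->
  (iint (n * p.+1) (fun d => evidence phi d * (p0data p n f0 s0 d)%:E) =
   iint K.+1 (fun w => (prior w * phi w)%:E))%E.
Proof.
move=> mphi phi0.
have pd0 := p0data_ge0 p f0 s0 n.
have mpd := measurable_p0data p f0 s0 mf0 n.
have mfix d : measurable_fun setT (fun w => (prior w * phi w * (lik d w / lik0 d))%:E).
  apply/measurable_EFinP; exact: (measurableT_comp (mevidence2 _ mphi) (pair1_measurable d)).
transitivity (iint (n * p.+1) (fun d => iint K.+1 (fun w =>
    ((p0data p n f0 s0 d) * (prior w * phi w * (lik d w / lik0 d)))%:E))).
  apply: eq_iint => d; rewrite muleC /evidence -iintZl//.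
  - by move=> w; rewrite lee_fin Gint_ge0.
  - by rewrite lee_fin.
rewrite (iint_swap _ _ (fun d w => (p0data p n f0 s0 d * (prior w * phi w * (lik d w / lik0 d)))%:E)); last 2 first.
- apply/measurable_EFinP; apply: measurable_funM; last exact: mevidence2.
  exact: (measurableT_comp mpd measurable_fst).
- by move=> d w; rewrite lee_fin mulr_ge0// Gint_ge0.
apply: eq_iint => w.
have [sp|sp] := ltP 0 (sig2 K w); last first.
  have pw : prior w = 0 by rewrite priorE ignorm_npos.
  by rewrite pw mul0r; under eq_iint do rewrite mul0r mulr0; rewrite iint0.
have pp0 : 0 <= prior w * phi w by rewrite mulr_ge0 ?prior_ge0.
transitivity ((prior w * phi w)%:E * E0 (fun d => lik d w / lik0 d)%R)%E; last by rewrite expect0_lik_ratio// mule1.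
rewrite /expect0 -iintZl//.
- by apply: eq_iint => d; rewrite -EFinM; congr EFin; ring.
- apply/measurable_EFinP; apply: measurable_funM => //.
  exact: (measurableT_comp measurable_ratio2 (pair2_measurable w)).
- by move=> d; rewrite lee_fin mulr_ge0.
Qed.

End likelihood_ratio.

(** * Sieve and covering *)

Section sieve.
Context {R : realType}.

(** The variance is kept away from zero because the log-likelihood is not Lipschitz there; the two
    upper bounds make the number of cells finite. *)
Definition sieve (u U M : R) (K : nat) (w : K.+1.-tuple R) : bool :=
  [&& u <= sig2 K w, sig2 K w <= U & [forall i : 'I_K, `|nth 0 (theta K w) i| <= M]].
Arguments sieve u U M K w : clear implicits.

Lemma measurable_sieve u U M K : measurable_fun setT (fun w => (sieve u U M K w)%:R : R).
Proof.
rewrite (_ : (fun w => _) = fun w : K.+1.-tuple R => (u <= sig2 K w)%R%:R * (sig2 K w <= U)%R%:R *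
    \prod_(i < K) (`|nth 0 (theta K w) i| <= M)%R%:R :> R); last first.
  apply/funext => w; rewrite /sieve.
  case: (u <= _); rewrite ?mul0r//= ?mul1r; case: (_ <= U); rewrite ?mul0r//= ?mul1r.
  case: forallP => [h|]; first by rewrite big1// => i _; rewrite h.
  move=> /forallP; rewrite negb_forall => /existsP[i hi].
  by rewrite (bigD1 i)//= (negbTE hi) mul0r.
have mb (f : K.+1.-tuple R -> bool) : measurable_fun setT f -> measurable_fun setT (fun w => (f w)%:R : R).
  move=> mf; rewrite (_ : (fun w => _) = fun w => if f w then 1 else 0); last first.
    by apply/funext => w; case: (f w).
  by apply: measurable_fun_ifT => //; exact: measurable_cst.
apply: measurable_funM.
  apply: measurable_funM; apply: mb; apply: measurable_fun_ler; try exact: measurable_cst; exact: measurable_sig2.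
apply: measurable_prod => i _; apply: mb; apply: measurable_fun_ler; last exact: measurable_cst.
by apply: measurableT_comp => //; exact: measurable_theta.
Qed.

(** One Chernoff-type bound per way of leaving the sieve: an exponential moment of the inverse
    variance, the moment of order [al / 2] of the variance, and a Gaussian exponential moment of
    each of the [K] weights. *)
Lemma prior_tail (al lam zeta u U M : R) K : 0 < al -> 0 < lam -> 0 < zeta -> 0 < u -> 0 < U -> 0 <= M ->
  (iint K.+1 (fun w => (prior al lam zeta K w * (~~ sieve u U M K w)%:R)%:E) <=
   (expR (- (lam / 2 / u)) * 2 `^ al +
    (U `^ (al / 2))^-1 * (lam `^ (al / 2) * Gammaf (al / 2) / Gammaf al) +
    K%:R * (expR (- (M ^+ 2 / (4 * zeta ^+ 2))) * 2))%:E)%E.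
Proof.
move=> al0 lam0 zeta0 u0 U0 M0.
have al20 : 0 < al / 2 by rewrite divr_gt0.
have lam20 : 0 < lam / 2 by rewrite divr_gt0.
have z2 : 0 < zeta ^+ 2 by rewrite exprn_gt0.
pose X := ignorm al (lam / 2) (fun=> 0) (fun=> zeta ^+ 2) K.
pose Y := ignorm (al / 2) lam (fun=> 0) (fun=> zeta ^+ 2) K.
pose A j := ignorm al lam (fun=> 0) (dbl (fun=> zeta ^+ 2) j) K.
pose c1 := expR (- (lam / 2 / u)) * 2 `^ al.
pose c2 := (U `^ (al / 2))^-1 * (lam `^ (al / 2) * Gammaf (al / 2) / Gammaf al).
pose c3 := expR (- (M ^+ 2 / (4 * zeta ^+ 2))) * 2 : R.
have c10 : 0 <= c1 by rewrite mulr_ge0 ?expR_ge0 ?powR_ge0.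
have c20 : 0 <= c2.
  apply: mulr_ge0; first by rewrite invr_ge0 powR_ge0.
  by rewrite divr_ge0 ?mulr_ge0 ?powR_ge0// ltW// Gammaf_gt0.
have c30 : 0 <= c3 by rewrite mulr_ge0 ?expR_ge0.
have mI (a' b' : R) v' : measurable_fun setT (fun w => (ignorm a' b' (fun=> 0) v' K w)%:E).
  by apply/measurable_EFinP; exact: measurable_ignorm.
have gI (a' b' : R) v' : 0 < a' -> forall w, (0 <= (ignorm a' b' (fun=> 0) v' K w)%:E)%E.
  by move=> a'0 w; rewrite lee_fin ignorm_ge0.
have mZ (c a' b' : R) v' : measurable_fun setT (fun w => c%:E * (ignorm a' b' (fun=> 0) v' K w)%:E)%E.
  by apply: emeasurable_funM; [exact: measurable_cst|exact: mI].
have gZ (c a' b' : R) v' : 0 <= c -> 0 < a' -> forall w, (0 <= c%:E * (ignorm a' b' (fun=> 0) v' K w)%:E)%E.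
  by move=> c0 a'0 w; rewrite mule_ge0// ?lee_fin// ignorm_ge0.
apply: (@le_trans _ _ (iint K.+1 (fun w => c1%:E * (X w)%:E + c2%:E * (Y w)%:E + \sum_(j < K) c3%:E * (A j w)%:E)%E)).
  apply: le_iint => w; first by rewrite lee_fin mulr_ge0// priorE ignorm_ge0.
  under eq_bigr do rewrite -!EFinM; rewrite sumEFin -!EFinM -!EFinD lee_fin.
  have X0 : 0 <= c1 * X w by rewrite mulr_ge0// ignorm_ge0.
  have Y0 : 0 <= c2 * Y w by rewrite mulr_ge0// ignorm_ge0.
  have A0 (i : 'I_K) : 0 <= c3 * A i w by rewrite mulr_ge0// ignorm_ge0.
  have S0 : 0 <= \sum_(i < K) c3 * A i w by apply: sumr_ge0.
  case: (boolP (sieve u U M K w)) => hs; first by rewrite mulr0 !addr_ge0.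
  rewrite mulr1; have [sp|sp] := ltP 0 (sig2 K w); last by rewrite priorE ignorm_npos// !addr_ge0.
  have p0 : 0 <= prior al lam zeta K w by rewrite priorE ignorm_ge0.
  move: hs; rewrite /sieve !negb_and => /orP[|/orP[]].
  - rewrite -ltNge => su; rewrite -addrA; apply: (@le_trans _ _ (c1 * X w)); last by rewrite lerDl addr_ge0.
    have -> : c1 * X w = expR (- (lam / 2 / u)) * (expR (lam / 2 / sig2 K w) * prior al lam zeta K w).
      have e := invgamma_expR al lam (sig2 K w) al0 lam0.
      rewrite /c1 /X priorE /ignorm; set P := \prod_(i < K) _.
      transitivity (expR (- (lam / 2 / u)) * (2 `^ al * invgamma al (lam / 2) (sig2 K w)) * P); first by ring.
      by rewrite -e; ring.
    have h : lam / 2 / u <= lam / 2 / sig2 K w.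
      by apply: ler_wpM2l; [exact: ltW|rewrite lef_pV2 ?posrE// ltW].
    by rewrite mulrA -expRD ler_peMl// -[leLHS]expR0 ler_expR addrC subr_ge0.
  - rewrite -ltNge => Us; rewrite addrAC -addrA addrC -addrA.
    apply: (@le_trans _ _ (c2 * Y w)); last first.
      by rewrite addrCA lerDl addr_ge0.
    have -> : c2 * Y w = (U `^ (al / 2))^-1 * (sig2 K w `^ (al / 2) * prior al lam zeta K w).
      have e := invgamma_powR al lam (sig2 K w) al0 lam0.
      rewrite /c2 /Y priorE /ignorm; set P := \prod_(i < K) _.
      move: e; move: (lam `^ _ * _ / _) => C e.
      transitivity ((U `^ (al / 2))^-1 * (C * invgamma (al / 2) lam (sig2 K w)) * P); first by ring.
      by rewrite -e; ring.
    rewrite mulrA ler_peMl// mulrC ler_pdivlMr ?powR_gt0// mul1r.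
    by apply: ge0_ler_powR; rewrite ?nnegrE ?ltW.
  - rewrite negb_forall => /existsP[i]; rewrite -ltNge => hi.
    apply: (@le_trans _ _ (c3 * A i w)); last first.
      rewrite (bigD1 i)//= addrCA lerDl addr_ge0// ?addr_ge0//.
      by apply: sumr_ge0 => j _; exact: A0.
    have := @ignorm_expR R al lam (fun=> 0) (fun=> zeta ^+ 2) K w i al0 z2.
    rewrite subr0 -/(A i) -priorE => h.
    apply: (@le_trans _ _ (expR (- (M ^+ 2 / (4 * zeta ^+ 2))) * (2 * A i w))); last by rewrite mulrA.
    apply: le_trans (ler_wpM2l (expR_ge0 _) h).
    have hM : M ^+ 2 / (4 * zeta ^+ 2) <= nth 0 (theta K w) i ^+ 2 / (4 * zeta ^+ 2).
      rewrite ler_pM2r ?invr_gt0 ?mulr_gt0// -[leRHS]real_normK ?num_real//.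
      by apply: lerXn2r; rewrite ?nnegrE//; exact: ltW.
    by rewrite mulrA -expRD ler_peMl// -[leLHS]expR0 ler_expR addrC subr_ge0.
have gS w : (0 <= \sum_(j < K) c3%:E * (A j w)%:E)%E by apply: sume_ge0 => j _; exact: gZ.
have mS : measurable_fun setT (fun w => \sum_(j < K) c3%:E * (A j w)%:E)%E.
  by apply: emeasurable_sum => j; exact: mZ.
rewrite (iintD _ (fun w => c1%:E * (X w)%:E + c2%:E * (Y w)%:E)%E _ (emeasurable_funD (mZ _ _ _ _) (mZ _ _ _ _)) mS _ gS); last first.
  by move=> w; apply: adde_ge0; exact: gZ.
rewrite (iintD _ (fun w => c1%:E * (X w)%:E)%E (fun w => c2%:E * (Y w)%:E)%E (mZ _ _ _ _) (mZ _ _ _ _) (gZ _ _ _ _ c10 al0) (gZ _ _ _ _ c20 al20)).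
rewrite iint_sum//; [|by move=> j; exact: mZ|by move=> j w; exact: gZ].
rewrite (eq_bigr (fun=> c3%:E)); last first.
  move=> j _; rewrite iintZl//; [|exact: mI|exact: gI].
  by rewrite iint_ignorm ?mule1// => i _; exact: dbl_gt0.
have [l1 l2] : (0 <= c1%:E)%E /\ (0 <= c2%:E)%E by rewrite !lee_fin.
rewrite (iintZl _ _ _ (mI _ _ _) (gI _ _ _ al0) l1) (iintZl _ _ _ (mI _ _ _) (gI _ _ _ al20) l2).
rewrite !iint_ignorm// !mule1 sumEFin sumr_const card_ord -!EFinD lee_fin.
by rewrite -(mulr_natl c3).
Qed.

End sieve.

(** * Finite covering of the far part of the sieve *)

Section covering.
Context {R : realType} (p k n : nat).
Variables (f0 : p.-tuple R -> R) (s0 : R).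
Hypotheses (mf0 : measurable_fun setT f0) (s00 : 0 < s0).
Notation K := (Kpar p k).
Notation lik0 := (lik0 p n f0 s0).
Notation lik := (lik p k n).
Notation dat := ((n * p.+1).-tuple R).
Notation par := (K.+1.-tuple R).
Variables (u U M : R).
Hypotheses (u0 : 0 < u) (U0 : 0 < U) (M0 : 0 < M) (n0 : (0 < n)%N).

Definition fnet_sup : R := K%:R * M.
(* On a cell of side [1 / mesh_inv] the log-likelihood varies by at most [1] as soon as
   [\sum_i y_i ^+ 2 <= n ^+ 2]. *)
Definition mesh_inv : R := n%:R / (2 * u) + (n%:R ^+ 2 + n%:R * fnet_sup ^+ 2) / u ^+ 2 +
  (1 + M) * K%:R * (n%:R + n%:R ^+ 2 + n%:R * fnet_sup) / u.

(** Normalising factor, variance and mean are changed separately: the variance at the mean [f'],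
    then the mean at the variance [s]. The linear [|y|] is absorbed by [1 + y ^+ 2], since only the
    sum of squared responses will be controlled. *)
Lemma ln_gauss_lip (y f f' s s' h D F : R) : u <= s -> u <= s' -> `|s - s'| <= h ->
  `|f - f'| <= D -> `|f| <= F -> `|f'| <= F ->
  ln (gauss f s y) - ln (gauss f' s' y) <= h / (2 * u) + (y ^+ 2 + F ^+ 2) * (h / u ^+ 2) +
    D * (1 + y ^+ 2 + F) / u.
Proof.
move=> us us' hh ff fF f'F.
have sp : 0 < s by exact: lt_le_trans us.
have sp' : 0 < s' by exact: lt_le_trans us'.
have h0 : 0 <= h by exact: le_trans hh.
have D0 : 0 <= D by exact: le_trans ff.
have p0 : 0 < 2 * pi :> R by rewrite mulr_gt0// pi_gt0.
rewrite !ln_gauss// !(@lnM _ (2 * pi)) ?posrE//.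
have h1 : ln s' - ln s <= h / u.
  rewrite -ln_div ?posrE//; apply: le_trans (ln_le_subr1 _ (divr_gt0 sp' sp)) _.
  have -> : s' / s - 1 = (s' - s) / s by field; rewrite gt_eqF.
  apply: (@le_trans _ _ (h / s)).
    by rewrite ler_pM2r ?invr_gt0//; apply: le_trans hh; rewrite distrC ler_norm.
  by rewrite ler_wpM2l// lef_pV2.
have fb2 : (y - f') ^+ 2 <= 2 * (y ^+ 2 + F ^+ 2).
  have F2 : f' ^+ 2 <= F ^+ 2.
    by rewrite -[leLHS]real_normK ?num_real//; apply: lerXn2r; rewrite ?nnegrE// (le_trans _ f'F).
  have := sqr_ge0 (y + f'); have -> : (y + f') ^+ 2 = 2 * y ^+ 2 + 2 * f' ^+ 2 - (y - f') ^+ 2 by ring.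
  by lra.
have h2 : (y - f') ^+ 2 / (2 * s') - (y - f') ^+ 2 / (2 * s) <= (y ^+ 2 + F ^+ 2) * (h / u ^+ 2).
  have -> : (y - f') ^+ 2 / (2 * s') - (y - f') ^+ 2 / (2 * s) =
      (y - f') ^+ 2 / 2 * ((s - s') / (s * s')) by field; rewrite !gt_eqF.
  apply: (@le_trans _ _ ((y - f') ^+ 2 / 2 * (h / u ^+ 2))).
    rewrite ler_wpM2l ?divr_ge0 ?sqr_ge0//.
    apply: (@le_trans _ _ (h / (s * s'))).
      by rewrite ler_pM2r ?invr_gt0 ?mulr_gt0//; apply: le_trans hh; exact: ler_norm.
    rewrite ler_wpM2l// lef_pV2 ?posrE ?exprn_gt0 ?mulr_gt0// expr2.
    by apply: ler_pM => //; exact: ltW.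
  rewrite ler_wpM2r ?divr_ge0 ?sqr_ge0//.
  by move: ((y - f') ^+ 2) (y ^+ 2) (F ^+ 2) fb2 => *; lra.
have h3 : (y - f') ^+ 2 / (2 * s) - (y - f) ^+ 2 / (2 * s) <= D * (1 + y ^+ 2 + F) / u.
  have -> : (y - f') ^+ 2 / (2 * s) - (y - f) ^+ 2 / (2 * s) =
      (f - f') * (y - (f + f') / 2) / s by field; rewrite gt_eqF.
  have hb : `|(f - f') * (y - (f + f') / 2)| <= D * (1 + y ^+ 2 + F).
    rewrite normrM; apply: ler_pM => //.
    apply: (le_trans (ler_normB _ _)); apply: lerD.
      have := sqr_ge0 (`|y| - 1); rewrite sqrrB1 real_normK ?num_real// => hy.
      by have := normr_ge0 y; move: (`|y|) (y ^+ 2) hy => a b; lra.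
    rewrite normrM (@ger0_norm _ 2^-1)//; have := ler_normD f f'.
    by move: (`|f|) (`|f'|) (`|f + f'|) fF f'F => a b c; lra.
  apply: (@le_trans _ _ (D * (1 + y ^+ 2 + F) / s)).
    by rewrite ler_pM2r ?invr_gt0//; apply: le_trans hb; exact: ler_norm.
  rewrite ler_wpM2l ?lef_pV2// mulr_ge0// !addr_ge0 ?sqr_ge0//.
  exact: le_trans fF.
have -> : h / (2 * u) = h / u / 2 by field; rewrite gt_eqF.
move: h1 h2 h3; move: (_ / u) (_ * (h / _)) (h / u) => a b c.
move: (_ / (2 * s')) (_ / (2 * s)) (_ / (2 * s)) (ln s) (ln s') (ln (2 * pi)) => *; lra.
Qed.

Lemma sum_affine2 (A : nat -> R) (a F b D v : R) m :
  \sum_(i < m) (a + (A i + F ^+ 2) * b + D * (1 + A i + F) / v) =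
  m%:R * a + (\sum_(i < m) A i + m%:R * F ^+ 2) * b +
  D * (m%:R + \sum_(i < m) A i + m%:R * F) / v.
Proof.
elim: m => [|m IH]; first by rewrite !big_ord0; ring.
by rewrite !big_ord_recr/= IH -natr1; move: (\sum_(i < m) A i) => B; ring.
Qed.

Lemma mesh_inv_gt0 : 0 < mesh_inv.
Proof.
have nR : 0 < n%:R :> R by rewrite ltr0n.
have F0 : 0 <= fnet_sup by rewrite mulr_ge0// ltW.
rewrite /mesh_inv -addrA; apply: ltr_pwDl; first by rewrite divr_gt0// mulr_gt0.
apply: addr_ge0.
  by rewrite divr_ge0 ?sqr_ge0// addr_ge0 ?sqr_ge0// mulr_ge0 ?sqr_ge0.
rewrite divr_ge0 ?(ltW u0)// mulr_ge0//.
  by rewrite mulr_ge0// addr_ge0// ltW.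
by rewrite !addr_ge0 ?sqr_ge0// mulr_ge0.
Qed.

(** Summed over the observations, the bound of [ln_gauss_lip] is at most [mesh_inv] times the cell
    side, that is one. *)
Lemma lik_lip (d : dat) (w w' : par) : (forall i, (i < n)%N -> in_cube (xdat p n d i)) ->
  \sum_(i < n) ydat p n d i ^+ 2 <= n%:R ^+ 2 ->
  sieve u U M K w -> sieve u U M K w' ->
  `|sig2 K w - sig2 K w'| <= mesh_inv^-1 ->
  (forall i : 'I_K, `|nth 0 (theta K w) i - nth 0 (theta K w') i| <= mesh_inv^-1) ->
  lik d w <= expR 1 * lik d w'.
Proof.
move=> xc y2 /and3P[us sU /forallP thM] /and3P[us' sU' /forallP thM'] hs hth.
set h := mesh_inv^-1 in hs hth *; have h0 : 0 < h by rewrite invr_gt0 mesh_inv_gt0.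
have sp : 0 < sig2 K w by exact: lt_le_trans us.
have sp' : 0 < sig2 K w' by exact: lt_le_trans us'.
have l0 : 0 < lik d w by apply: prodr_gt0 => i _; exact: gauss_gt0.
have l0' : 0 < lik d w' by apply: prodr_gt0 => i _; exact: gauss_gt0.
have thMn i : (i < K)%N -> `|nth 0 (theta K w) i| <= M by move=> iK; exact: (thM (Ordinal iK)).
have thMn' i : (i < K)%N -> `|nth 0 (theta K w') i| <= M by move=> iK; exact: (thM' (Ordinal iK)).
pose D := (1 + M) * K%:R * h.
have key : ln (lik d w) - ln (lik d w') <= 1.
  rewrite !ln_lik// -sumrB.
  apply: (@le_trans _ _ (\sum_(i < n) (h / (2 * u) + (ydat p n d i ^+ 2 + fnet_sup ^+ 2) * (h / u ^+ 2) +
    D * (1 + ydat p n d i ^+ 2 + fnet_sup) / u))).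
    apply: ler_sum => i _; apply: ln_gauss_lip => //.
    - apply: (le_trans (fnet_lip p k _ _ _ M (xc i (ltn_ord i)) (ltW M0) thMn')).
      rewrite /D -mulrA ler_wpM2l ?addr_ge0 ?(ltW M0)//.
      rewrite mulr_natl -[X in _ *+ X](card_ord K) -sumr_const; apply: ler_sum => j _.
      exact: hth.
    - exact: (fnet_bound p k _ _ M (ltW M0) thMn).
    - exact: (fnet_bound p k _ _ M (ltW M0) thMn').
  have -> : \sum_(i < n) (h / (2 * u) + (ydat p n d i ^+ 2 + fnet_sup ^+ 2) * (h / u ^+ 2) +
      D * (1 + ydat p n d i ^+ 2 + fnet_sup) / u) =
      n%:R * (h / (2 * u)) + (\sum_(i < n) ydat p n d i ^+ 2 + n%:R * fnet_sup ^+ 2) * (h / u ^+ 2) +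
      D * (n%:R + \sum_(i < n) ydat p n d i ^+ 2 + n%:R * fnet_sup) / u.
    by rewrite (sum_affine2 (fun i => ydat p n d i ^+ 2)).
  apply: (@le_trans _ _ (h * mesh_inv)); last by rewrite /h mulVf// gt_eqF// mesh_inv_gt0.
  have -> : h * mesh_inv = n%:R * (h / (2 * u)) + (n%:R ^+ 2 + n%:R * fnet_sup ^+ 2) * (h / u ^+ 2) +
      D * (n%:R + n%:R ^+ 2 + n%:R * fnet_sup) / u by rewrite /mesh_inv /D; ring.
  apply: lerD; first apply: lerD => //.
    by rewrite ler_wpM2r ?divr_ge0 ?sqr_ge0 ?(ltW h0)// lerD2r.
  rewrite ler_wpM2r ?invr_ge0 ?(ltW u0)// ler_wpM2l; first by [].
    by rewrite /D !mulr_ge0// ?addr_ge0// ltW.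
  by rewrite lerD2r lerD2l.
rewrite -[lik d w]lnK ?posrE// -[lik d w']lnK ?posrE// -expRD ler_expR.
by rewrite -lerBlDr.
Qed.

Definition ncell1 : nat := Num.truncn (U * mesh_inv).
Definition ncell2 : nat := Num.truncn (2 * M * mesh_inv).

(** Adding [M] makes a coordinate of a sieve point nonnegative before truncation. The default value
    of [inord] does not interfere on the sieve, where all indices are in range. *)
Definition cell (w : par) : 'I_ncell1.+1 * {ffun 'I_K -> 'I_ncell2.+1} :=
  (inord (Num.truncn (sig2 K w * mesh_inv)),
   [ffun i : 'I_K => inord (Num.truncn ((nth 0 (theta K w) i + M) * mesh_inv))]).

Lemma truncn_dist (a b : R) : 0 <= a -> 0 <= b ->
  Num.truncn (a * mesh_inv) = Num.truncn (b * mesh_inv) -> `|a - b| <= mesh_inv^-1.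
Proof.
move=> a0 b0 e; have L0 := mesh_inv_gt0.
have /andP[a1 a2] := truncn_itv (mulr_ge0 a0 (ltW L0)).
have /andP[b1 b2] := truncn_itv (mulr_ge0 b0 (ltW L0)).
rewrite -e -natr1 in b1 b2; rewrite -natr1 in a2.
rewrite -[leRHS]mul1r ler_pdivlMr// -[X in _ * X](ger0_norm (ltW L0)) -normrM mulrBl ler_norml.
by move: ((Num.truncn (a * mesh_inv))%:R : R) (a * _) (b * _) a1 a2 b1 b2 => m x y *; apply/andP; split; lra.
Qed.

Lemma cell_close (w w' : par) : sieve u U M K w -> sieve u U M K w' -> cell w = cell w' ->
  `|sig2 K w - sig2 K w'| <= mesh_inv^-1 /\
  (forall i : 'I_K, `|nth 0 (theta K w) i - nth 0 (theta K w') i| <= mesh_inv^-1).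
Proof.
move=> /and3P[us sU /forallP thM] /and3P[us' sU' /forallP thM'] [e1 /ffunP e2].
have L0 := mesh_inv_gt0.
have le_tr (a b : R) : a <= b -> (Num.truncn (a * mesh_inv) <= Num.truncn (b * mesh_inv))%N.
  by move=> ab; apply: le_truncn; rewrite ler_wpM2r// ltW.
split.
  apply: truncn_dist; [exact: le_trans (ltW u0) us|exact: le_trans (ltW u0) us'|].
  by move: e1 => /(congr1 val) /=; rewrite !inordK// ltnS le_tr.
move=> i; have {}e2 := e2 i; rewrite !ffunE in e2.
have /andP[h1 h2] : (- M <= nth 0 (theta K w) i <= M) by rewrite -ler_norml.
have /andP[h1' h2'] : (- M <= nth 0 (theta K w') i <= M) by rewrite -ler_norml.
have -> : nth 0 (theta K w) i - nth 0 (theta K w') i =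
  (nth 0 (theta K w) i + M) - (nth 0 (theta K w') i + M) by ring.
apply: truncn_dist; [lra|lra|].
move: e2 => /(congr1 val) /=; rewrite !inordK//.
- by rewrite ltnS le_tr//; lra.
- by rewrite ltnS le_tr//; lra.
Qed.

(* [Wc] is the sum over the cells of the root likelihood ratio at a representative
   chosen in the far part of the cell, so it dominates every far point of the sieve. *)
Lemma sieve_cover (r : R) : 0 < r ->
  exists Wc : dat -> R, [/\ measurable_fun setT Wc, (forall d, 0 <= Wc d),
    (expect0 p f0 s0 n Wc <= ((ncell1.+1 * ncell2.+1 ^ K)%:R * expR (- (n%:R * (r / 2))))%:E)%E &
    forall d w, (forall i, (i < n)%N -> in_cube (xdat p n d i)) ->
      \sum_(i < n) ydat p n d i ^+ 2 <= n%:R ^+ 2 ->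
      sieve u U M K w -> ~~ (dH p k f0 s0 w < r%:E)%E ->
      lik d w / lik0 d <= expR 1 * Wc d ^+ 2].
Proof.
move=> r0.
pose A (w : par) : Prop := sieve u U M K w /\ ~~ (dH p k f0 s0 w < r%:E)%E.
pose J := ('I_ncell1.+1 * {ffun 'I_K -> 'I_ncell2.+1})%type.
(* [None] marks a cell without far points of the sieve; it contributes zero. Fixing the
   representatives independently of the data makes [Wc] a finite sum of measurable functions, unlike
   a supremum over the cell. *)
have ch : forall j : J, {o : option par | match o with
    | Some w => A w /\ cell w = j | None => ~ exists w, A w /\ cell w = j end}.
  move=> j; case: (pselect (exists w, A w /\ cell w = j)) => [/cid[w h]|h].
    by exists (Some w).
  by exists None.
pose rep j := projT1 (ch j).
pose t j (d : dat) : R := if rep j is Some w then Num.sqrt (lik d w / lik0 d) else 0.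
have t0 j d : 0 <= t j d by rewrite /t; case: (rep j) => // w; exact: sqrtr_ge0.
have mt j : measurable_fun setT (t j).
  rewrite /t; case: (rep j) => [w|]; last exact: measurable_cst.
  apply: (measurableT_comp measurable_sqrtr).
  exact: (measurableT_comp (measurable_ratio2 p k n f0 s0 mf0) (pair2_measurable w)).
exists (fun d => \sum_(j : J) t j d); split.
- by apply: measurable_sum => j; exact: mt.
- by move=> d; apply: sumr_ge0 => j _; exact: t0.
- rewrite expect0_sum//.
  apply: (@le_trans _ _ (\sum_(j : J) (expR (- (n%:R * (r / 2))))%:E)%E).
    apply: lee_sum => j _; rewrite /t; have := projT2 (ch j); rewrite -/(rep j).
    case: (rep j) => [w [[hs hd] _]|_]; last first.
      rewrite /expect0; under eq_iint do rewrite mul0r.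
      by rewrite iint0 lee_fin expR_ge0.
    apply: expect0_sqrt_lik_ratio => //.
    by move: hs => /and3P[us _ _]; exact: lt_le_trans us.
  have cJ : #|{: J}| = (ncell1.+1 * ncell2.+1 ^ K)%N by rewrite card_prod card_ffun !card_ord.
  by rewrite sumEFin -cJ lee_fin sumr_const [leRHS]mulr_natl.
move=> d w xc y2 hs hd.
have l0 : 0 < lik0 d by exact: lik0_gt0.
have : A w by split.
have := projT2 (ch (cell w)); rewrite -/(rep (cell w)).
case E : (rep (cell w)) => [w'|]; last by move=> h Aw; case: h; exists w.
move=> [[hs' hd'] ce] Aw; have [c1 c2] := cell_close w w' hs hs' (esym ce).
have h := lik_lip d w w' xc y2 hs hs' c1 c2.
have rr : 0 <= lik d w' / lik0 d by rewrite divr_ge0 ?lik_ge0// ltW.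
apply: (@le_trans _ _ (expR 1 * (lik d w' / lik0 d))).
  by rewrite mulrA ler_pM2r ?invr_gt0.
rewrite ler_wpM2l ?expR_ge0// -(sqr_sqrtr rr); apply: lerXn2r; rewrite ?nnegrE ?sqrtr_ge0//.
  by apply: sumr_ge0 => j _; exact: t0.
rewrite (bigD1 (cell w))//= {1}/t E lerDl; apply: sumr_ge0 => j _; exact: t0.
Qed.

End covering.

(** * The bound at a fixed sample size *)

Section fixed_sample_size.
Context {R : realType} (p k n : nat).
Variables (f0 : p.-tuple R -> R) (s0 al lam zeta : R).
Hypotheses (mf0 : measurable_fun setT f0) (s00 : 0 < s0).
Hypotheses (al0 : 0 < al) (lam0 : 0 < lam) (zeta0 : 0 < zeta).
Notation K := (Kpar p k).
Notation lik0 := (lik0 p n f0 s0).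
Notation lik := (lik p k n).
Notation dat := ((n * p.+1).-tuple R).
Notation par := (K.+1.-tuple R).
Notation prior := (prior al lam zeta K).
Notation evidence := (evidence p k n f0 s0 al lam zeta).
Notation p0d := (p0data p n f0 s0).

Lemma measurable_dH : measurable_fun setT (dH p k f0 s0).
Proof.
apply: (@measurable_iint_param R _ par p.+1 (fun w z =>
    ((in_cube (behead z))%:R *
     (Num.sqrt (gauss (fnet p k (theta _ w) [tuple of behead z]) (sig2 _ w) (thead z))
      - Num.sqrt (gauss (f0 [tuple of behead z]) s0 (thead z))) ^+ 2)%:E)); last first.
  by move=> w z; rewrite lee_fin mulr_ge0// sqr_ge0.
have mt : measurable_fun setT (fun z : par * p.+1.-tuple R => tl p z.2).
  exact: (measurableT_comp (measurable_tl p) measurable_snd).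
have mh : measurable_fun setT (fun z : par * p.+1.-tuple R => hd p z.2).
  exact: (measurableT_comp (measurable_hd p) measurable_snd).
apply/measurable_EFinP; apply: measurable_funM.
  exact: (measurableT_comp (measurable_in_cube p) mt).
apply: measurable_funX; apply: measurable_funB; apply: (measurableT_comp measurable_sqrtr).
  apply: measurable_gauss => //.
    apply: measurable_fnet => [i|//].
    exact: (measurableT_comp (measurable_theta K i) measurable_fst).
  exact: (measurableT_comp (measurable_sig2 K) measurable_fst).
by apply: measurable_gauss; [exact: (measurableT_comp mf0 mt)|exact: measurable_cst|exact: mh].
Qed.

Definition farset (r : R) (w : par) : bool := (0 < sig2 K w) && ~~ (dH p k f0 s0 w < r%:E)%E.

Lemma measurable_farset r : measurable_fun setT (fun w => (farset r w)%:R : R).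
Proof.
rewrite (_ : (fun w => _) = fun w => if (0 < sig2 K w) && (r%:E <= dH p k f0 s0 w)%E then 1 else 0); last first.
  by apply/funext => w; rewrite /farset -leNgt; case: ifP.
apply: measurable_fun_ifT; [|exact: measurable_cst|exact: measurable_cst].
apply: measurable_and.
  by apply: measurable_fun_ltr; [exact: measurable_cst|exact: measurable_sig2].
by apply: measurable_fun_lee; [exact: measurable_cst|exact: measurable_dH].
Qed.

Lemma iint_prior : (iint K.+1 (fun w => (prior w)%:E) = 1)%E.
Proof.
apply: (iint_ignorm al lam (fun=> 0) (fun=> zeta ^+ 2) K al0 lam0) => i _.
by rewrite exprn_gt0.
Qed.

(** Near parameters carry no exponential and give [g1]; far ones off the sieve give [g2]; at far
    ones in the sieve the factor [exp T] is compensated by the small likelihood ratio, which leaves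
    at most [e] times the prior, of mass one. *)
Lemma evidence_bound (T r u U M W g1 g2 : R) (d : dat) : 0 <= T -> 0 <= W ->
  (evidence (fun=> 1%R) d <= g1%:E)%E ->
  ((expR T)%:E * evidence (fun w => (~~ sieve u U M K w)%:R) d <= g2%:E)%E ->
  expR T * W <= 1 ->
  (forall w, sieve u U M K w -> ~~ (dH p k f0 s0 w < r%:E)%E -> lik d w / lik0 d <= expR 1 * W ^+ 2) ->
  (iint K.+1 (fun w => (lik d w * prior w * expR (T * (farset r w)%:R))%:E) <=
   (lik0 d * (g1 + g2 + expR 1))%:E)%E.
Proof.
move=> T0 W0 hg1 hg2 hW hcov.
have l0 : 0 < lik0 d by exact: lik0_gt0.
have pr0 w : 0 <= prior w by exact: prior_ge0.
have rat0 w : 0 <= lik d w / lik0 d by rewrite divr_ge0 ?lik_ge0// ltW.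
have S0 w : 0 <= (~~ sieve u U M K w)%:R :> R by [].
have mS : measurable_fun setT (fun w => (~~ sieve u U M K w)%:R : R).
  rewrite (_ : (fun w => _) = fun w => 1 - (sieve u U M K w)%:R); last first.
    by apply/funext => w; case: sieve; rewrite ?subrr ?subr0.
  by apply: measurable_funB; [exact: measurable_cst|exact: measurable_sieve].
have mG phi : measurable_fun setT phi -> measurable_fun setT (fun w => (prior w * phi w * (lik d w / lik0 d))%:E).
  move=> mphi; apply/measurable_EFinP; apply: measurable_funM.
    by apply: measurable_funM => //; exact: measurable_prior.
  apply: measurable_funM; last exact: measurable_cst.
  exact: measurable_lik1.
have G0 phi : (forall w, 0 <= phi w) -> forall w, (0 <= (prior w * phi w * (lik d w / lik0 d))%:E)%E.
  by move=> phi0 w; rewrite lee_fin mulr_ge0// mulr_ge0.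
(* The hypothesis forces [W <= 1] because [T >= 0], so the square in the covering bound costs
   nothing. *)
have W2 : expR T * W ^+ 2 <= 1.
  have W1 : W <= 1.
    apply: le_trans hW; rewrite ler_peMl// -expR0 ler_expR//.
  by rewrite expr2 mulrA; apply: mulr_ile1 => //; rewrite mulr_ge0// expR_ge0.
pose b1 w := (prior w * 1 * (lik d w / lik0 d))%:E.
pose b2 w := (prior w * (~~ sieve u U M K w)%:R * (lik d w / lik0 d))%:E.
have mb1 : measurable_fun setT b1 by apply: mG; exact: measurable_cst.
have mb2 : measurable_fun setT b2 by exact: mG.
have b10 w : (0 <= b1 w)%E by exact: (G0 (fun=> 1)).
have b20 w : (0 <= b2 w)%E by exact: (G0 (fun w => (~~ sieve u U M K w)%:R)).
have eT : (0 <= (expR T)%:E)%E by rewrite lee_fin expR_ge0.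
have e1 : (0 <= (expR 1 : R)%:E)%E by rewrite lee_fin expR_ge0.
have mb2' : measurable_fun setT (fun w => (expR T)%:E * b2 w)%E.
  by apply: emeasurable_funM => //; exact: measurable_cst.
have mp : measurable_fun setT (fun w => (prior w)%:E) by apply/measurable_EFinP; exact: measurable_prior.
have mp' : measurable_fun setT (fun w => (expR 1)%:E * (prior w)%:E)%E.
  by apply: emeasurable_funM => //; exact: measurable_cst.
apply: (@le_trans _ _ (iint K.+1 (fun w => (lik0 d)%:E * (b1 w + (expR T)%:E * b2 w + (expR 1)%:E * (prior w)%:E))%E)).
  apply: le_iint => w; first by rewrite lee_fin mulr_ge0 ?expR_ge0// mulr_ge0// lik_ge0.
  rewrite /b1 /b2; cbv beta; rewrite -!EFinM lee_fin.
  have -> : lik d w * prior w * expR (T * (farset r w)%:R) =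
      lik0 d * (prior w * (lik d w / lik0 d) * expR (T * (farset r w)%:R)) by field; rewrite gt_eqF.
  rewrite ler_wpM2l ?(ltW l0)// mulr1.
  have P0 : 0 <= prior w * (lik d w / lik0 d) by rewrite mulr_ge0.
  have E0 : 0 <= expR 1 * prior w by rewrite mulr_ge0 ?expR_ge0.
  have B0 : 0 <= expR T * (prior w * (~~ sieve u U M K w)%:R * (lik d w / lik0 d)).
    by rewrite mulr_ge0 ?expR_ge0// mulr_ge0// mulr_ge0.
  case: (boolP (farset r w)) => [/andP[sp hd]|_]; last first.
    by rewrite mulr0 expR0 mulr1 -addrA lerDl addr_ge0.
  rewrite mulr1; case: (boolP (sieve u U M K w)) => hs /=.
    have hc := hcov w hs hd; rewrite mulr0 mul0r mulr0 addr0.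
    apply: (@le_trans _ _ (expR 1 * prior w)); last by rewrite lerDr.
    apply: (@le_trans _ _ (prior w * (expR 1 * W ^+ 2) * expR T)).
      by rewrite ler_wpM2r ?expR_ge0// ler_wpM2l.
    rewrite (_ : _ * _ * _ = (expR 1 * prior w) * (expR T * W ^+ 2)); last by ring.
    by rewrite ler_piMr.
  rewrite mulr1 [expR T * _]mulrC addrAC lerDr addr_ge0//.
rewrite iintZl; first last.
- by rewrite lee_fin ltW.
- by move=> w; apply: adde_ge0; [apply: adde_ge0 => //; exact: mule_ge0|apply: mule_ge0 => //; rewrite lee_fin].
- by apply: emeasurable_funD => //; apply: emeasurable_funD.
rewrite EFinM lee_wpmul2l ?lee_fin ?(ltW l0)//.
rewrite (iintD _ (fun w => b1 w + (expR T)%:E * b2 w)%E); first last.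
- by move=> w; apply: mule_ge0 => //; rewrite lee_fin.
- by move=> w; apply: adde_ge0 => //; exact: mule_ge0.
- exact: mp'.
- exact: emeasurable_funD.
rewrite iintD//; last by move=> w; exact: mule_ge0.
rewrite iintZl// (iintZl _ _ _ mp)//.
by rewrite iint_prior mule1 !EFinD leeD2r// leeD.
Qed.

(* Bounds [KL(q', post) + ln E_post[exp(T 1_A)]] when the noise and bias sums
   of squares are [a1] and [a2], [q'] has standard deviation [sd], and [M2] is the
   squared norm of its centre. *)
Definition kl_rhs (rho a1 a2 sd M2 g : R) : R :=
  lam / s0 + rho * a1 / (2 * s0) + (1 + rho^-1) * a2 / s0 + 1 +
  ((zeta ^+ 2)^-1 + (1 + rho^-1) * (n%:R * ((2 + M2) ^+ 2 * K%:R)) / s0) * (8 * sd ^+ 2 * K%:R) +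
  (ln n%:R + (al * ln s0 + al - al * ln lam + ln (Gammaf al))) +
  K%:R * ((ln (zeta ^+ 2) - ln (sd ^+ 2)) / 2) + M2 / zeta ^+ 2 + ln g.

Lemma mass_bound (T r u U M W g1 g2 rho sd : R) (th0 : seq R) (vq : vparam R) (d : dat) :
  (1 < n)%N -> al <= n%:R -> size th0 = K -> 0 < rho -> 0 < sd ->
  (forall i, (i < n)%N -> in_cube (xdat p n d i)) ->
  is_vb_minimizer al lam zeta p k n d vq ->
  0 <= T -> 0 <= W ->
  (evidence (fun=> 1%R) d <= g1%:E)%E ->
  ((expR T)%:E * evidence (fun w => (~~ sieve u U M K w)%:R) d <= g2%:E)%E ->
  expR T * W <= 1 ->
  (forall w, sieve u U M K w -> ~~ (dH p k f0 s0 w < r%:E)%E -> lik d w / lik0 d <= expR 1 * W ^+ 2) ->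
  0 < g1 + g2 + expR 1 ->
  (T%:E * mass_Vc p k f0 s0 r vq <=
   (kl_rhs rho (noise_ss p n f0 d) (bias_ss p k n f0 th0 d) sd (\sum_(i < K) nth 0 th0 i ^+ 2) (g1 + g2 + expR 1))%:E)%E.
Proof.
move=> n1 aln sth rho0 sd0 xc [[a0 b0 sm ss hall] hmin] T0 W0 hg1 hg2 hW hcov g0.
have nR : 0 < n%:R :> R by rewrite ltr0n; exact: ltn_trans n1.
have nR1 : 1 < n%:R :> R by rewrite ltr1n.
have l0 : 0 < lik0 d by exact: lik0_gt0.
have vq0 i : (i < K)%N -> 0 < nth 0 vq.2 i ^+ 2.
  by move=> iK; rewrite exprn_gt0//; move/all_nthP : hall; apply; rewrite ss.
have sd2 : 0 < sd ^+ 2 by rewrite exprn_gt0.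
pose v' : vparam R := (n%:R, n%:R * s0, th0, nseq K sd).
have Qv' : inQ K v'.
  by split; rewrite ?all_nseq ?sd0 ?orbT ?size_nseq// mulr_gt0.
pose q' := ignorm n%:R (n%:R * s0) (nth 0 th0) (fun=> sd ^+ 2) K.
have q'E : qdens K v' = q'.
  apply/funext => w; rewrite qdensE /q' /ignorm; congr (_ * _).
  by apply: eq_bigr => i _; rewrite nth_nseq ltn_ord.
have hKL := hmin v' Qv'; rewrite q'E in hKL.
pose c := cterm p k n f0 s0 al lam zeta (sd ^+ 2) th0 d.
pose U0 := Uterm p k n f0 s0 lam zeta rho th0 d.
pose c1 := lam + (1 + rho) / 2 * noise_ss p n f0 d + (1 + rho^-1) * bias_ss p k n f0 th0 d.
pose c4 := (1 + rho^-1) * (n%:R * lip_sqr p k th0).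
have r1 : 0 <= 1 + rho^-1 by rewrite addr_ge0// invr_ge0 ltW.
have noise_ss0 : 0 <= noise_ss p n f0 d by apply: sumr_ge0 => i _; exact: sqr_ge0.
have bias_ss0 : 0 <= bias_ss p k n f0 th0 d by apply: sumr_ge0 => i _; exact: sqr_ge0.
have c10 : 0 <= c1.
  apply: addr_ge0 (mulr_ge0 r1 bias_ss0); apply: addr_ge0 (ltW lam0) _.
  by apply: mulr_ge0 => //; apply: divr_ge0 => //; apply: addr_ge0 => //; exact: ltW.
have c40 : 0 <= c4 by rewrite mulr_ge0// mulr_ge0// mulr_ge0// sqr_ge0.
have c20 : 0 <= n%:R / (2 * s0) by rewrite divr_ge0// mulr_ge0// ltW.
have c30 : 0 <= (zeta ^+ 2)^-1 by rewrite invr_ge0 sqr_ge0.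
have D (w : par) : [/\ 0 < qdens K vq w, 0 < q' w, 0 < prior w & 0 < lik d w] \/
             [/\ qdens K vq w = 0, q' w = 0, prior w = 0 & 0 <= lik d w].
  have [sp|sp] := ltP 0 (sig2 K w); [left|right]; split.
  - by rewrite qdensE; exact: ignorm_gt0.
  - by apply: ignorm_gt0 => //; rewrite mulr_gt0.
  - by rewrite priorE; apply: ignorm_gt0 => // i _; rewrite exprn_gt0.
  - by apply: prodr_gt0 => i _; exact: gauss_gt0.
  - by rewrite qdensE ignorm_npos.
  - by rewrite /q' ignorm_npos.
  - by rewrite priorE ignorm_npos.
  - exact: lik_ge0.
have sig_gt0 (w : par) : 0 < q' w -> 0 < sig2 K w.
  by move=> h; rewrite ltNge; apply/negP => sp; move: h; rewrite /q' ignorm_npos// ltxx.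
have mD : measurable_fun setT (sqdist (nth 0 th0) K) by exact: measurable_sum_sqr.
have msi : measurable_fun setT (fun w : par => (sig2 K w)^-1).
  exact: (measurableT_comp measurable_invr (measurable_sig2 K)).
(* At nonpositive variance [Uterm] may be negative while [q'] vanishes; cutting it off there yields
   the nonnegative function that [vb_bound] asks for. *)
pose U1 w := if 0 < sig2 K w then U0 w else 0.
have U0E w : U0 w = c1 / sig2 K w + n%:R / (2 * s0) * sig2 K w + (zeta ^+ 2)^-1 * sqdist (nth 0 th0) K w +
   c4 * (sqdist (nth 0 th0) K w / sig2 K w) by [].
have U1ge0 w : 0 <= U1 w.
  rewrite /U1; case: ifP => // sp; rewrite U0E.
  have D0 : 0 <= sqdist (nth 0 th0) K w by exact: sum_sqr_dist_ge0.
  have S0 := ltW sp; have DS := divr_ge0 D0 S0.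
  exact: addr_ge0 (addr_ge0 (addr_ge0 (divr_ge0 c10 S0) (mulr_ge0 c20 S0)) (mulr_ge0 c30 D0)) (mulr_ge0 c40 DS).
have mU0 : measurable_fun setT U0.
  rewrite (_ : U0 = fun w => c1 / sig2 K w + n%:R / (2 * s0) * sig2 K w + (zeta ^+ 2)^-1 * sqdist (nth 0 th0) K w +
   c4 * (sqdist (nth 0 th0) K w / sig2 K w)); last by apply/funext => w; exact: U0E.
  apply: measurable_funD; last first.
    by apply: measurable_funM; [exact: measurable_cst|exact: measurable_funM].
  apply: measurable_funD; last by apply: measurable_funM; [exact: measurable_cst|].
  apply: measurable_funD; first by apply: measurable_funM; [exact: measurable_cst|].
  by apply: measurable_funM; [exact: measurable_cst|exact: measurable_sig2].
have mU1 : measurable_fun setT U1.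
  apply: measurable_fun_ifT => //.
  by apply: measurable_fun_ltr; [exact: measurable_cst|exact: measurable_sig2].
have hU w : 0 < q' w -> ln (q' w / (lik d w * prior w)) <= U1 w + c.
  by move=> qw; have sp := sig_gt0 w qw; rewrite /U1 sp; apply: log_ratio_bound => //; exact: ltn_trans n1.
have hB := @iint_ignorm_U R n%:R (n%:R * s0) c1 (n%:R / (2 * s0)) (zeta ^+ 2)^-1 c4 (sd ^+ 2) (nth 0 th0) K
  nR1 (mulr_gt0 nR s00) sd2 c10 c20 c30 c40.
have hB' := le_trans (_ : (iint K.+1 (fun w => (q' w * U1 w)%:E) <= _)%E) hB.
have hG := evidence_bound T r u U M W g1 g2 d T0 W0 hg1 hg2 hW hcov.
have mq : measurable_fun setT (qdens K vq) by exact: (measurable_ignorm vq.1.1.1 vq.1.1.2 (nth 0 vq.1.2) (fun i => nth 0 vq.2 i ^+ 2)).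
have mq' : measurable_fun setT q' by exact: measurable_ignorm.
have iq : (iint K.+1 (fun w => (qdens K vq w)%:E) = 1)%E.
  exact: (iint_ignorm vq.1.1.1 vq.1.1.2 (nth 0 vq.1.2) (fun i => nth 0 vq.2 i ^+ 2)).
have iq' : (iint K.+1 (fun w => (q' w)%:E) = 1)%E by apply: iint_ignorm => //; rewrite mulr_gt0.
apply: le_trans (vb_bound _ (qdens K vq) q' prior (lik d) U1 (farset r) T _ c _ mq mq'
  (measurable_prior _ _ _ _ _) (measurable_lik1 p k n d) mU1 (measurable_farset r) D iq iq' T0 U1ge0 hU (hB' _) hG hKL) _.
  apply: le_iint => w; first by rewrite lee_fin mulr_ge0// ignorm_ge0.
  rewrite lee_fin; have [sp|sp] := ltP 0 (sig2 K w); last by rewrite /q' ignorm_npos// !mul0r.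
  by rewrite ler_wpM2l ?ignorm_ge0// /U1 sp U0E.
rewrite lee_fin lnM ?posrE// /c /cterm /kl_rhs /c1 /c4 /lip_sqr.
set M2 := \sum_(i < K) nth 0 th0 i ^+ 2.
have e1 : n%:R / (n%:R * s0) = s0^-1 by field; rewrite !gt_eqF.
(* The mean of the variance under [q'] is [n s0 / (n - 1)], so the excess over the [n / 2] of
   [cterm] is [n / (2 (n - 1))], at most one for [n >= 2]. The rest of the comparison with [kl_rhs]
   is an identity in which [ln lik0] cancels. *)
have e2 : n%:R / (2 * s0) * (n%:R * s0 / (n%:R - 1)) - n%:R / 2 <= 1.
  have nm : 0 < n%:R - 1 :> R by rewrite subr_gt0.
  have -> : n%:R / (2 * s0) * (n%:R * s0 / (n%:R - 1)) - n%:R / 2 = n%:R / (2 * (n%:R - 1)) :> R.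
    by field; rewrite !gt_eqF.
  rewrite ler_pdivrMr ?mulr_gt0// mul1r.
  have : 2 <= n%:R :> R by rewrite ler_nat.
  by move: (n%:R : R) => N hN; lra.
rewrite e1; move: e2; set X := _ * (_ * s0 / _) => e2.
rewrite -subr_ge0; set lhs := (X in 0 <= X).
have -> : lhs = 1 - (X - n%:R / 2).
  by rewrite /lhs; field; rewrite !gt_eqF.
by rewrite subr_ge0.
Qed.

(* Markov's inequality for an event that need not be measurable. *)
Lemma p0data_markov (W : dat -> \bar R) (A : set dat) : measurable_fun setT W -> (forall d, (0 <= W d)%E) ->
  (forall d, (forall i, (i < n)%N -> in_cube (xdat p n d i)) -> (W d <= 1)%E -> A d) ->
  (1 <= P0n p n f0 s0 A + iint (n * p.+1) (fun d => W d * (p0d d)%:E))%E.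
Proof.
move=> mW W0 hA.
(* Pointwise [1 <= B + W], and [B] is measurable even when the indicator of [A], which dominates it
   on the cube, is not. *)
pose B d := (if (W d <= 1)%E then 1 else 0 : R).
have mB : measurable_fun setT B.
  apply: measurable_fun_ifT; [|exact: measurable_cst|exact: measurable_cst].
  by apply: measurable_fun_lee => //; exact: measurable_cst.
have B0 d : 0 <= B d by rewrite /B; case: ifP.
have pd0 := p0data_ge0 p f0 s0 n.
have mpd := measurable_p0data p f0 s0 mf0 n.
have mBp : measurable_fun setT (fun d => (B d * p0d d)%:E) by apply/measurable_EFinP; exact: measurable_funM.
have mWp : measurable_fun setT (fun d => W d * (p0d d)%:E)%E.
  by apply: emeasurable_funM => //; exact/measurable_EFinP.
apply: (@le_trans _ _ (iint (n * p.+1) (fun d => (B d * p0d d)%:E + W d * (p0d d)%:E)%E)).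
  rewrite -(expect0_1 p f0 s0 mf0 s00 n); apply: le_iint => d; first by rewrite mul1r lee_fin.
  rewrite mul1r /B; case: ifP => [_|/negbT].
    by rewrite mul1r leeDl// mule_ge0// lee_fin.
  by rewrite -ltNge mul0r add0e => /ltW h; rewrite -[leLHS]mul1e lee_wpmul2r// lee_fin.
rewrite iintD//; last 2 first.
- by move=> d; rewrite lee_fin mulr_ge0.
- by move=> d; apply: mule_ge0 => //; rewrite lee_fin.
rewrite leeD2r//; apply: le_iint => d; first by rewrite lee_fin mulr_ge0.
rewrite lee_fin /B; case: ifP => [h|_]; last by rewrite mul0r mulr_ge0// indicE.
have [xc|xc] := pselect (forall i, (i < n)%N -> in_cube (xdat p n d i)).
  by rewrite indicE mem_set//; exact: hA.
have -> : p0d d = 0; last by rewrite !mulr0.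
move: xc => /existsNP[i /not_implyP[hi /negP/negbTE xi]].
by rewrite /p0data (bigD1 (Ordinal hi))//= xi !mul0r.
Qed.

Lemma P0n_le1 (A : set dat) : (P0n p n f0 s0 A <= 1)%E.
Proof.
rewrite -(expect0_1 p f0 s0 mf0 s00 n); apply: le_iint => d.
  by rewrite lee_fin mulr_ge0 ?p0data_ge0// indicE.
by rewrite lee_fin ler_wpM2r ?p0data_ge0// indicE; case: (_ \in _).
Qed.

End fixed_sample_size.

(** * Probability of the event that the variational mass is small *)

Section vb_mass_event.
Context {R : realType} (p k n : nat).
Variables (f0 : p.-tuple R -> R) (s0 al lam zeta : R).
Hypotheses (mf0 : measurable_fun setT f0) (s00 : 0 < s0).
Hypotheses (al0 : 0 < al) (lam0 : 0 < lam) (zeta0 : 0 < zeta).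
Notation K := (Kpar p k).
Notation dat := ((n * p.+1).-tuple R).
Notation par := (K.+1.-tuple R).
Notation noise_ss := (noise_ss p n f0).
Notation bias_ss := (bias_ss p k n f0).
Notation E0 := (expect0 p f0 s0 n).
Notation evidence := (evidence p k n f0 s0 al lam zeta).
Notation p0d := (p0data p n f0 s0).

Let Sf (d : dat) := \sum_(i < n) f0 (xdat p n d i) ^+ 2.

Lemma measurable_xdat i : measurable_fun setT (fun d : dat => xdat p n d i).
Proof.
apply/measurable_fun_tnthP => h.
rewrite (_ : _ \o _ = fun d : dat => nth 0 d (i * p.+1 + h.+1)); first exact: measurable_nth.
by apply/funext => d /=; rewrite tnth_mktuple.
Qed.

Lemma measurable_noise_ss : measurable_fun setT noise_ss.
Proof.
apply: measurable_sum => i; apply: measurable_funX; apply: measurable_funB; first exact: measurable_nth.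
exact: (measurableT_comp mf0 (measurable_xdat i)).
Qed.

Lemma measurable_bias_ss th0 : measurable_fun setT (bias_ss th0).
Proof.
apply: measurable_sum => i; apply: measurable_funX; apply: measurable_funB.
  exact: (measurableT_comp mf0 (measurable_xdat i)).
exact: (measurableT_comp (measurable_fnet_fix p k th0) (measurable_xdat i)).
Qed.

Let mSf : measurable_fun setT Sf.
Proof.
apply: measurable_sum => i; apply: measurable_funX.
exact: (measurableT_comp mf0 (measurable_xdat i)).
Qed.

Lemma noise_ss_ge0 d : 0 <= noise_ss d. Proof. by apply: sumr_ge0 => i _; exact: sqr_ge0. Qed.
Lemma bias_ss_ge0 th0 d : 0 <= bias_ss th0 d. Proof. by apply: sumr_ge0 => i _; exact: sqr_ge0. Qed.
Let Sf_ge0 d : 0 <= Sf d. Proof. by apply: sumr_ge0 => i _; exact: sqr_ge0. Qed.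

Lemma sum_ydat_le (d : dat) : \sum_(i < n) ydat p n d i ^+ 2 <= 2 * noise_ss d + 2 * \sum_(i < n) f0 (xdat p n d i) ^+ 2.
Proof.
rewrite !mulr_sumr -big_split/=; apply: ler_sum => i _.
have := sqr_ge0 (ydat p n d i - 2 * f0 (xdat p n d i)).
by move: (ydat p n d i) (f0 _) => y f; rewrite !expr2 => h; nra.
Qed.

Lemma kl_rhs_mono rho a1 a1' a2 a2' sd M2 g : 0 < rho -> a1 <= a1' -> a2 <= a2' ->
  kl_rhs p k n s0 al lam zeta rho a1 a2 sd M2 g <= kl_rhs p k n s0 al lam zeta rho a1' a2' sd M2 g.
Proof.
move=> rho0 h1 h2; rewrite /kl_rhs.
have e1 : rho * a1 / (2 * s0) <= rho * a1' / (2 * s0).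
  by rewrite ler_wpM2r ?ler_wpM2l ?invr_ge0 ?mulr_ge0// ltW.
have e2 : (1 + rho^-1) * a2 / s0 <= (1 + rho^-1) * a2' / s0.
  by rewrite ler_wpM2r ?ler_wpM2l ?invr_ge0 ?addr_ge0 ?invr_ge0// ltW.
rewrite !lerD2r; apply: lerD => //.
by rewrite lerD2l.
Qed.

Definition tail_mass (u U M : R) : R :=
  expR (- (lam / 2 / u)) * 2 `^ al +
    (U `^ (al / 2))^-1 * (lam `^ (al / 2) * Gammaf (al / 2) / Gammaf al) +
    K%:R * (expR (- (M ^+ 2 / (4 * zeta ^+ 2))) * 2).

Lemma iint_lin3 m (A B C : m.-tuple R -> \bar R) (b c : \bar R) :
  measurable_fun setT A -> measurable_fun setT B -> measurable_fun setT C ->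
  (forall t, 0 <= A t)%E -> (forall t, 0 <= B t)%E -> (forall t, 0 <= C t)%E ->
  (0 <= b)%E -> (0 <= c)%E ->
  (iint m (fun t => A t + b * B t + c * C t) = iint m A + b * iint m B + c * iint m C)%E.
Proof.
move=> mA mB mC A0 B0 C0 b0 c0.
have mbB := measurable_funeM b mB; have mcC := measurable_funeM c mC.
rewrite (iintD _ (fun t => A t + b * B t)%E)//; first last.
- by move=> t; exact: mule_ge0.
- by move=> t; apply: adde_ge0 => //; exact: mule_ge0.
- exact: emeasurable_funD.
rewrite iintD//; last by move=> t; exact: mule_ge0.
by rewrite !iintZl.
Qed.

(** Every event required by [mass_bound] bounds a nonnegative statistic by a threshold. The
    statistics divided by their thresholds are added up to [W], so that [W <= 1] forces all the
    events at once and the expectation of [W] bounds the probability of failure. *)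
Lemma vb_mass_event (T r u U M rho sd a1 a2 e2 F2 eta : R) (th0 : seq R) (vq : dat -> vparam R) :
  (1 < n)%N -> al <= n%:R -> size th0 = K -> 0 < rho -> 0 < sd -> 0 < r ->
  0 < u -> 0 < U -> 0 < M -> 0 < T -> 0 < a1 -> 0 < a2 ->
  (forall d, is_vb_minimizer al lam zeta p k n d (vq d)) ->
  (iint p (fun x => ((in_cube x)%:R * (f0 x - fnet p k th0 x) ^+ 2)%:E) <= e2%:E)%E ->
  (iint p (fun x => ((in_cube x)%:R * f0 x ^+ 2)%:E) <= F2%:E)%E ->
  kl_rhs p k n s0 al lam zeta rho a1 a2 sd (\sum_(i < K) nth 0 th0 i ^+ 2) (n%:R + 1 + expR 1) <= T * eta ->
  (1 <= P0n p n f0 s0 [set d | mass_Vc p k f0 s0 r (vq d) <= eta%:E] +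
    ((a1^-1 + 2 / n%:R ^+ 2) * (n%:R * (8 * s0)) + a2^-1 * (n%:R * e2) + 2 / n%:R ^+ 2 * (n%:R * F2) +
     expR T * ((ncell1 p k n u U M).+1%:R * (ncell2 p k n u M).+1%:R ^+ K * expR (- (n%:R * (r / 2)))) +
     n%:R^-1 + expR T * tail_mass u U M)%:E)%E.
Proof.
move=> n1 aln sth rho0 sd0 r0 u0 U0 M0 T0 a10 a20 hvq he2 hF2 hB.
have n0 : (0 < n)%N by exact: ltn_trans n1.
have nR : 0 < n%:R :> R by rewrite ltr0n.
have [Wc [mWc Wc0 EWc hWc]] := sieve_cover p k n f0 s0 mf0 s00 u U M u0 M0 n0 r r0.
(* The part [a1^-1] enforces [noise_ss <= a1]. The extra [2 / n^2], with the same coefficient on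
   [Sf], enforces through [sum_ydat_le] the bound [n^2] on the squared responses that [lik_lip]
   requires. *)
pose c0 := a1^-1 + 2 / n%:R ^+ 2.
have c00 : 0 <= c0 by rewrite addr_ge0 ?invr_ge0 ?divr_ge0 ?sqr_ge0// ltW.
have c20 : 0 <= 2 / n%:R ^+ 2 :> R by rewrite divr_ge0 ?sqr_ge0.
have a2i : 0 <= a2^-1 by rewrite invr_ge0 ltW.
have eT0 := @expR_ge0 R T.
have ni : 0 <= n%:R^-1 :> R by rewrite invr_ge0.
pose h1 d := c0 * noise_ss d + a2^-1 * bias_ss th0 d + 2 / n%:R ^+ 2 * Sf d + expR T * Wc d.
pose ph2 (w : par) : R := (~~ sieve u U M K w)%:R.
pose ph1 (_ : par) : R := 1.
have ph10 w : 0 <= ph1 w by exact: ler01.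
have mph1 : measurable_fun setT ph1 by exact: measurable_cst.
have mph2 : measurable_fun setT ph2.
  rewrite (_ : ph2 = fun w => 1 - (sieve u U M K w)%:R); last first.
    by apply/funext => w; rewrite /ph2; case: sieve; rewrite ?subrr ?subr0.
  by apply: measurable_funB; [exact: measurable_cst|exact: measurable_sieve].
have ph20 w : 0 <= ph2 w by [].
pose W d := ((h1 d)%:E + (n%:R^-1)%:E * evidence ph1 d + (expR T)%:E * evidence ph2 d)%E.
have t1 d : 0 <= c0 * noise_ss d by rewrite mulr_ge0// noise_ss_ge0.
have t2 d : 0 <= a2^-1 * bias_ss th0 d by rewrite mulr_ge0// bias_ss_ge0.
have t3 d : 0 <= 2 / n%:R ^+ 2 * Sf d by rewrite mulr_ge0.
have t4 d : 0 <= expR T * Wc d by rewrite mulr_ge0.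
have mm (c : R) (h : dat -> R) : measurable_fun setT h -> measurable_fun setT (fun d => c * h d).
  by move=> mh; apply: measurable_funM => //; exact: measurable_cst.
have m1 := mm c0 _ measurable_noise_ss; have m2 := mm a2^-1 _ (measurable_bias_ss th0).
have m3 := mm (2 / n%:R ^+ 2) _ mSf; have m4 := mm (expR T) _ mWc.
have m12 : measurable_fun setT (fun d => c0 * noise_ss d + a2^-1 * bias_ss th0 d) by exact: measurable_funD.
have m123 : measurable_fun setT (fun d => c0 * noise_ss d + a2^-1 * bias_ss th0 d + 2 / n%:R ^+ 2 * Sf d).
  exact: measurable_funD.
have mh1 : measurable_fun setT h1 by exact: measurable_funD.
have h10 d : 0 <= h1 d by rewrite addr_ge0// addr_ge0// addr_ge0.
have mG1 : measurable_fun setT (evidence ph1).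
  exact: measurable_evidence.
have mG2 : measurable_fun setT (evidence ph2) by exact: measurable_evidence.
have G10 d : (0 <= evidence ph1 d)%E by exact: evidence_ge0.
have G20 d : (0 <= evidence ph2 d)%E by exact: evidence_ge0.
have s2 d : (0 <= (n%:R^-1)%:E * evidence ph1 d)%E by apply: mule_ge0 => //; rewrite lee_fin.
have s3 d : (0 <= (expR T)%:E * evidence ph2 d)%E by apply: mule_ge0 => //; rewrite lee_fin.
have ms2 : measurable_fun setT (fun d => (n%:R^-1)%:E * evidence ph1 d)%E.
  apply: measurable_funeM; exact mG1.
have ms3 : measurable_fun setT (fun d => (expR T)%:E * evidence ph2 d)%E.
  apply: measurable_funeM; exact mG2.
have mW : measurable_fun setT W.
  apply: emeasurable_funD ms3; apply: emeasurable_funD ms2; exact/measurable_EFinP.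
have W0 d : (0 <= W d)%E by apply: adde_ge0 => //; apply: adde_ge0 => //; rewrite lee_fin.
pose A : set dat := [set d | mass_Vc p k f0 s0 r (vq d) <= eta%:E]%E.
apply: le_trans (p0data_markov p n f0 s0 mf0 s00 W A mW W0 _) _.
- move=> d xc Wd.
  have hh : h1 d <= 1.
    rewrite -lee_fin; apply: le_trans Wd; rewrite /W -addeA leeDl//; exact: adde_ge0.
  have hg1 : (evidence ph1 d <= n%:R%:E)%E.
    have : ((n%:R^-1)%:E * evidence ph1 d <= 1)%E.
      apply: le_trans Wd; rewrite /W addeAC leeDr//; apply: adde_ge0 => //; by rewrite lee_fin.
    by rewrite -(@lee_pdivlMl _ n%:R^-1) ?invr_gt0// mule1 invrK.
  have hg2 : ((expR T)%:E * evidence ph2 d <= 1%:E)%E.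
    by apply: le_trans Wd; rewrite /W leeDr//; apply: adde_ge0 => //; rewrite lee_fin.
  have b4 : expR T * Wc d <= 1.
    by apply: le_trans hh; rewrite /h1 lerDr addr_ge0// addr_ge0.
  have b1 : c0 * noise_ss d + 2 / n%:R ^+ 2 * Sf d <= 1.
    move: hh (t2 d) (t4 d); rewrite /h1.
    by move: (c0 * noise_ss d) (a2^-1 * _) (2 / _ * Sf d) (expR T * _) => x y z t *; lra.
  have b2 : a2^-1 * bias_ss th0 d <= 1.
    by apply: le_trans hh; rewrite /h1 -!addrA addrCA lerDl addr_ge0// addr_ge0.
  have d0 := noise_ss_ge0 d.
  have n2 : 0 < n%:R ^+ 2 :> R by rewrite exprn_gt0.
  have hS0 : noise_ss d <= a1.
    have := t3 d; have : 0 <= 2 / n%:R ^+ 2 * noise_ss d by rewrite mulr_ge0.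
    move: b1; rewrite /c0 mulrDl; move: (2 / _ * noise_ss d) (2 / _ * Sf d) => x y h x0 y0.
    have : a1^-1 * noise_ss d <= 1 by lra.
    by rewrite ler_pdivrMl// mulr1.
  have hy : \sum_(i < n) ydat p n d i ^+ 2 <= n%:R ^+ 2.
    apply: le_trans (sum_ydat_le d) _.
    have : 0 <= a1^-1 * noise_ss d by rewrite mulr_ge0 ?invr_ge0// ltW.
    move: b1; rewrite /c0 mulrDl; move: (a1^-1 * noise_ss d) => x h x0.
    have : (n%:R ^+ 2)^-1 * (2 * noise_ss d + 2 * Sf d) <= 1.
      rewrite (_ : _ * _ = 2 / n%:R ^+ 2 * noise_ss d + 2 / n%:R ^+ 2 * Sf d); last by ring.
      by move: (2 / _ * noise_ss d) (2 / _ * Sf d) h => y z; lra.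
    by rewrite ler_pdivrMl// mulr1.
  have hS1 : bias_ss th0 d <= a2 by move: b2; rewrite ler_pdivrMl// mulr1.
  have g0 : 0 < n%:R + 1 + expR 1 :> R by rewrite addr_gt0 ?expR_gt0// addr_gt0.
  (* With the evidence at most [n] and its off-sieve part, times [exp T], at most one, the argument
     of the last logarithm is [n + 1 + e], so it costs no more than order [ln n]. *)
  have := mass_bound p k n f0 s0 al lam zeta mf0 s00 al0 lam0 zeta0 T r u U M (Wc d) n%:R 1 rho sd th0 (vq d) d
    n1 aln sth rho0 sd0 xc (hvq d) (ltW T0) (Wc0 d) hg1 hg2 b4 (fun w => hWc d w xc hy) g0.
  move=> hm; rewrite /A /= -(@lee_pmul2l _ T%:E)//.
  apply: le_trans hm _; rewrite -EFinM lee_fin; apply: le_trans hB.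
  exact: kl_rhs_mono.
apply: leeD => //.
have pd0 d : (0 <= (p0d d)%:E)%E by rewrite lee_fin p0data_ge0.
have mpd : measurable_fun setT (fun d => (p0d d)%:E) by apply/measurable_EFinP; exact: measurable_p0data.
have mA : measurable_fun setT (fun d => (h1 d)%:E * (p0d d)%:E)%E.
  by apply: emeasurable_funM mpd; exact/measurable_EFinP.
have mB0 : measurable_fun setT (fun d => evidence ph1 d * (p0d d)%:E)%E by exact: (emeasurable_funM mG1 mpd).
have mC0 : measurable_fun setT (fun d => evidence ph2 d * (p0d d)%:E)%E by exact: (emeasurable_funM mG2 mpd).
have qA d : (0 <= (h1 d)%:E * (p0d d)%:E)%E by apply: mule_ge0 => //; rewrite lee_fin.
have qB0 d : (0 <= evidence ph1 d * (p0d d)%:E)%E by exact: mule_ge0.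
have qC0 d : (0 <= evidence ph2 d * (p0d d)%:E)%E by exact: mule_ge0.
have niE : (0 <= (n%:R^-1 : R)%:E)%E by rewrite lee_fin.
have eTE : (0 <= (expR T)%:E)%E by rewrite lee_fin.
rewrite (_ : (fun d => W d * (p0d d)%:E)%E = fun d => ((h1 d)%:E * (p0d d)%:E +
    (n%:R^-1)%:E * (evidence ph1 d * (p0d d)%:E) + (expR T)%:E * (evidence ph2 d * (p0d d)%:E))%E); last first.
  apply/funext => d; rewrite /W ge0_muleDl//; last by apply: adde_ge0 => //; rewrite lee_fin.
  by rewrite ge0_muleDl ?lee_fin// !muleA.
rewrite (iint_lin3 _ _ _ _ _ _ mA mB0 mC0 qA qB0 qC0 niE eTE).
rewrite EFinD; apply: leeD; last first.
  rewrite (iint_evidence p k n f0 s0 mf0 s00 al lam zeta al0 ph2 mph2 ph20).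
  by rewrite EFinM lee_wpmul2l//; exact: prior_tail (ltW M0).
rewrite EFinD; apply: leeD; last first.
  rewrite (iint_evidence p k n f0 s0 mf0 s00 al lam zeta al0 ph1 mph1 ph10).
  have -> : (iint K.+1 (fun w : par => (prior al lam zeta K w * ph1 w)%:E) = 1)%E.
    by under eq_iint do rewrite mulr1; rewrite iint_prior.
  by rewrite mule1.
rewrite (_ : iint _ _ = E0 h1); last by apply: eq_iint => d; rewrite -EFinM.
rewrite /h1 (expect0D p f0 s0 mf0 n _ _ m123 m4)//; last by move=> d; rewrite addr_ge0// addr_ge0.
rewrite (expect0D p f0 s0 mf0 n _ _ m12 m3)//; last by move=> d; rewrite addr_ge0.
rewrite (expect0D p f0 s0 mf0 n _ _ m1 m2)//.
rewrite (expect0Z p f0 s0 mf0 n _ _ measurable_noise_ss noise_ss_ge0 c00) (expect0Z p f0 s0 mf0 n _ _ (measurable_bias_ss th0) (bias_ss_ge0 th0) a2i).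
rewrite (expect0Z p f0 s0 mf0 n _ _ mSf Sf_ge0 c20) (expect0Z p f0 s0 mf0 n _ _ mWc Wc0 eT0).
rewrite !EFinD; apply: leeD; last first.
  rewrite EFinM lee_wpmul2l//; apply: le_trans EWc _.
  by rewrite natrM natrX.
apply: leeD; last first.
  by rewrite [leRHS]EFinM lee_wpmul2l ?lee_fin//; exact: expect0_sum_f0_sqr.
apply: leeD; rewrite [leRHS]EFinM lee_wpmul2l ?lee_fin//.
- exact: expect0_noise_ss.
- exact: expect0_bias_ss.
Qed.

End vb_mass_event.

(** * Asymptotics *)

Section polynomial_growth.
Context {R : realType}.
Implicit Types (u v : nat -> R) (b c : R).

(** The relation [u = O(n^c)]. It turns every rate below into arithmetic of exponents. *)
Definition powO u c := exists2 C : R, 0 <= C & \forall n \near \oo, `|u n| <= C * n%:R `^ c.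

Lemma near_ge (N : nat) : \forall n \near \oo, (N <= n)%N.
Proof. by exists N. Qed.

Lemma powO_le u b c : b <= c -> powO u b -> powO u c.
Proof.
move=> bc [C C0 h]; exists C => //; near=> n.
have n1 : (1 <= n)%N by near: n; exact: near_ge.
have hn : `|u n| <= C * n%:R `^ b by near: n.
apply: le_trans hn _; rewrite ler_wpM2l//.
by apply: ler_powR => //; rewrite ler1n.
Unshelve. all: by end_near. Qed.

Lemma powO_near u v c : (\forall n \near \oo, `|u n| <= `|v n|) -> powO v c -> powO u c.
Proof.
move=> h [C C0 hv]; exists C => //; near=> n.
have h1 : `|u n| <= `|v n| by near: n.
apply: le_trans h1 _; by near: n.
Unshelve. all: by end_near. Qed.

Lemma powO_pow c : powO (fun n => n%:R `^ c) c.
Proof. by exists 1 => //; near=> n; rewrite mul1r ger0_norm// powR_ge0. Unshelve. all: by end_near. Qed.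

Lemma powO_nat : powO (fun n => n%:R) 1.
Proof. by exists 1 => //; near=> n; rewrite mul1r powRr1// ger0_norm. Unshelve. all: by end_near. Qed.

Lemma powO_cst (x : R) : powO (fun=> x) 0.
Proof. by exists `|x| => //; near=> n; rewrite powRr0 mulr1. Unshelve. all: by end_near. Qed.

Lemma powO_add u v c : powO u c -> powO v c -> powO (fun n => u n + v n) c.
Proof.
move=> [C C0 h] [D D0 k]; exists (C + D); first exact: addr_ge0.
near=> n; apply: le_trans (ler_normD _ _) _; rewrite mulrDl; apply: lerD; by near: n.
Unshelve. all: by end_near. Qed.

Lemma powO_opp u c : powO u c -> powO (fun n => - u n) c.
Proof. by move=> h; apply: powO_near h; near=> n; rewrite normrN. Unshelve. all: by end_near. Qed.

Lemma powO_mul u v b c : powO u b -> powO v c -> powO (fun n => u n * v n) (b + c).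
Proof.
move=> [C C0 h] [D D0 k]; exists (C * D); first exact: mulr_ge0.
near=> n; have n1 : (1 <= n)%N by near: n; exact: near_ge.
have hn : `|u n| <= C * n%:R `^ b by near: n.
have kn : `|v n| <= D * n%:R `^ c by near: n.
rewrite normrM powRD; last by apply/implyP => _; rewrite pnatr_eq0 -lt0n.
rewrite mulrACA; exact: ler_pM.
Unshelve. all: by end_near. Qed.

Lemma powO_mulc (x : R) u c : powO u c -> powO (fun n => x * u n) c.
Proof. by move=> h; rewrite -[c]add0r; apply: powO_mul => //; exact: powO_cst. Qed.

Lemma powO_sqr u c : powO u c -> powO (fun n => u n ^+ 2) (c + c).
Proof. by move=> h; under eq_fun do rewrite expr2; exact: powO_mul. Qed.

Lemma cvg_powR_neg c : c < 0 -> (fun n : nat => n%:R `^ c : R) @ \oo --> (0 : R).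
Proof.
move=> c0; have c0' : 0 < - c by rewrite oppr_gt0.
apply/cvgrPdist_le => e e0.
pose N := (Num.truncn ((e^-1) `^ ((- c)^-1))).+1.
have hN : (e^-1) `^ ((- c)^-1) <= N%:R by apply/ltW; exact: truncnS_gt.
near=> n.
have n1 : (1 <= n)%N by near: n; exact: near_ge.
have nN : (N <= n)%N by near: n; exact: near_ge.
rewrite sub0r normrN ger0_norm ?powR_ge0//.
rewrite -[c]opprK powRN invf_ple ?posrE ?powR_gt0 ?ltr0n//.
have -> : e^-1 = (e^-1 `^ (- c)^-1) `^ (- c) by rewrite -powRrM mulVf ?gt_eqF// powRr1// invr_ge0 ltW.
apply: ge0_ler_powR; rewrite ?nnegrE ?powR_ge0// ?(ltW c0')//.
by apply: le_trans hN _; rewrite ler_nat.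
Unshelve. all: by end_near. Qed.

Lemma powO_cvg0 u c : c < 0 -> powO u c -> u @ \oo --> (0 : R).
Proof.
move=> c0 [C C0 h].
have hC : (fun n : nat => C * n%:R `^ c) @ \oo --> (0 : R).
  by rewrite -[X in _ --> X](mulr0 C); apply: cvgM; [exact: cvg_cst|exact: cvg_powR_neg].
have hN : (fun n : nat => - (C * n%:R `^ c)) @ \oo --> (0 : R).
  by rewrite -[X in _ --> X]oppr0; exact: cvgN.
apply: squeeze_cvgr hN hC; near=> n.
by rewrite -ler_norml; near: n.
Unshelve. all: by end_near. Qed.

Lemma powO_small u b c (x : R) : b < c -> 0 < x -> powO u b -> \forall n \near \oo, u n <= x * n%:R `^ c.
Proof.
move=> bc x0 hu.
have h0 : (fun n => u n * n%:R `^ (- c)) @ \oo --> (0 : R).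
  apply: (@powO_cvg0 _ (b + - c)); first by rewrite subr_lt0.
  by apply: powO_mul => //; exact: powO_pow.
have /cvgrPdist_le/(_ _ x0) h := h0.
near=> n.
have n1 : (1 <= n)%N by near: n; exact: near_ge.
have : `|0 - u n * n%:R `^ (- c)| <= x by near: n.
rewrite sub0r normrN => /ler_normlW; rewrite powRN ler_pdivrMr// powR_gt0// ltr0n//.
Unshelve. all: by end_near. Qed.

Lemma ln_le_powR c (x : R) : 0 < c -> 0 < x -> ln x <= x `^ c / c.
Proof.
move=> c0 x0; rewrite ler_pdivlMr// mulrC -ln_powR.
have p0 : 0 < x `^ c by exact: powR_gt0.
apply: le_trans (_ : x `^ c - 1 <= _); last by rewrite gerBl.
by rewrite -[X in ln X](subrK 1) addrC le_ln1Dx// ltrBDr addNr.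
Qed.

Lemma powO_ln c : 0 < c -> powO (fun n => ln n%:R) c.
Proof.
move=> c0; exists c^-1; first by rewrite invr_ge0 ltW.
near=> n.
have n1 : (1 <= n)%N by near: n; exact: near_ge.
rewrite ger0_norm ?ln_ge0 ?ler1n// mulrC.
by apply: ln_le_powR => //; rewrite ltr0n.
Unshelve. all: by end_near. Qed.

(** The logarithm of a polynomially bounded sequence is below every positive power of [n]. The
    exponent is first raised to a nonnegative [d], so that the one inside the logarithm is at most
    [n^d]. *)
Lemma powO_ln1D u b c : 0 < c -> (\forall n \near \oo, 0 <= u n) -> powO u b -> powO (fun n => ln (1 + u n)) c.
Proof.
move=> c0 u0 hu.
have [d d0 hd] : exists2 d, 0 <= d & powO u d.
  by exists (Num.max b 0); [rewrite le_max lexx orbT|apply: powO_le hu; rewrite le_max lexx].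
have [C C0 h] := hd.
apply: (@powO_near _ (fun n => ln (1 + C) + d * ln n%:R)); last first.
  apply: powO_add; last by apply: powO_mulc; exact: powO_ln.
  by apply: powO_le (powO_cst _); exact: ltW.
near=> n.
have n1 : (1 <= n)%N by near: n; exact: near_ge.
have nR : 1 <= n%:R :> R by rewrite ler1n.
have un0 : 0 <= u n by near: n.
have hn : `|u n| <= C * n%:R `^ d by near: n.
rewrite ger0_norm; last by rewrite ln_ge0// lerDl.
apply: le_trans (ler_norm _); rewrite -ln_powR -lnM ?posrE ?ltr_pwDl ?powR_gt0// ?(lt_le_trans ltr01)//.
have p1 : 1 <= n%:R `^ d by apply: le_trans (_ : 1 `^ d <= _); [rewrite powR1|apply: ge0_ler_powR; rewrite ?nnegrE].
rewrite ler_ln ?posrE ?ltr_pwDl ?mulr_gt0 ?ltr_pwDl// ?(lt_le_trans ltr01)//.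
rewrite mulrDl mul1r; apply: lerD => //.
by apply: le_trans hn; exact: ler_norm.
Unshelve. all: by end_near. Qed.

(** Half of [x n^c] absorbs [u], which is of smaller order; on the other half [exp(-t) <= 1/t] gives
    the stated power. *)
Lemma powO_expN u c b (x : R) : 0 < x -> b < c -> 0 < c -> powO u b ->
  powO (fun n => expR (u n - x * n%:R `^ c)) (- c).
Proof.
move=> x0 bc c0 hu; exists (2 / x); first by rewrite divr_ge0// ltW.
have hs := powO_small u b c (x / 2) bc (divr_gt0 x0 (ltr0Sn _ 1)) hu.
near=> n.
have n1 : (1 <= n)%N by near: n; exact: near_ge.
have hn : u n <= x / 2 * n%:R `^ c by near: n.
have p0 : 0 < n%:R `^ c :> R by rewrite powR_gt0// ltr0n.
rewrite ger0_norm ?expR_ge0//.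
apply: (@le_trans _ _ (expR (- (x / 2 * n%:R `^ c)))).
  by rewrite ler_expR; move: (n%:R `^ c) hn => y; lra.
have q0 : 0 < x / 2 * n%:R `^ c by rewrite mulr_gt0// divr_gt0.
rewrite expRN powRN (_ : 2 / x / n%:R `^ c = (x / 2 * n%:R `^ c)^-1); last by field; rewrite !gt_eqF.
rewrite lef_pV2 ?posrE ?expR_gt0//.
by apply: le_trans (expR_ge1Dx _); rewrite lerDr.
Unshelve. all: by end_near. Qed.

End polynomial_growth.

(** * Growth exponents of the quantities in the bound *)

Section rates.
Context {R : realType} (p : nat) (k : nat -> nat).
Variables (s0 al lam zeta : R).
Hypotheses (s00 : 0 < s0) (al0 : 0 < al) (lam0 : 0 < lam) (zeta0 : 0 < zeta).
Notation K := (fun n => (Kpar p (k n))%:R : R).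

Lemma Kpar_powO (a : R) : 0 < a -> (fun n : nat => (k n)%:R / n%:R `^ a) @ \oo --> (1 : R) -> powO K a.
Proof.
move=> a0 hk.
have k_a : powO (fun n => (k n)%:R : R) a.
  exists 2 => //; have /cvgrPdist_le/(_ 1 ltr01) h := hk.
  near=> n; have n1 : (1 <= n)%N by near: n; exact: near_ge.
  have : `|1 - (k n)%:R / n%:R `^ a| <= (1 : R) by near: n.
  have p0 : 0 < n%:R `^ a :> R by rewrite powR_gt0// ltr0n.
  rewrite [`|(k n)%:R|]ger0_norm// -ler_pdivrMr// ler_norml => /andP[h1 _].
  by move: ((k n)%:R / _) h1 => y; lra.
have -> : K = fun n => 1 + ((k n)%:R + (k n)%:R * p.+1%:R).
  by apply/funext => n; rewrite /Kpar -addnA natrD natrD natrM.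
apply: powO_add; first by apply: powO_le (powO_cst _); exact: ltW.
apply: powO_add => //; rewrite -[a]addr0; apply: powO_mul => //; exact: powO_cst.
Unshelve. all: by end_near. Qed.

Lemma powO_inv : powO (fun n => n%:R^-1 : R) (-1).
Proof. by under eq_fun do rewrite -powR_inv1//; exact: powO_pow. Qed.

(** The thresholds for the noise and bias sums exceed the orders of their means by [n^e]; with
    [rho = n^-delta] both contribute exactly the order [n^(1-delta+e)]. *)
Lemma kl_rhs_powO (a delta e : R) (M2 : nat -> R) : 0 < e -> 0 < delta -> delta < 1 - a -> 0 < a ->
  powO K a -> powO M2 (1 - delta) ->
  powO (fun n => kl_rhs p (k n) n s0 al lam zeta (n%:R `^ (- delta)) (n%:R `^ (1 + e))
     (n%:R `^ (1 - 2 * delta + e)) (n%:R `^ (-4)) (M2 n) (n%:R + 1 + expR 1)) (1 - delta + e).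
Proof.
move=> e0 d0 da a0 hK hM.
have c0 (x : R) : powO (fun=> x) (1 - delta + e) by apply: powO_le (powO_cst _); lra.
have hln (c : R) : 0 < c -> powO (fun n => ln n%:R : R) c by exact: powO_ln.
rewrite /kl_rhs; apply: powO_add; last first.
  have -> : (fun n : nat => ln (n%:R + 1 + expR 1) : R) = fun n => ln (1 + (n%:R + expR 1)).
    by apply/funext => n; rewrite addrA [1 + _]addrC.
  apply: (powO_le _ e); first by lra.
  apply: (powO_ln1D _ 1) => //; first by near=> n; rewrite addr_ge0 ?expR_ge0.
  by apply: powO_add; [exact: powO_nat|apply: powO_le (powO_cst _); lra].
have hr : powO (fun n => 1 + (n%:R `^ (- delta))^-1 : R) delta.
  apply: powO_add; first by apply: powO_le (powO_cst _); lra.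
  by under eq_fun do rewrite -powRN opprK; exact: powO_pow.
apply: powO_add; last first.
  apply: (powO_le _ (1 - delta + 0)); first by lra.
  by apply: powO_mul => //; exact: powO_cst.
apply: powO_add; last first.
  (* The divergence of [K] narrow normals from the prior costs [K ln n]; this is where
     [delta < 1 - a] is decisive. *)
  apply: (powO_le _ (a + (e + 0))); first by lra.
  apply: powO_mul => //; apply: powO_mul; last exact: powO_cst.
  apply: powO_add; first by apply: powO_le (powO_cst _); lra.
  under eq_fun do rewrite -powR_mulrn ?powR_ge0// -powRrM ln_powR.
  by apply: powO_opp; apply: powO_mulc; exact: hln.
apply: powO_add; last first.
  apply: powO_add; last exact: c0.
  by apply: powO_le (hln e e0); lra.
apply: powO_add; last first.
  (* The Lipschitz factor grows at most like [n^5], while the squared standard deviation is [n^-8]: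
     the spread of [q'] around its centre is negligible. *)
  apply: (powO_le _ (5 + (0 + (-4 + -4) + a))); first by lra.
  apply: powO_mul; last first.
    by apply: powO_mul => //; apply: powO_mul; [exact: powO_cst|apply: powO_sqr; exact: powO_pow].
  apply: powO_add; first by apply: powO_le (powO_cst _); lra.
  apply: (powO_le _ (delta + (1 + ((1 + 1) + a)) + 0)); first by lra.
  apply: powO_mul; last exact: powO_cst.
  apply: powO_mul => //; apply: powO_mul; first exact: powO_nat.
  apply: powO_mul => //; apply: powO_sqr; apply: powO_add; first by apply: powO_le (powO_cst _); lra.
  by apply: powO_le hM; lra.
apply: powO_add; last exact: c0.
apply: powO_add; last first.
  apply: (powO_le _ (delta + (1 - 2 * delta + e) + 0)); first by lra.
  apply: powO_mul; last exact: powO_cst.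
  by apply: powO_mul => //; exact: powO_pow.
apply: powO_add; first exact: c0.
apply: (powO_le _ (- delta + (1 + e) + 0)); first by lra.
by apply: powO_mul; [apply: powO_mul; exact: powO_pow|exact: powO_cst].
Unshelve. all: by end_near. Qed.

Section error_terms.
Variables (a e : R).
(** The scales [u], [U], [M] are fitted to [prior_tail]: its three parts decay like [exp(-2 T)],
    [exp(-2 T)] and [K exp(-n^2)], and all remain negligible after multiplication by [exp T]. *)
Let T n : R := n%:R `^ (1 - e).
Let u n : R := lam / (4 * T n).
Let U n : R := expR (4 * T n / al).
Let M n : R := 2 * zeta * n%:R.

(** A crude exponent: [1/u] grows at most like [n] and [K M] at most like [n^2], and only the
    logarithm of the mesh enters later. *)
Lemma mesh_inv_powO : 0 < a -> a < 1 -> 0 < e -> e <= 4^-1 -> powO K a ->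
  powO (fun n => mesh_inv p (k n) n (u n) (M n)) 7.
Proof.
move=> a0 a1 e0 e1 hK.
have -> : (fun n => mesh_inv p (k n) n (u n) (M n)) = fun n => n%:R * (2^-1 * (u n)^-1) +
    (n%:R ^+ 2 + n%:R * (K n * M n) ^+ 2) * (u n)^-1 ^+ 2 +
    (1 + M n) * K n * (n%:R + n%:R ^+ 2 + n%:R * (K n * M n)) * (u n)^-1.
  by apply/funext => n; rewrite /mesh_inv /fnet_sup invfM exprVn.
have hV : powO (fun n => (u n)^-1) 1.
  have -> : (fun n => (u n)^-1) = fun n => 4 / lam * T n.
    by apply/funext => n; rewrite /u invf_div mulrAC.
  by apply: powO_mulc; apply: (powO_le _ (1 - e)); [lra|exact: powO_pow].
have hN := @powO_nat R.
have hM : powO M 1 by exact: powO_mulc.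
have hK1 : powO K 1 by apply: powO_le hK; exact: ltW.
have hF : powO (fun n => K n * M n) (1 + 1) by exact: powO_mul.
apply: powO_add; first apply: powO_add.
- apply: (powO_le _ (1 + 1)); first by lra.
  by apply: powO_mul => //; exact: powO_mulc.
- apply: (powO_le _ (5 + (1 + 1))); first by lra.
  apply: powO_mul; last exact: powO_sqr.
  apply: powO_add; first by apply: powO_le (powO_sqr _ _ hN); lra.
  by apply: (powO_le _ (1 + ((1 + 1) + (1 + 1)))); [lra|apply: powO_mul => //; exact: powO_sqr].
- apply: (powO_le _ (1 + 1 + 3 + 1)); first by lra.
  apply: powO_mul => //; apply: powO_mul.
    by apply: powO_mul => //; apply: powO_add => //; apply: powO_le (powO_cst _).
  apply: powO_add; last by apply: (powO_le _ (1 + (1 + 1))); [lra|exact: powO_mul].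
  apply: powO_add; first by apply: powO_le hN; lra.
  by apply: powO_le (powO_sqr _ _ hN); lra.
Qed.

(** The sequence [E] bounds the logarithm of [exp T] times the number of cells. It is of an order
    strictly below [n], so the exponent [n r / 2] wins by [powO_expN]. *)
Lemma cover_powO (r : R) : 0 < a -> a < 1 -> 0 < e -> e <= 4^-1 -> powO K a ->
  0 < r ->
  powO (fun n => expR (T n) * ((ncell1 p (k n) n (u n) (U n) (M n)).+1%:R *
    (ncell2 p (k n) n (u n) (M n)).+1%:R ^+ (Kpar p (k n)) * expR (- (n%:R * (r / 2))))) (-1).
Proof.
move=> a0 a1 e0 e1 hK r0.
pose L n := mesh_inv p (k n) n (u n) (M n).
pose E n := T n + 4 * T n / al + ln (1 + L n) + K n * ln (1 + 2 * M n * L n).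
have L0 : \forall n \near \oo, 0 <= L n.
  near=> n; have n1 : (1 <= n)%N by near: n; exact: near_ge.
  apply/ltW/mesh_inv_gt0 => //; last by rewrite !mulr_gt0// ltr0n.
  by rewrite divr_gt0// mulr_gt0// powR_gt0// ltr0n.
have hE : powO E (Num.max (1 - e) ((1 + a) / 2)).
  set b := Num.max _ _.
  have b1 : 1 - e <= b by rewrite le_max lexx.
  have b2 : (1 + a) / 2 <= b by rewrite le_max lexx orbT.
  have b0 : 0 < b by apply: lt_le_trans b2; rewrite divr_gt0// addr_gt0.
  apply: powO_add; first apply: powO_add; first apply: powO_add.
  - by apply: powO_le b1 _; exact: powO_pow.
  - apply: (powO_le _ (0 + (1 - e) + 0)); first by rewrite addr0 add0r.
    by apply: powO_mul; [apply: powO_mul; [exact: powO_cst|exact: powO_pow]|exact: powO_cst].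
  - by apply: (powO_ln1D _ 7) => //; exact: (mesh_inv_powO a0 a1 e0 e1 hK).
  (* The logarithm may use half of the room between [K], of order [n^a], and [n]. *)
  - apply: (powO_le _ (a + (1 - a) / 2)); first by apply: le_trans b2; lra.
    apply: powO_mul => //; apply: (powO_ln1D _ (0 + 1 + 7)).
    + by rewrite divr_gt0// subr_gt0.
    + near=> n; have h : 0 <= L n by near: n.
      by rewrite !mulr_ge0// ltW.
    + apply: powO_mul; last exact: (mesh_inv_powO a0 a1 e0 e1 hK).
      by apply: powO_mul; [exact: powO_cst|apply: powO_mulc; exact: powO_nat].
have b1 : Num.max (1 - e) ((1 + a) / 2) < 1 by rewrite gt_max; apply/andP; split; lra.
apply: (powO_near _ _ _ _ (powO_expN E 1 _ (r / 2) (divr_gt0 r0 (ltr0Sn _ 1)) b1 ltr01 hE)).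
near=> n; have n1 : (1 <= n)%N by near: n; exact: near_ge.
have L0n : 0 <= L n by near: n.
(* This allows [1 + U L <= U (1 + L)], which separates the exponentially large [U] from the
   polynomial mesh. *)
have U1 : 1 <= U n by rewrite -expR0 ler_expR divr_ge0 ?(ltW al0)// mulr_ge0// powR_ge0.
have M0 : 0 <= M n by rewrite !mulr_ge0// ltW.
have l1 : 0 < 1 + L n by rewrite ltr_pwDl.
have l2 : 0 < 1 + 2 * M n * L n by rewrite ltr_pwDl// mulr_ge0// mulr_ge0.
rewrite !ger0_norm ?expR_ge0 ?mulr_ge0 ?exprn_ge0 ?expR_ge0// powRr1//.
rewrite /E !expRD expRM_natl !lnK ?posrE// [r / 2 * _]mulrC -!(mulrA (expR (T n))).
rewrite ler_wpM2l ?expR_ge0// ler_wpM2r ?expR_ge0// -/(U n).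
apply: ler_pM; rewrite ?exprn_ge0//.
  rewrite -natr1 [U n * _]mulrDr mulr1 addrC; apply: lerD => //.
  by rewrite truncn_le mulr_ge0 ?expR_ge0.
apply: lerXn2r; rewrite ?nnegrE ?(ltW l2)//.
by rewrite -natr1 addrC lerD2l truncn_le mulr_ge0// mulr_ge0.
Unshelve. all: by end_near. Qed.

Lemma tail_powO : 0 < a -> a < 1 -> 0 < e -> e <= 4^-1 -> powO K a ->
  powO (fun n => expR (T n) * tail_mass p (k n) al lam zeta (u n) (U n) (M n)) (- (1 - e)).
Proof.
move=> a0 a1 e0 e1 hK.
pose C := lam `^ (al / 2) * Gammaf (al / 2) / Gammaf al.
have ee : 0 < 1 - e by lra.
have h1 : powO (fun n => expR (0 - 1 * n%:R `^ (1 - e)) : R) (- (1 - e)).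
  exact: (powO_expN _ _ 0 _ ltr01 ee ee (powO_cst 0)).
have h2 : powO (fun n => expR (T n - 1 * n%:R `^ 2) : R) (- 2).
  by apply: (powO_expN _ _ (1 - e)) => //; [lra|exact: powO_pow].
apply: (powO_near _ (fun n => (2 `^ al + C) * expR (0 - 1 * n%:R `^ (1 - e)) + K n * (2 * expR (T n - 1 * n%:R `^ 2)))); last first.
  apply: powO_add; first exact: powO_mulc.
  by apply: (powO_le _ (a + (-2))); [lra|apply: powO_mul => //; exact: powO_mulc].
near=> n; have n1 : (1 <= n)%N by near: n; exact: near_ge.
have nR : 0 < n%:R :> R by rewrite ltr0n.
have T0 : 0 < T n by exact: powR_gt0.
rewrite le_eqVlt; apply/predU1P; left; congr (`| _ |); rewrite /tail_mass -/C.
have -> : lam / 2 / u n = T n + T n by rewrite /u; field; rewrite !gt_eqF.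
have -> : U n `^ (al / 2) = expR (T n + T n).
  by rewrite /U -expRM; congr expR; field; rewrite gt_eqF.
have -> : M n ^+ 2 / (4 * zeta ^+ 2) = n%:R ^+ 2 by rewrite /M; field; rewrite gt_eqF.
rewrite !mul1r sub0r -expRN !opprD !expRD -/(T n) -(powR_mulrn 2) ?(ltW nR)//.
have e1' : expR (T n) * expR (- T n) = 1 by rewrite -expRD subrr expR0.
rewrite !mulrDr !mulrDl; congr (_ + _ + _).
- by rewrite !mulrA e1' mul1r mulrC.
- by rewrite !mulrA e1' mul1r [RHS]mulrC /C !mulrA.
- by ring.
Unshelve. all: by end_near. Qed.

(** The slowest terms are the Markov bounds for the noise and bias sums, each exactly of order
    [n^-e]; all others decay at least as fast because [e <= 1/4]. *)
Lemma error_powO (delta F2 r : R) : 0 < a -> a < 1 -> 0 < e -> e <= 4^-1 -> powO K a ->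
  0 < r ->
  powO (fun n => (((n%:R `^ (1 + e))^-1 + 2 / n%:R ^+ 2) * (n%:R * (8 * s0)) +
     (n%:R `^ (1 - 2 * delta + e))^-1 * (n%:R * (n%:R `^ (- delta)) ^+ 2) + 2 / n%:R ^+ 2 * (n%:R * F2) +
     expR (T n) * ((ncell1 p (k n) n (u n) (U n) (M n)).+1%:R *
       (ncell2 p (k n) n (u n) (M n)).+1%:R ^+ (Kpar p (k n)) * expR (- (n%:R * (r / 2)))) +
     n%:R^-1 + expR (T n) * tail_mass p (k n) al lam zeta (u n) (U n) (M n))) (- e).
Proof.
move=> a0 a1 e0 e1 hK r0.
have hi := powO_inv.
have hi2 : powO (fun n => 2 / n%:R ^+ 2 : R) (-1 + -1).
  by under eq_fun do rewrite -exprVn; apply: powO_mulc; exact: powO_sqr.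
have hN (x : R) : powO (fun n => n%:R * x) 1.
  by rewrite -[X in powO _ X]addr0; apply: powO_mul; [exact: powO_nat|exact: powO_cst].
apply: powO_add; last by apply: powO_le (tail_powO a0 a1 e0 e1 hK); lra.
apply: powO_add; last by apply: powO_le hi; lra.
apply: powO_add; last by apply: powO_le (cover_powO r a0 a1 e0 e1 hK r0); lra.
apply: powO_add; last by apply: (powO_le _ (-1 + -1 + 1)); [lra|exact: powO_mul].
apply: powO_add.
  apply: (powO_le _ (- (1 + e) + 1)); first by lra.
  apply: powO_mul => //; apply: powO_add; last by apply: powO_le hi2; lra.
  by under eq_fun do rewrite -powRN; exact: powO_pow.
apply: (powO_le _ (- (1 - 2 * delta + e) + (1 + (- delta + - delta)))); first by lra.
apply: powO_mul; first by under eq_fun do rewrite -powRN; exact: powO_pow.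
by apply: powO_mul; [exact: powO_nat|apply: powO_sqr; exact: powO_pow].
Qed.

End error_terms.

(** Convergence to zero in the extended reals makes the norm eventually finite and the product at
    most one; squaring removes the root. *)
Lemma L2norm_near (delta : R) (g : forall n : nat, p.-tuple R -> R) :
  (fun n : nat => ((n%:R `^ delta)%:E * L2norm p (g n))%E) @ \oo --> 0%E ->
  \forall n \near \oo, (iint p (fun x => ((in_cube x)%:R * g n x ^+ 2)%:E) <= ((n%:R `^ (- delta)) ^+ 2)%:E)%E.
Proof.
move=> /fine_cvgP[hfin /cvgrPdist_le/(_ 1 ltr01) h].
near=> n; have n1 : (1 <= n)%N by near: n; exact: near_ge.
have nd0 : 0 < n%:R `^ delta :> R by rewrite powR_gt0// ltr0n.
have f1 : ((n%:R `^ delta)%:E * L2norm p (g n))%E \is a fin_num by near: n.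
have f2 : `|0 - fine ((n%:R `^ delta)%:E * L2norm p (g n))%E| <= 1 by near: n.
have : (0 <= iint p (fun x => ((in_cube x)%:R * g n x ^+ 2)%:E))%E.
  by apply: iint_ge0 => x; rewrite lee_fin mulr_ge0// sqr_ge0.
move: f1 f2; rewrite /L2norm; case: (iint _ _) => [x| |]//; last first.
  by rewrite poweRyr ?invr_eq0// gt0_muley ?lte_fin.
rewrite poweR_EFin -EFinM /= lee_fin sub0r normrN => _ h1 x0.
rewrite lee_fin; move: h1; rewrite powR12_sqrt// ger0_norm ?mulr_ge0 ?sqrtr_ge0 ?(ltW nd0)// => h1.
have : Num.sqrt x <= n%:R `^ (- delta) by rewrite powRN -ler_pdivlMl// in h1 *; rewrite mulr1 in h1.
by move=> h2; rewrite -(sqr_sqrtr x0); apply: lerXn2r; rewrite ?nnegrE ?sqrtr_ge0 ?powR_ge0.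
Unshelve. all: by end_near. Qed.

End rates.

(* s0 = sigma_0^2 ; (al, lam, zeta) = (alpha, lambda, zeta) prior hyperparameters;
   k n = number of hidden nodes k_n ; theta0 n = theta_{0n} ;
   qstar n d = variational parameters of pi^* for the data set d of size n ;
   eps = the rate slack epsilon, r = the Hellinger radius varepsilon. *)
Theorem theorem3 (R : realType) (p : nat) (hp : (0 < p)%N)
  (f0 : p.-tuple R -> R) (hf0m : measurable_fun setT f0)
  (hf0L2 : (iint p (fun x => ((in_cube x)%:R * f0 x ^+ 2)%:E) < +oo)%E)
  (s0 : R) (hs0 : 0 < s0)
  (al lam zeta : R) (hal : 0 < al) (hlam : 0 < lam) (hzeta : 0 < zeta)
  (k : nat -> nat) (a : R) (ha : 0 < a < 1)
  (hk : (fun n : nat => (k n)%:R / n%:R `^ a) @ \oo --> (1 : R))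
  (delta : R) (hdelta : 0 < delta < 1 - a)
  (theta0 : nat -> seq R)
  (hsize : forall n, size (theta0 n) = Kpar p (k n))
  (A1 : (fun n : nat =>
          ((n%:R `^ delta)%:E * L2norm p (fun x => (fnet p (k n) (theta0 n) x - f0 x)%R))%E)
        @ \oo --> 0%E)
  (A2 : (fun n : nat =>
          (\sum_(i < Kpar p (k n)) nth 0 (theta0 n) i ^+ 2) / n%:R `^ (1 - delta))
        @ \oo --> (0 : R))
  (qstar : forall n : nat, (n * p.+1).-tuple R -> vparam R)
  (hqstar : forall (n : nat) (d : (n * p.+1).-tuple R),
      is_vb_minimizer al lam zeta p (k n) n d (qstar n d)) :
  forall eps r eta : R, 0 < eps -> 0 < r -> 0 < eta ->
    (fun n : nat =>
       P0n p n f0 s0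
         [set d | (mass_Vc p (k n) f0 s0 r (qstar n d)
                   <= (eta * n%:R `^ (eps - delta))%:E)%E])
    @ \oo --> 1%E.
Proof.
move=> eps r eta eps0 r0 eta0.
have [a0 a1] := andP ha; have [d0 d1] := andP hdelta.
(* The slack is lost twice, in [T = n^(1-e)] and in the order [n^(1-delta+e)] of [kl_rhs], so
   [2 e < eps] is what is needed; the cap [1/4] serves the error terms. *)
pose e := Num.min (eps / 4) 4^-1.
have e0 : 0 < e by rewrite lt_min invr_gt0 ltr0n andbT divr_gt0.
have e1 : e <= 4^-1 by rewrite ge_min lexx orbT.
have e2 : e <= eps / 4 by rewrite ge_min lexx.
have hK := Kpar_powO p k a a0 hk.
have hM : powO (fun n => \sum_(i < Kpar p (k n)) nth 0 (theta0 n) i ^+ 2) (1 - delta).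
  exists 1 => //; have /cvgrPdist_le/(_ 1 ltr01) h := A2.
  near=> n; have n1 : (1 <= n)%N by near: n; exact: near_ge.
  have : `|0 - (\sum_(i < Kpar p (k n)) nth 0 (theta0 n) i ^+ 2) / n%:R `^ (1 - delta)| <= 1 by near: n.
  have p0 : 0 < n%:R `^ (1 - delta) :> R by rewrite powR_gt0// ltr0n.
  by rewrite sub0r normrN normrM [`|_^-1|]ger0_norm ?invr_ge0 ?(ltW p0)// ler_pdivrMr.
pose T (n : nat) : R := n%:R `^ (1 - e).
pose u n : R := lam / (4 * T n).
pose U n : R := expR (4 * T n / al).
pose M n : R := 2 * zeta * n%:R.
have [F2 hF2] : exists F2 : R, (iint p (fun x => ((in_cube x)%:R * f0 x ^+ 2)%:E) <= F2%:E)%E.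
  have : (0 <= iint p (fun x : p.-tuple R => ((in_cube x)%:R * f0 x ^+ 2)%:E))%E.
    by apply: iint_ge0 => x; rewrite lee_fin mulr_ge0// sqr_ge0.
  by move: hf0L2; case: (iint _ _) => [x| |]// _ _; exists x.
have hB := kl_rhs_powO p k s0 al lam zeta a delta e _ e0 d0 d1 a0 hK hM.
have bc : 1 - delta + e < 1 - e + (eps - delta) by lra.
have hB' := powO_small _ _ _ _ bc eta0 hB.
have herr := error_powO p k s0 al lam zeta hal hlam hzeta a e delta F2 r a0 a1 e0 e1 hK r0.
set err := (X in powO X) in herr.
have err0 : err @ \oo --> (0 : R) by apply: powO_cvg0 herr; rewrite oppr_lt0.
have hA1 := L2norm_near p delta _ A1.
have lower : (fun n => (1 - err n)%:E) @ \oo --> (1 : \bar R)%E.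
  apply: cvg_EFin; first by near=> n.
  by rewrite -[X in _ --> X](subr0 1); apply: cvgB => //; exact: cvg_cst.
apply: squeeze_cvge lower (cvg_cst _); near=> n.
have n1 : (1 < n)%N by near: n; exact: near_ge.
have n0 : 0 < n%:R :> R by rewrite ltr0n (ltn_trans _ n1).
have aln : al <= n%:R by near: n; exact: nbhs_infty_ger.
have T0 : 0 < T n by exact: powR_gt0.
rewrite P0n_le1// andbT EFinB leeBlDr//.
apply: (vb_mass_event p (k n) n f0 s0 al lam zeta hf0m hs0 hal hlam hzeta (T n) r (u n) (U n) (M n)
  (n%:R `^ (- delta)) (n%:R `^ (-4)) _ _ _ _ _ (theta0 n) (qstar n)) => //; rewrite ?powR_gt0//.
- by rewrite divr_gt0// mulr_gt0.
- exact: expR_gt0.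
- by rewrite !mulr_gt0.
- rewrite (_ : (fun x : p.-tuple R => _) =
    fun x => ((in_cube x)%:R * (fnet p (k n) (theta0 n) x - f0 x) ^+ 2)%:E); last first.
    by apply/funext => x; rewrite -[in RHS]opprB sqrrN.
  by near: n.
(* The target level times [T] is [eta n^(1-e+eps-delta)], an exponent above that of [kl_rhs] by
   [bc]. *)
rewrite mulrCA -powRD; last by rewrite (gt_eqF n0) implybT.
by near: n.
Unshelve. all: by end_near. Qed.
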